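(* Fix finite sets of exponents and integers as in the setting of the context. There is a finite set of primes $P$, depending only on $\mathrm{supp} f$ and containing the primes dividing $b$, such that if $\mathrm{char}\,\mathbf{F}_q \notin P$ and $h \neq 0$, then for all $I \subseteq \{1,\ldots,s\}$ and all $0 \leq d \leq t$, \[ \dim V_{I,d} + \frac{t+d}{2} + \#I - n \leq -\sigma(f_I) - s + \#I. \]
   Context: Setting: $\mathbf{F}_q$ is a finite field; $x = (x_1,\ldots,x_s)$, $y=(y_1,\ldots,y_t)$, $z = (z_1,\ldots,z_r)$ are variables with $s,t \geq 0$, $r \geq 1$, $n = s+t+r$. $f \in \mathbf{F}_q[x,y,z]$ is non-degenerate with respect to the faces of its Newton polyhedron at the origin (for every non-empty face $\tau$ of $\Delta_0(f) = \mathrm{conv}(\mathrm{supp} f)+\mathbf{R}^n_{\geq 0}$, the partial derivatives of $f_\tau$, the sum of the terms of $f$ with exponent in $\tau$, have no common zero in $(\overline{\mathbf{F}}_q^\ast)^n$). There are an integer $b>0$ and integers $w_1,\ldots,w_t$ with $0 < w_j < b$ such that, assigning weight $b$ to each $x_i$, weight $w_j$ to $y_j$ and weight $0$ to each $z_\ell$, every monomial of $f$ has weighted degree $b$; $r$ is maximal, i.e. $\mathrm{supp} f$ is not contained in any hyperplane $\sum_j c_j i_j = b'$ with $b'>0$, $c_j \in \mathbf{Z}_{\geq 0}$, having more than $r$ coefficients equal to $0$. Write $f = h + g_1x_1 + \cdots + g_sx_s$ with $g_i \in \mathbf{F}_q[z]\setminus\{0\}$ and $h \in \mathbf{F}_q[y,z]$.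 For $I \subseteq\{1,\ldots,s\}$, $f_I = h + \sum_{i\in I} g_i x_i$. For $z \in \overline{\mathbf{F}}_q^r$, $C_{h(\cdot,z)} \subseteq \mathbf{A}^t$ is the set of $y \in \overline{\mathbf{F}}_q^t$ at which all $\partial h(\cdot,z)/\partial y_j$ vanish (all of $\mathbf{A}^t$ if $h(\cdot,z)=0$). $V_{I,d} = \{ z \in (\overline{\mathbf{F}}_q^\ast)^r : \dim C_{h(\cdot,z)} = d, \text{ and } g_i(z) = 0 \Leftrightarrow i \in I\}$, and $\dim V_{I,d}$ is the dimension of its Zariski closure ($-\infty$ if empty). $\sigma(u)$ is the supremum of the $\sigma>0$ with $(1/\sigma,\ldots,1/\sigma) \in \Delta_0(u)$. *)

(* Defs.v *)
From HB Require Import structures.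
From mathcomp Require Import all_boot all_order all_algebra.
(* mpoly must be imported before the mathcomp-analysis libraries: in the other
   order their notations are incompatible. *)
From mathcomp Require Import mpoly.
From mathcomp Require Import boolp classical_sets reals constructive_ereal ereal.

Set Implicit Arguments.
Unset Strict Implicit.
Unset Printing Implicit Defensive.

Import Order.TTheory GRing.Theory Num.Theory.

Local Open Scope classical_set_scope.
Local Open Scope ring_scope.

Section Zariski.
Variables (K : fieldType) (n : nat).
Implicit Types A B Z : set ('I_n -> K).

Definition zero_locus (E : set {mpoly K[n]}) : set ('I_n -> K) :=
  [set a | forall p, E p -> p.@[a] = 0].

Definition zclosed A := exists E, A = zero_locus E.

Definition zclosure A : set ('I_n -> K) :=
  \bigcap_(B in [set B | zclosed B /\ A `<=` B]) B.

Definition zirreducible Z :=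
  [/\ zclosed Z, Z !=set0 &
      forall A B, zclosed A -> zclosed B -> Z = A `|` B -> Z = A \/ Z = B].

(* Z contains a strict chain c 0, ..., c k of irreducible closed subsets. *)
Definition has_zchain Z (k : nat) :=
  exists c : nat -> set ('I_n -> K),
    (forall i, (i <= k)%N -> zirreducible (c i) /\ c i `<=` Z) /\
    (forall i, (i < k)%N -> c i `<` c i.+1).

(* Krull dimension, meant for closed Z; it is -oo when Z is empty. *)
Definition zdim (R : realType) Z : \bar R :=
  ereal_sup [set (k%:R)%:E | k in has_zchain Z].

End Zariski.

Section Newton.
Variables (R : realType) (n : nat).

Definition conv_hull (A : set 'rV[R]_n) : set 'rV[R]_n :=
  [set a | exists (k : nat) (p : 'I_k -> 'rV[R]_n) (l : 'I_k -> R),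
      [/\ forall i, A (p i), forall i, 0 <= l i, \sum_i l i = 1 &
          a = \sum_i l i *: p i]].

Definition exponent (m : 'X_{1..n}) : 'rV[R]_n := \row_i (m i)%:R.

Definition newton (F : fieldType) (p : {mpoly F[n]}) : set 'rV[R]_n :=
  [set u + v | u in conv_hull [set exponent m | m in [set` msupp p]]
             & v in [set v : 'rV[R]_n | forall i, 0 <= v 0 i]].

(* Faces are cut out by valid linear inequalities; D itself is a face
   (c = 0, c0 = 0), and the empty face is allowed. *)
Definition face (D tau : set 'rV[R]_n) :=
  exists (c : 'rV[R]_n) (c0 : R),
    (forall a, D a -> c0 <= \sum_i c 0 i * a 0 i) /\
    tau = [set a | D a /\ \sum_i c 0 i * a 0 i = c0].

Definition face_part (F : fieldType) (p : {mpoly F[n]}) (tau : set 'rV[R]_n) :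
    {mpoly F[n]} :=
  \sum_(m <- msupp p | `[< tau (exponent m) >]) p@_m *: 'X_[m].

Definition newton_nondegenerate (F K : fieldType) (iota : {rmorphism F -> K})
    (p : {mpoly F[n]}) :=
  forall tau, face (newton p) tau -> tau !=set0 ->
  ~ exists a : 'I_n -> K, (forall i, a i != 0) /\
      forall i, (map_mpoly iota (mderiv i (face_part p tau))).@[a] = 0.

Definition sigma (F : fieldType) (p : {mpoly F[n]}) : \bar R :=
  ereal_sup [set x%:E | x in [set x : R | 0 < x /\ newton p (const_mx x^-1)]].

End Newton.

Arguments newton_nondegenerate R {n F K}.

Definition in_hyperplane n (S : seq 'X_{1..n}) (c : 'I_n -> nat) (b : nat) :=
  forall m, m \in S -> (\sum_i c i * m i)%N = b.

(* The s + (t + r) variables are ordered as x (s of them), y (t of them),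
   z (r of them). *)
Section Setting.
Variables s t r : nat.
Notation N := (s + (t + r))%N.

Definition weight (b : nat) (w : 'I_t -> nat) (i : 'I_N) : nat :=
  match split i with
  | inl _ => b
  | inr k => match split k with inl j => w j | inr _ => 0%N end
  end.

Section Polynomials.
Variable F : fieldType.

Definition rename m n (e : 'I_m -> 'I_n) (p : {mpoly F[m]}) : {mpoly F[n]} :=
  p \mPo [tuple 'X_(e i) | i < m].

(* h lives in F[y, z] and each g i in F[z]. *)
Definition partial_sum (h : {mpoly F[t + r]}) (g : 'I_s -> {mpoly F[r]})
    (I : {set 'I_s}) : {mpoly F[N]} :=
  rename (@rshift s (t + r)) h +
  \sum_(i in I) rename (fun l => rshift s (rshift t l)) (g i)
                * 'X_(lshift (t + r) i).

End Polynomials.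

Section Strata.
Variables (F K : fieldType) (iota : {rmorphism F -> K}).

(* h(., z), as a polynomial in y over K *)
Definition fiber (h : {mpoly F[t + r]}) (z : 'I_r -> K) : {mpoly K[t]} :=
  map_mpoly iota h \mPo
    [tuple match split i with inl j => 'X_j | inr l => (z l)%:MP end
     | i < t + r].

Definition crit_locus (u : {mpoly K[t]}) : set ('I_t -> K) :=
  [set y | forall j, (mderiv j u).@[y] = 0].

Definition stratum (R : realType) (h : {mpoly F[t + r]})
    (g : 'I_s -> {mpoly F[r]}) (I : {set 'I_s}) (d : nat) : set ('I_r -> K) :=
  [set z | [/\ forall l, z l != 0,
               zdim R (crit_locus (fiber h z)) = (d%:R)%:E &
               forall i, (map_mpoly iota (g i)).@[z] = 0 <-> i \in I]].

End Strata.

End Setting.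

(* Main.v *)
(** Write k for the dimension of V_{I,d}; the inequality reads
    k + sigma(f_I) <= r + (t - d) / 2.  A chain of length k in the closure of V_{I,d}
    makes k of the coordinates z_l (those in J') independent on V_{I,d}, and on C_{h(.,z)}
    some d of the coordinates y_j (those in J, fixed by pigeonhole) are independent.

    If the combinatorial bound below failed in infinitely many characteristics, then an
    ultraproduct of the counterexamples, with z avoiding all low-degree relations over
    the finite fields, would give a characteristic-zero point z with z_{J'} algebraically
    independent over the field of coefficients of f.  There derivations D_l dual to z_{J'}
    exist.  Since f(0,y,z) vanishes for y in the cone C = C_{h(.,z)}, applying D_l shows
    that sum_q D_l(z_q) df/dz_q vanishes on C.  The D_l are orthogonal to the gradients of
    the g_i, i in I, which are independent by non-degeneracy, so r - #I - k further
    weighted-homogeneous equations kill all df/dz_q, up to a combination of these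
    gradients that is absorbed by the x_i.  These equations cut C in dimension at least
    d - (r - #I - k).  Let A be the set of nonzero y-coordinates of a generic point of the
    cut and B the set of the y_j occurring linearly over A, z in a monomial of f.
    Non-degeneracy at this point excludes monomials supported on A, z and bounds
    #A - #B from below; weights adapted to A, B and I then bound sigma(f_I). *)

Require Import Defs.
From HB Require Import structures.
From mathcomp Require Import all_boot all_order all_algebra.
From mathcomp Require Import mpoly.
From mathcomp Require Import boolp classical_sets reals constructive_ereal ereal.
From mathcomp Require Import generic_quotient ring_quotient fraction filter.
From mathcomp Require Import ring zify lra.

Set Implicit Arguments.
Unset Strict Implicit.
Unset Printing Implicit Defensive.

Import Order.TTheory GRing.Theory Num.Theory.
Local Open Scope ring_scope.

(** * Prime ideals and residue fields *)

(** Why pass to a limit: the argument uses derivations dual to independent coordinates and the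
    inverse of the Euler factor [b], both available in characteristic 0, while the data live over
    finite fields. The bound sought, [weighted_cover], mentions only [S], [I], [J] and [J'], so it
    has the same meaning in the limit and in every characteristic. The set of excluded primes
    obtained by contradiction thus depends on the support alone and is not explicit.

    Finiteness of the coefficient fields supplies the points: only finitely many polynomials of
    bounded degree are to be avoided, so their product is a single nonzero polynomial.

    Dimension is measured by coordinates that are algebraically independent modulo an ideal, and its
    changes are controlled by counting monomials. An equation could miss a general affine set
    altogether; homogeneity for positive weights excludes this, so that each cut costs at most one
    dimension.

    The generic point of the cut lies in an extension of the limit field, where non-degeneracy must
    still hold. The weak Nullstellensatz carries it there; its short proof rests on uncountability,
    which ultraproducts provide. *)

Record is_ideal (R : comNzRingType) (I : R -> Prop) : Prop := IsIdeal {
  ideal0 : I 0;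
  idealD : forall x y, I x -> I y -> I (x + y);
  idealM : forall a x, I x -> I (a * x) }.

Lemma idealB (R : comNzRingType) (I : R -> Prop) (hI : is_ideal I) x y :
  I x -> I y -> I (x - y).
Proof. by move=> Ix Iy; apply: idealD => //; rewrite -mulN1r; apply: idealM. Qed.

Lemma ideal_sum (R : comNzRingType) (I : R -> Prop) (hI : is_ideal I)
    (J : Type) (s : seq J) (P : pred J) (G : J -> R) :
  (forall j, P j -> I (G j)) -> I (\sum_(j <- s | P j) G j).
Proof. by move=> h; elim/big_rec: _ => [|j x Pj Ix]; [case: hI | apply: idealD; auto]. Qed.

Section PrimeField.
Variables (R : comNzRingType) (P : R -> Prop).
Hypotheses (idealP : is_ideal P) (P1 : ~ P 1)
  (primeP : forall x y, P (x * y) -> P x \/ P y).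

Let Pb : {pred R} := fun x => `[< P x >].

Let Pb_idealr : idealr_closed Pb.
Proof.
split; first by apply/asboolP; exact: ideal0 idealP.
  by apply/negP => /asboolP.
move=> a x y /asboolP Px /asboolP Py; apply/asboolP.
by apply: idealD => //; apply: idealM.
Qed.

HB.instance Definition _ := isIdealr.Build R Pb Pb_idealr.

Let Pb_prime : prime_idealr_closed Pb.
Proof.
by move=> x y /asboolP /primeP[] h; apply/orP; [left|right]; apply/asboolP.
Qed.

HB.instance Definition _ := isPrimeIdealrClosed.Build R Pb Pb_prime.

Definition prime_quot : Type := {ideal_quot Pb}.
HB.instance Definition _ := GRing.ComNzRing.on prime_quot.

(** Inverses are chosen classically, only to place the quotient among the integral domains; the
    field is its fraction field. *)
Let unit_quot : pred prime_quot := fun x => `[< exists y, y * x = 1 >].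
Let inv_quot (x : prime_quot) : prime_quot :=
  if pselect (exists y, y * x = 1) is left e then sval (cid e) else x.

Let mulVq : {in unit_quot, left_inverse 1 inv_quot *%R}.
Proof.
move=> x /asboolP ux; rewrite /inv_quot; case: pselect => // e.
by case: (cid e).
Qed.

Let unitqP (x y : prime_quot) : y * x = 1 -> unit_quot x.
Proof. by move=> h; apply/asboolP; exists y. Qed.

Let inv_out : {in [predC unit_quot], inv_quot =1 id}.
Proof.
move=> x /negP nu; rewrite /inv_quot; case: pselect => // e.
by case: nu; apply/asboolP.
Qed.

HB.instance Definition _ :=
  GRing.ComNzRing_hasMulInverse.Build prime_quot mulVq unitqP inv_out.

Let quot_idomain (x y : prime_quot) : x * y = 0 -> (x == 0) || (y == 0).
Proof. exact: (@Quotient.rquot_IdomainAxiom R Pb). Qed.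

HB.instance Definition _ :=
  GRing.ComUnitRing_isIntegral.Build prime_quot quot_idomain.

Lemma prime_ideal_field : exists (L : fieldType) (phi : {rmorphism R -> L}),
  (forall x, phi x = 0 <-> P x) /\
  (forall u, exists a b, phi b != 0 /\ u = phi a / phi b).
Proof.
pose pi : {rmorphism R -> prime_quot} := \pi_({ideal_quot Pb})%qT.
have phi0 x : (FracField.tofrac (pi x) == 0) = `[< P x >].
  rewrite tofrac_eq0 -[0](rmorph0 pi) /pi /=.
  by rewrite -Quotient.idealrBE subr0.
have surj (q : prime_quot) : exists x, q = pi x.
  by exists (repr (q : {ideal_quot Pb})); rewrite /pi /= reprK.
exists {fraction prime_quot}, (@FracField.tofrac prime_quot \o pi); split=> [x|u] /=.
  by split=> [/eqP|h]; [rewrite phi0 => /asboolP | apply/eqP; rewrite phi0; apply/asboolP].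
have [a ea] := surj ((frac (repr u)).1); have [b eb] := surj ((frac (repr u)).2).
exists a, b; rewrite -ea -eb tofrac_eq0 denom_ratioP; split=> //.
apply: (canRL (mulfK _)); first by rewrite tofrac_eq0 denom_ratioP.
rewrite -{1}[u]reprK; unlock FracField.tofrac.
rewrite -[LHS]FracField.pi_mul; apply/eqmodP => /=.
rewrite /FracField.mulf /= !numden_Ratio ?(oner_neq0, mul1r, mulr1) ?denom_ratioP //.
by rewrite /FracField.equivf !numden_Ratio ?oner_neq0 ?denom_ratioP // mulr1 mulrC.
Qed.
End PrimeField.

Lemma maximal_ideal_avoiding (R : comNzRingType) (I S : R -> Prop) :
  is_ideal I -> S 1 -> (forall x, I x -> ~ S x) ->
  exists P : R -> Prop, [/\ is_ideal P, forall x, I x -> P x,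
    forall x, P x -> ~ S x &
    forall x, ~ P x -> exists s a, S s /\ P (s - a * x)].
Proof.
move=> hI S1 IS.
pose good (A : set R) := A = set0 \/
  [/\ is_ideal A, forall x, I x -> A x & forall x, A x -> ~ S x].
have goodI : good I by right; split.
have [F Fgood tot|P [gP maxP]] := @Zorn_bigcup R good.
  have [->|/eqP/set0P[A FA]] := EM ((\bigcup_(X in F) X) = set0)%classic; first by left.
  right; split.
  - split=> [|x y|a x].
    + have [B FB [z Bz]] : exists2 B, F B & exists z, B z by case: FA => B ? ?; exists B => //; exists A.
      exists B => //; case: (Fgood _ FB) => [B0|[hB _ _]]; last exact: ideal0 hB.
      by rewrite B0 in Bz.
    + move=> [B FB Bx] [C FC Cy].
      have [BC|CB] := tot B C FB FC.
        exists C => //; case: (Fgood _ FC) => [C0|[hC _ _]]; first by rewrite C0 in Cy.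
        by apply: idealD => //; apply: BC.
      exists B => //; case: (Fgood _ FB) => [C0|[hC _ _]]; first by rewrite C0 in Bx.
      by apply: idealD => //; apply: CB.
    + move=> [B FB Bx]; exists B => //; case: (Fgood _ FB) => [B0|[hB _ _]].
        by rewrite B0 in Bx.
      exact: idealM.
  - case: FA => B FB Bz x Ix; exists B => //.
    case: (Fgood _ FB) => [B0|[_ IB _]]; last exact: IB.
    by rewrite B0 in Bz.
  - move=> x [B FB Bx]; case: (Fgood _ FB) => [B0|[_ _]]; last exact.
    by rewrite B0 in Bx.
have [P0|[hP IP PS]] := gP.
  exfalso; apply: (maxP I) => //; rewrite P0; split=> // h.
  by apply: (h 0); exact: ideal0 hI.
exists P; split=> // x Px; apply: contrapT => nS.
pose Q : set R := fun y => exists p a, P p /\ y = p + a * x.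
apply: (maxP Q).
  split=> [y Py|QP]; first by exists y, 0; rewrite mul0r addr0.
  by apply/Px/QP; exists 0, 1; rewrite mul1r add0r; split=> //; exact: ideal0 hP.
right; split.
- split.
  + by exists 0, 0; rewrite mul0r add0r; split=> //; exact: ideal0 hP.
  + move=> _ _ [p [a [Pp ->]]] [q [c [Pq ->]]]; exists (p + q), (a + c).
    by rewrite mulrDl addrACA; split=> //; apply: idealD.
  + move=> c _ [p [a [Pp ->]]]; exists (c * p), (c * a).
    by rewrite mulrDr mulrA; split=> //; apply: idealM.
- by move=> y /IP Py; exists y, 0; rewrite mul0r addr0.
- move=> _ [p [a [Pp ->]]] Ss; apply: nS; exists (p + a * x), a.
  by rewrite addrK.
Qed.

(** An ideal maximal among those that miss the multiplicative set [S] is prime. With [S] the nonzero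
    polynomials in chosen coordinates this gives a point at which these coordinates stay
    independent. *)
Lemma field_avoiding (R : comNzRingType) (I S : R -> Prop) :
  is_ideal I -> S 1 -> (forall x y, S x -> S y -> S (x * y)) ->
  (forall x, I x -> ~ S x) ->
  exists (L : fieldType) (phi : {rmorphism R -> L}),
    [/\ forall x, I x -> phi x = 0, forall x, S x -> phi x != 0,
        forall x, phi x != 0 -> exists s a, S s /\ phi (a * x) = phi s &
        forall u, exists a b, phi b != 0 /\ u = phi a / phi b].
Proof.
move=> hI S1 SM IS; have [P [hP IP PS maxP]] := maximal_ideal_avoiding hI S1 IS.
have P1 : ~ P 1 by move=> /PS.
have primeP x y : P (x * y) -> P x \/ P y.
  move=> Pxy; apply/or_asboolP; rewrite -[_ || _]negbK negb_or.
  apply/negP => /andP[/asboolPn /maxP[s [a [Ss Ps]]] /asboolPn /maxP[s' [a' [Ss' Ps']]]].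
  apply: (PS (s * s')); last exact: SM.
  have -> : s * s' = s' * (s - a * x) + a * x * (s' - a' * y) + a * a' * (x * y) by ring.
  by apply: idealD => //; [apply: idealD => //|]; apply: idealM.
have [L [phi [phi0 surj]]] := prime_ideal_field hP P1 primeP.
exists L, phi; split=> // [x /IP|x Sx|x /eqP nx]; first by rewrite phi0.
  by apply/eqP => /phi0 /PS.
have [s [a [Ss Ps]]] : exists s a, S s /\ P (s - a * x).
  by apply: maxP => /phi0.
exists s, a; split=> //; apply/esym/eqP; rewrite -subr_eq0 -rmorphB.
exact/eqP/phi0.
Qed.

(** With [S] reduced to 1, every nonzero value is already invertible inside the image, so no
    fractions remain. *)
Lemma residue_field (R : comNzRingType) (I : R -> Prop) :
  is_ideal I -> ~ I 1 ->
  exists (L : fieldType) (phi : {rmorphism R -> L}),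
    (forall x, I x -> phi x = 0) /\ (forall u, exists a, u = phi a).
Proof.
move=> hI I1; have [||x Ix e|L [phi [h0 hS hm hf]]] :=
    @field_avoiding R I (fun x => x = 1) hI.
- by [].
- by move=> x y -> ->; rewrite mulr1.
- by rewrite e in Ix.
exists L, phi; split=> // u; have [a [b [nb ->]]] := hf u.
have [_ [c [-> ec]]] := hm b nb; exists (a * c); rewrite rmorphM.
by congr (_ * _); apply: (mulIf nb); rewrite mulVf // -rmorphM ec rmorph1.
Qed.

(** * The weak Nullstellensatz over uncountable fields *)

Lemma lin_dep (k : fieldType) (I T : finType) (A : I -> T -> k) :
  (#|T| < #|I|)%N ->
  exists lam : I -> k,
    (exists i, lam i != 0) /\ forall t, \sum_i lam i * A i t = 0.
Proof.
move=> ltTI; pose M := \matrix_(i < #|I|, t < #|T|) A (enum_val i) (enum_val t).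
have : kermx M != 0.
  by rewrite -mxrank_eq0 mxrank_ker -lt0n subn_gt0 (leq_ltn_trans (rank_leq_col M)).
case/rowV0Pn => v /sub_kermxP vM /eqP nv.
exists (fun i => v 0 (enum_rank i)); split.
  apply: contrapT => h; apply: nv; apply/rowP => j; rewrite mxE.
  by apply/eqP/negPn/negP => nj; apply: h; exists (enum_val j); rewrite enum_valK.
move=> t; move/rowP/(_ (enum_rank t)): vM; rewrite !mxE => e; rewrite -[RHS]e {e}.
rewrite (reindex_onto enum_val enum_rank) /=; last by move=> i _; rewrite enum_rankK.
rewrite (eq_bigl xpredT) => [|i]; last by rewrite enum_valK eqxx.
by apply: eq_bigr => i _; rewrite mxE enum_rankK enum_valK.
Qed.

Lemma finite_of_bounded (T : eqType) (A : T -> Prop) (D : nat) :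
  (forall s : seq T, uniq s -> (forall x, x \in s -> A x) -> (size s <= D)%N) ->
  exists l : seq T, forall x, A x -> x \in l.
Proof.
move=> hD.
pose P m := `[< exists s : seq T, [/\ uniq s, forall x, x \in s -> A x & size s = m] >].
have exP : exists m, P m by exists 0%N; apply/asboolP; exists [::].
have leP m : P m -> (m <= D)%N by move=> /asboolP[s [us As <-]]; apply: hD.
case: (ex_maxnP exP leP) => m /asboolP[s [us As <-]] smax.
exists s => x Ax; apply/negPn/negP => nx.
have /smax : P (size s).+1.
  apply/asboolP; exists (x :: s); split=> //=; first by rewrite nx.
  by move=> y; rewrite inE => /predU1P[->|/As].
by rewrite ltnn.
Qed.

(** A predicate and not a structure, since an ultraproduct is obtained as a bare [fieldType]. The
    size condition excludes nonzero constants and allows [p = 0]. *)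
Definition alg_closed (k : fieldType) :=
  forall p : {poly k}, size p != 1 -> exists x, root p x.

(** Countable sets enter as sequences of finite lists, the form in which [residue_in_base] meets
    them: one list for each degree. *)
Definition uncountable (k : fieldType) :=
  forall l : nat -> seq k, exists x, forall m, x \notin l m.

Lemma mpoly_ring_ind (R : comNzRingType) (n : nat) (Q : {mpoly R[n]} -> Prop) :
  (forall c, Q c%:MP) -> (forall i, Q 'X_i) ->
  (forall p q, Q p -> Q q -> Q (p + q)) -> (forall p q, Q p -> Q q -> Q (p * q)) ->
  forall p, Q p.
Proof.
move=> QC QX QD QM p; rewrite (mpolyE p); elim/big_rec: _ => [|m q _ Qq].
  by rewrite -mpolyC0.
apply: (QD) => //; rewrite -mul_mpolyC; apply: (QM) => //; rewrite mpolyXE_id.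
elim/big_rec: _ => [|i r _ Qr]; first by rewrite -mpolyC1.
apply: (QM) => //; elim: (m i) => [|e IH]; first by rewrite expr0 -mpolyC1.
by rewrite exprS; apply: (QM).
Qed.

Lemma map_mpoly_meval (R S : comNzRingType) (f : {rmorphism R -> S}) (n : nat)
    (p : {mpoly R[n]}) (a : 'I_n -> R) :
  (map_mpoly f p).@[f \o a] = f p.@[a].
Proof.
elim/mpoly_ring_ind: p => [c|i|p q IHp IHq|p q IHp IHq].
- by rewrite map_mpolyC !mevalC.
- by rewrite map_mpolyX !mevalXU.
- by rewrite (rmorphD (map_mpoly f)) /= !mevalD (rmorphD f) IHp IHq.
- by rewrite (rmorphM (map_mpoly f)) /= !mevalM (rmorphM f) IHp IHq.
Qed.

Lemma mpoly_rmorphE (R S : comNzRingType) (n : nat) (f : {rmorphism {mpoly R[n]} -> S})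
    (g : {rmorphism R -> S}) (p : {mpoly R[n]}) :
  (forall c, f c%:MP = g c) -> f p = (map_mpoly g p).@[fun i => f 'X_i].
Proof.
move=> fg; elim/mpoly_ring_ind: p => [c|i|p q IHp IHq|p q IHp IHq].
- by rewrite map_mpolyC mevalC fg.
- by rewrite map_mpolyX mevalXU.
- by rewrite (rmorphD (map_mpoly g)) /= mevalD rmorphD IHp IHq.
- by rewrite (rmorphM (map_mpoly g)) /= mevalM rmorphM IHp IHq.
Qed.

Lemma alg_closed_root (k M : fieldType) (f : {rmorphism k -> M}) (t : M)
    (p : {poly k}) :
  alg_closed k -> p != 0 -> root (map_poly f p) t -> exists c, t = f c.
Proof.
move=> clk; elim: {p}(size p) {-2}p (leqnn (size p)) => [|m IH] p.
  by rewrite size_poly_leq0 => /eqP ->; rewrite eqxx.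
move=> sp np; have [/eqP/size_poly1P[c nc ->]|s1] := eqVneq (size p) 1%N.
  by rewrite map_polyC rootC fmorph_eq0 (negPf nc).
have [c /factor_theorem[q e]] := clk p s1.
have nq : q != 0 by apply: contraNneq np => q0; rewrite e q0 mul0r.
rewrite e rmorphM rootM /= map_polyXsubC root_XsubC => /orP[|/eqP ->]; last by exists c.
apply: IH => //; by move: sp; rewrite e size_Mmonic ?monicXsubC // size_XsubC addn2.
Qed.

Section WeakNullstellensatz.
Variables (k : fieldType) (n : nat).
Hypotheses (clk : alg_closed k) (unk : uncountable k).
Variables (M : fieldType) (phi : {rmorphism {mpoly k[n]} -> M}).
Hypothesis surj : forall u, exists p, u = phi p.

Let iota : {rmorphism k -> M} := phi \o (@mpolyC n k).

(* If t were transcendental, the inverses of t - c for the uncountably many c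
   in k would be linearly independent in a space of countable dimension. *)
Lemma residue_in_base (t : M) : exists c, t = iota c.
Proof.
apply: contrapT => nt.
have ntc c : t - iota c != 0.
  by rewrite subr_eq0; apply/eqP => e; apply: nt; exists c.
have transc (p : {poly k}) : root (map_poly iota p) t -> p = 0.
  by move=> rt; apply/eqP/negPn/negP => np; apply: nt; apply: alg_closed_root np rt.
(* The [c] for which the inverse of [t - c] has a representative of degree below [m]. More of them
   than monomials of that degree would force a linear relation between the inverses. *)
pose A m c := exists p : {mpoly k[n]}, (msize p <= m)%N /\ phi p = (t - iota c)^-1.
have finA m : exists l : seq k, forall c, A m c -> c \in l.
  apply: (@finite_of_bounded _ _ #|{: 'X_{1..n < m}}|) => s us As.
  rewrite leqNgt; apply/negP => lts.
  have /choice[P hP] : forall j : 'I_(size s), exists p : {mpoly k[n]},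
      (msize p <= m)%N /\ phi p = (t - iota (tnth (in_tuple s) j))^-1.
    by move=> j; apply: As; exact: mem_tnth.
  have [|lam [[j nj] hlam]] := @lin_dep k 'I_(size s) {: 'X_{1..n < m}}
    (fun j u => (P j)@_u); first by rewrite card_ord.
  have sum0 : \sum_i lam i *: P i = 0.
    apply/mpolyP => u; rewrite raddf_sum mcoeff0 /=.
    have [lt|ge] := ltnP (mdeg u) m.
      by rewrite -[RHS](hlam (BMultinom lt)); apply: eq_bigr => i _; rewrite mcoeffZ.
    rewrite big1 // => i _; rewrite mcoeffZ memN_msupp_eq0 ?mulr0 //.
    by apply: msize_mdeg_ge; apply: leq_trans ge; case: (hP i).
  (* The relation with its denominators cleared; at the node of index [j] only the term of index [j]
     survives. *)
  pose q := \sum_i lam i *: \prod_(l | l != i) ('X - (tnth (in_tuple s) l)%:P).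
  have : root (map_poly iota q) t.
    rewrite /root /q rmorph_sum horner_sum /=.
    have -> : \sum_i (map_poly iota (lam i *: \prod_(l | l != i)
        ('X - (tnth (in_tuple s) l)%:P))).[t]
      = phi (\sum_i lam i *: P i) * \prod_l (t - iota (tnth (in_tuple s) l)).
      rewrite rmorph_sum mulr_suml; apply: eq_bigr => i _.
      rewrite map_polyZ hornerZ rmorph_prod horner_prod -mul_mpolyC rmorphM /=.
      rewrite (hP i).2 -mulrA; congr (_ * _).
      rewrite [in RHS](bigD1 i) //= mulrA mulVf ?ntc // mul1r.
      by apply: eq_bigr => l _; rewrite map_polyXsubC hornerXsubC.
    by rewrite sum0 rmorph0 mul0r.
  move/transc/(congr1 (horner^~ (tnth (in_tuple s) j))).
  rewrite horner0 horner_sum (bigD1 j) //= [X in _ + X]big1 ?addr0 => [|i nij]; last first.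
    rewrite hornerZ horner_prod (bigD1 j) 1?eq_sym //=.
    by rewrite hornerXsubC subrr mul0r mulr0.
  move/eqP; rewrite hornerZ mulf_eq0 (negPf nj) horner_prod prodf_seq_eq0 /=.
  case/hasP => l _ /andP[nl]; rewrite hornerXsubC subr_eq0 => /eqP e.
  case/eqP: nl; apply/val_inj/eqP.
  rewrite -(nth_uniq 0 (ltn_ord l) (ltn_ord j) us).
  by move: e; rewrite !(tnth_nth 0) => ->.
have /choice[l hl] := finA.
have [c hc] := unk l.
have [p ep] := surj (t - iota c)^-1.
by have /negP := hc (msize p); apply; apply: hl; exists p.
Qed.

End WeakNullstellensatz.

(** The zero over [L] serves to make the ideal proper. The quotient by a maximal ideal above it is
    [k] itself by [residue_in_base], and the images of the variables are the point sought. The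
    system [E] may be infinite. *)
Lemma weak_nullstellensatz (k L : fieldType) (iota : {rmorphism k -> L}) (n : nat)
    (E : {mpoly k[n]} -> Prop) (a : 'I_n -> L) :
  alg_closed k -> uncountable k ->
  (forall p, E p -> (map_mpoly iota p).@[a] = 0) ->
  exists a0 : 'I_n -> k, forall p, E p -> p.@[a0] = 0.
Proof.
move=> clk unk hE.
pose I (p : {mpoly k[n]}) := (map_mpoly iota p).@[a] = 0.
have hI : is_ideal I.
  split; rewrite /I ?rmorph0 //.
    by move=> x y ex ey; rewrite (rmorphD (map_mpoly iota)) mevalD ex ey addr0.
  by move=> c x ex; rewrite (rmorphM (map_mpoly iota)) mevalM ex mulr0.
have I1 : ~ I 1 by rewrite /I rmorph1 meval1; apply/eqP/oner_neq0.
have [M [phi [h0 surj]]] := residue_field hI I1.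
have /choice[a0 ha0] := fun i => residue_in_base clk unk surj (phi 'X_i).
exists a0 => p /hE /h0.
pose g : {rmorphism k -> M} := phi \o (@mpolyC n k).
rewrite (@mpoly_rmorphE _ _ _ _ g) //.
rewrite (meval_eq (v2 := g \o a0)); last by move=> i; rewrite ha0.
by rewrite map_mpoly_meval => /eqP; rewrite fmorph_eq0 => /eqP.
Qed.

(** * Independent coordinates and standard monomials *)

Definition mon_in (R : comNzRingType) n (Q : 'X_{1..n} -> Prop) (p : {mpoly R[n]}) :=
  forall m, m \in msupp p -> Q m.

Section MonIn.
Variables (R : comNzRingType) (n : nat).
Implicit Types (p q : {mpoly R[n]}) (Q : 'X_{1..n} -> Prop).

Lemma mon_in0 Q : mon_in Q (0 : {mpoly R[n]}).
Proof. by move=> m; rewrite msupp0. Qed.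

Lemma mon_inX Q m : Q m -> mon_in Q ('X_[m] : {mpoly R[n]}).
Proof. by move=> Qm u; rewrite msuppX inE => /eqP ->. Qed.

Lemma mon_inD Q p q : mon_in Q p -> mon_in Q q -> mon_in Q (p + q).
Proof. by move=> hp hq m /msuppD_le; rewrite mem_cat => /orP[/hp|/hq]. Qed.

Lemma mon_inZ Q c p : mon_in Q p -> mon_in Q (c *: p).
Proof. by move=> hp m /msuppZ_le /hp. Qed.

Lemma mon_inM (Q1 Q2 Q3 : 'X_{1..n} -> Prop) p q :
  (forall m1 m2, Q1 m1 -> Q2 m2 -> Q3 (m1 + m2)%MM) ->
  mon_in Q1 p -> mon_in Q2 q -> mon_in Q3 (p * q).
Proof.
move=> h hp hq m /msuppM_le /allpairsP[[m1 m2] /= [/hp h1 /hq h2 ->]].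
exact: h.
Qed.

Lemma mon_in_sum Q (I : Type) (s : seq I) (P : pred I) (G : I -> {mpoly R[n]}) :
  (forall i, P i -> mon_in Q (G i)) -> mon_in Q (\sum_(i <- s | P i) G i).
Proof.
by move=> h; elim/big_rec: _ => [|i p Pi hp]; [exact: mon_in0 | apply: mon_inD; auto].
Qed.

Lemma mon_in1 Q : Q 0%MM -> mon_in Q (1 : {mpoly R[n]}).
Proof. by move=> h m; rewrite msupp1 inE => /eqP ->. Qed.

End MonIn.

Definition off (n : nat) (J : {set 'I_n}) (m : 'X_{1..n}) := forall i, i \notin J -> m i = 0%N.
Definition supp_in (R : comNzRingType) n (J : {set 'I_n}) (p : {mpoly R[n]}) :=
  mon_in (off J) p.

Lemma offD n (J : {set 'I_n}) m1 m2 : off J m1 -> off J m2 -> off J (m1 + m2)%MM.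
Proof. by move=> h1 h2 i iJ; rewrite mnmDE h1 // h2. Qed.

Lemma supp_inM (R : comNzRingType) n (J : {set 'I_n}) (p q : {mpoly R[n]}) :
  supp_in J p -> supp_in J q -> supp_in J (p * q).
Proof. by apply: mon_inM => *; apply: offD. Qed.

Lemma supp_in1 (R : comNzRingType) n (J : {set 'I_n}) : supp_in J (1 : {mpoly R[n]}).
Proof. by apply: mon_in1 => i _; rewrite mnm0E. Qed.

(** For the vanishing ideal of a set over an infinite field: the projection of the set to the
    coordinates in [J] is Zariski dense. The size of such a [J] stands in for the dimension. *)
Definition indep_mod (R : comNzRingType) n (I : {mpoly R[n]} -> Prop) (J : {set 'I_n}) :=
  forall p, p != 0 -> supp_in J p -> ~ I p.

(** Codes for the monomials in the variables of [J] with exponents at most [M]. Their number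
    [(M+1)^#|J|] is played against the count of standard monomials. *)
Definition box (n M : nat) (J : {set 'I_n}) := {ffun {i | i \in J} -> 'I_M.+1}.
Definition box_mnm n M (J : {set 'I_n}) (a : box M J) : 'X_{1..n} :=
  [multinom (if insub i is Some j then a j : nat else 0%N) | i < n].

Lemma card_box n M (J : {set 'I_n}) : #|{: box M J}| = (M.+1 ^ #|J|)%N.
Proof. by rewrite card_ffun card_ord card_sig; congr (_ ^ _)%N; apply: eq_card. Qed.

Lemma box_mnm_inj n M (J : {set 'I_n}) : injective (@box_mnm n M J).
Proof.
move=> a c /mnmP e; apply/ffunP => j; apply/val_inj.
by move: (e (val j)); rewrite !mnmE valK.
Qed.

Lemma box_mnm_off n M (J : {set 'I_n}) (a : box M J) : off J (box_mnm a).
Proof. by move=> i iJ; rewrite mnmE insubF //; apply/negbTE. Qed.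

Lemma box_mnm_le n M (J : {set 'I_n}) (a : box M J) i : (box_mnm a i <= M)%N.
Proof. by rewrite mnmE; case: insubP => // j _ _; rewrite -ltnS. Qed.

Section Standard.
Variables (k : fieldType) (n : nat) (I : {mpoly k[n]} -> Prop) (e : nat).
Hypothesis hI : is_ideal I.
Hypothesis dep : forall J : {set 'I_n}, #|J| = e.+1 -> ~ indep_mod I J.

Lemma idealZ c p : I p -> I (c *: p).
Proof. by move=> Ip; rewrite -mul_mpolyC; apply: idealM. Qed.

(** Consequently a monomial with more than [e] exponents at least [N0] is divisible by the leading
    monomial of an element of [I]; one [N0] serves the finitely many [J]. *)
Lemma lead_bound : exists N0, forall J : {set 'I_n}, #|J| = e.+1 ->
  exists p, [/\ p != 0, supp_in J p, I p & forall i, (mlead p i <= N0)%N].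
Proof.
have /choice[P hP] : forall J : {set 'I_n}, exists p,
    #|J| = e.+1 -> [/\ p != 0, supp_in J p & I p].
  move=> J; have [cJ|ncJ] := EM (#|J| = e.+1); last by exists 0 => /ncJ.
  apply: contrapT => h; apply: (dep cJ) => p np sp Ip.
  by apply: h; exists p.
exists (\max_(J : {set 'I_n}) \max_(i < n) mlead (P J) i)%N => J cJ.
exists (P J); have [np sp Ip] := hP J cJ; split=> // i.
by apply: leq_trans (leq_bigmax J); apply: (leq_bigmax (F := fun i => mlead (P J) i)).
Qed.

Definition standard N0 (m : 'X_{1..n}) := (#|[set i | (N0 <= m i)%N]| <= e)%N.

(* Division by the chosen polynomials for the graded monomial order. *)
Lemma standard_reduction N0 (m : 'X_{1..n}) :
  (forall J : {set 'I_n}, #|J| = e.+1 ->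
    exists p, [/\ p != 0, supp_in J p, I p & forall i, (mlead p i <= N0)%N]) ->
  exists q, I ('X_[m] - q) /\
    mon_in (fun u => standard N0 u /\ (mdeg u <= mdeg m)%N) q.
Proof.
move=> hN0; move: m; apply: ltmwf => m IH.
have [sm|nsm] := leqP #|[set i | (N0 <= m i)%N]| e.
  exists 'X_[m]; rewrite subrr; split; first exact: ideal0 hI.
  exact: mon_inX.
have [s [us ss sA]] := card_geqP nsm.
pose J := [set i in s].
have cJ : #|J| = e.+1 by rewrite cardsE (card_uniqP us).
have [p [np sp Ip leN]] := hN0 J cJ.
pose M := mlead p.
have leM : (M <= m)%MM.
  apply/mnm_lepP => i; have [iJ|niJ] := boolP (i \in J); last first.
    by rewrite (sp M (mlead_supp np)).
  apply: leq_trans (leN i) _; rewrite inE in iJ.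
  by have := sA _ iJ; rewrite inE.
have /choice[q hq] : forall u : 'X_{1..n}, exists q, u \in msupp p -> u != M ->
    I ('X_[m - M + u] - q) /\
    mon_in (fun u => standard N0 u /\ (mdeg u <= mdeg m)%N) q.
  move=> u; have [up|nup] := boolP (u \in msupp p); last by exists 0.
  have [->|nu] := eqVneq u M; first by exists 0.
  have lt : ((m - M + u)%MM < m)%O.
    rewrite -{2}(submK leM) ltmc_add2r lt_neqAle nu /=.
    exact: msupp_le_mlead.
  have [q [Iq hq]] := IH _ lt; exists q => _ _; split=> // v /hq[sv le].
  by split=> //; apply: leq_trans le (lemc_mdeg (ltW lt)).
exists (- (p@_M)^-1 *: \sum_(u <- msupp p | u != M) p@_u *: q u); split; last first.
  apply: mon_inZ; rewrite big_seq_cond; apply: mon_in_sum => u /andP[up uM].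
  by apply: mon_inZ; case: (hq u up uM).
have nc : p@_M != 0 by rewrite -mcoeff_msupp mlead_supp.
have -> : 'X_[m] - - (p@_M)^-1 *: \sum_(u <- msupp p | u != M) p@_u *: q u
  = (p@_M)^-1 *: ('X_[m - M] * p)
    - (p@_M)^-1 *: \sum_(u <- msupp p | u != M) p@_u *: ('X_[m - M + u] - q u).
  have -> : 'X_[m - M] * p = p@_M *: 'X_[m] +
      \sum_(u <- msupp p | u != M) p@_u *: 'X_[m - M + u].
    rewrite [X in _ * X]mpolyE (bigD1_seq M) ?mlead_supp ?msupp_uniq //= mulrDr.
    rewrite -scalerAr -mpolyXD submK // mulr_sumr; congr (_ + _).
    by apply: eq_bigr => u _; rewrite mpolyXD -scalerAr.
  rewrite scalerDr scalerA mulVf // scale1r scaleNr opprK -addrA; congr (_ + _).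
  rewrite -scalerBr -sumrB; congr (_ *: _).
  by apply: eq_bigr => u _; rewrite scalerBr opprB addrC subrK.
apply: idealB => //; apply: idealZ; first exact: idealM.
rewrite big_seq_cond; apply: ideal_sum => // u /andP[up uM].
by apply: idealZ; case: (hq u up uM).
Qed.

(** A variable stores its exponent when that is below [N0]; the others, at most [e] in number, list
    theirs in order in the second component. So only the power [e] of the degree enters the count.
    The code need not be unique. *)
Definition std_code N0 d := ({ffun 'I_n -> option 'I_N0} * {ffun 'I_e -> 'I_d.+1})%type.
Definition std_mnm N0 d (c : std_code N0 d) : 'X_{1..n} :=
  [multinom (match c.1 i with
             | Some x => x : nat
             | None => if insub (index i (enum [set i | c.1 i == None])) is Some j
                       then c.2 j : nat else 0%N
             end) | i < n].

Lemma card_std_code N0 d : #|{: std_code N0 d}| = (N0.+1 ^ n * d.+1 ^ e)%N.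
Proof. by rewrite card_prod !card_ffun !card_ord card_option card_ord. Qed.

Lemma standard_code N0 d m : standard N0 m -> (mdeg m <= d)%N ->
  exists c : std_code N0 d, m = std_mnm c.
Proof.
move=> sm dm.
pose c1 : {ffun 'I_n -> option 'I_N0} := [ffun i => insub (m i)].
have c1E : [set i | c1 i == None] = [set i | (N0 <= m i)%N].
  apply/setP => i; rewrite !inE ffunE leqNgt.
  by case: insubP => [x -> _|/negbTE ->].
pose c2 : {ffun 'I_e -> 'I_d.+1} := [ffun j : 'I_e =>
  inord (nth 0%N [seq m i | i <- enum [set i | c1 i == None]] j)].
exists (c1, c2); apply/mnmP => i; rewrite mnmE /=.
case E: (c1 i) => [x|].
  by move: E; rewrite ffunE; case: insubP => // y _ <- [->].
have iN : i \in enum [set i | c1 i == None] by rewrite mem_enum inE E.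
have lt : (index i (enum [set i | c1 i == None]) < e)%N.
  move: (iN); rewrite -index_mem => /leq_trans; apply.
  by rewrite -cardE c1E.
rewrite (insubT (fun x => (x < e)%N) lt) ffunE /= (nth_map i) ?index_mem // nth_index // inordK // ltnS.
by apply: leq_trans dm; rewrite mdegE (bigD1 i) //= leq_addr.
Qed.
End Standard.

Section Dependent.
Variables (k : fieldType) (n : nat) (I : {mpoly k[n]} -> Prop) (e : nat).
Hypothesis hI : is_ideal I.
Hypothesis dep : forall J : {set 'I_n}, #|J| = e.+1 -> ~ indep_mod I J.

Definition deg_le d (p : {mpoly k[n]}) := mon_in (fun m => (mdeg m <= d)%N) p.

Lemma standard_span : exists N0, forall d p, deg_le d p ->
  exists c : std_code n e N0 d -> k, I (p - \sum_t c t *: 'X_[std_mnm t]).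
Proof.
have [N0 hN0] := lead_bound dep; exists N0 => d p hp.
have [q [Iq hq]] : exists q, I (p - q) /\
    mon_in (fun u => standard e N0 u /\ (mdeg u <= d)%N) q.
  have /choice[q hq] : forall m : 'X_{1..n}, exists q, (mdeg m <= d)%N ->
      I ('X_[m] - q) /\ mon_in (fun u => standard e N0 u /\ (mdeg u <= d)%N) q.
    move=> m; have [q [Iq hq]] := standard_reduction hI m hN0.
    exists q => dm; split=> // u /hq[su du]; split=> //.
    exact: leq_trans du dm.
  exists (\sum_(m <- msupp p) p@_m *: q m); split; last first.
    rewrite big_seq; apply: mon_in_sum => m /hp dm; apply: mon_inZ.
    by case: (hq m dm).
  rewrite {1}(mpolyE p) -sumrB big_seq; apply: ideal_sum => // m /hp dm.
  by rewrite -scalerBr; apply: idealZ => //; case: (hq m dm).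
have [cd0] : exists c : std_code n e N0 d, true by exists ([ffun=> None], [ffun=> ord0]).
have /choice[g hg] : forall u : 'X_{1..n}, exists c : std_code n e N0 d,
    u \in msupp q -> u = std_mnm c.
  move=> u; have [/hq[su du]|nu] := boolP (u \in msupp q); last by exists cd0.
  by have [c ->] := standard_code su du; exists c.
exists (fun t => \sum_(u <- msupp q | g u == t) q@_u) => /=.
suff -> : \sum_t (\sum_(u <- msupp q | g u == t) q@_u) *: 'X_[std_mnm t] = q by [].
rewrite [RHS]mpolyE; under eq_bigr do rewrite scaler_suml.
rewrite (exchange_big_dep xpredT) //= big_seq [RHS]big_seq.
apply: eq_bigr => u uq; rewrite (bigD1 (g u)) //= -hg // big1 ?addr0 //.
by move=> t /andP[/eqP ->]; rewrite eqxx.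
Qed.

(** The Hilbert function of the quotient by [I] grows at most like the power [e] of the degree. *)
Lemma dependent_family : exists C, forall d (B : finType) (G : B -> {mpoly k[n]}),
  (forall b, deg_le d (G b)) -> (C * d.+1 ^ e < #|B|)%N ->
  exists lam : B -> k, (exists b, lam b != 0) /\ I (\sum_b lam b *: G b).
Proof.
have [N0 hN0] := standard_span; exists (N0.+1 ^ n)%N => d B G hG ltB.
have /choice[c hc] := fun b => hN0 d _ (hG b).
have [|lam [nz h]] := @lin_dep k B (std_code n e N0 d) c.
  by rewrite card_std_code.
exists lam; split=> //.
have -> : \sum_b lam b *: G b =
    \sum_b lam b *: (G b - \sum_t c b t *: 'X_[std_mnm t]).
  rewrite -[LHS]subr0; under [RHS]eq_bigr do rewrite scalerBr.
  rewrite sumrB; congr (_ - _).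
  under eq_bigr do rewrite scaler_sumr.
  rewrite exchange_big big1 //= => t _.
  under eq_bigr do rewrite scalerA.
  by rewrite -scaler_suml h scale0r.
by apply: ideal_sum => // b _; apply: idealZ.
Qed.

End Dependent.

Lemma box_count C D e : exists M, (C * (M * D).+1 ^ e < M.+1 ^ e.+1)%N.
Proof.
(* Since [M * D + 1 <= (M + 1) * (D + 1)], the left side is at most [M * (M + 1) ^ e] for this
   [M]. *)
pose M := (C * D.+1 ^ e)%N; exists M.
have lt : (M * M.+1 ^ e < M.+1 ^ e.+1)%N by rewrite expnS ltn_pmul2r // expn_gt0.
apply: leq_ltn_trans lt; rewrite -[X in (_ <= X * _)%N]/(C * D.+1 ^ e)%N -mulnA leq_mul2l -expnMn; apply/orP; right.
by case: e @M => // e M; rewrite leq_exp2r //; nia.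
Qed.

(** * Chains of irreducible sets and independent coordinates *)

Definition vanish (k : fieldType) n (X : set ('I_n -> k)) (p : {mpoly k[n]}) :=
  forall x, X x -> p.@[x] = 0.

Lemma vanish_ideal (k : fieldType) n (X : set ('I_n -> k)) : is_ideal (vanish X).
Proof.
split=> [x _|p q hp hq x Xx|a p hp x Xx]; first by rewrite meval0.
  by rewrite mevalD hp // hq // addr0.
by rewrite mevalM hp // mulr0.
Qed.

Section Chain.
Variables (k : fieldType) (n : nat).
Implicit Types (X Y : set ('I_n -> k)) (p q : {mpoly k[n]}).

Lemma zclosed_cut X p : zclosed X -> zclosed (X `&` [set x | p.@[x] = 0])%classic.
Proof.
move=> [E ->]; exists (E `|` [set p])%classic; apply/seteqP; split=> [x [Ex px] q [Eq|->]|x h] //.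
  exact: Ex.
by split=> [q Eq|]; apply: h; [left|right].
Qed.

Lemma vanish_prime X p q : zirreducible X -> vanish X (p * q) -> vanish X p \/ vanish X q.
Proof.
move=> [cX _ irr] pq.
have [|e|e] := irr _ _ (zclosed_cut p cX) (zclosed_cut q cX).
- apply/seteqP; split=> [x Xx|x [[]|[]]] //.
  have /eqP := pq _ Xx; rewrite mevalM mulf_eq0.
  by case/orP => /eqP h; [left|right].
- by left=> x; rewrite e => -[].
- by right=> x; rewrite e => -[].
Qed.

Lemma box_mnm_deg M (J : {set 'I_n}) (a : box M J) : (mdeg (box_mnm a) <= M * #|J|)%N.
Proof.
rewrite mdegE (bigID (mem J)) /= [X in (_ + X)%N]big1 ?addn0 => [|i]; last first.
  exact: box_mnm_off.
by rewrite mulnC -sum_nat_const; apply: leq_sum => i _; exact: box_mnm_le.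
Qed.

(* On Y the last nonzero coefficient of an algebraic relation of minimal order
   between the coordinates in J and f, which vanishes on Y only, is constant in f. *)
Lemma indep_grow X Y (J : {set 'I_n}) :
  zirreducible X -> zclosed Y -> (Y `<` X)%classic -> indep_mod (vanish Y) J ->
  exists J1 : {set 'I_n}, #|J1| = #|J|.+1 /\ indep_mod (vanish X) J1.
Proof.
move=> irrX [E EY] [YX nXY] indJ; apply: contrapT => dep.
have {}dep (J1 : {set 'I_n}) : #|J1| = #|J|.+1 -> ~ indep_mod (vanish X) J1.
  by move=> cJ ind; apply: dep; exists J1.
have [f [fY nfX]] : exists f, vanish Y f /\ ~ vanish X f.
  apply: contrapT => h; apply: nXY => x Xx; rewrite EY => f Ef.
  suff : vanish X f by apply.
  apply: contrapT => nf; apply: h; exists f; split=> // y.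
  by rewrite EY; apply.
have [C hC] := dependent_family (vanish_ideal X) dep.
have [M hM] := box_count C (#|J| + msize f) #|J|.
(* Box monomials times powers of [f] up to [M]: their number grows with exponent [#|J| + 1], one
   more than the quotient by [vanish X] allows. *)
have [||lam [[[a0 j0] nz] rel]] := hC (M * (#|J| + msize f))%N
   (box M J * 'I_M.+1)%type (fun b => 'X_[box_mnm b.1] * f ^+ b.2).
- move=> [a j] /=; rewrite mulnDr.
  apply: (@mon_inM _ _ (fun m => mdeg m <= M * #|J|)%N (fun m => mdeg m <= M * msize f)%N).
  + by move=> m1 m2 h1 h2; rewrite mdegD leq_add.
  + by apply: mon_inX; exact: box_mnm_deg.
  + have : mon_in (fun m => mdeg m <= j * msize f)%N (f ^+ j).
      elim: (j : nat) => [|i IH]; first by rewrite expr0; apply: mon_in1; rewrite mdeg0.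
      rewrite exprS; apply: mon_inM IH => [m1 m2|m mf].
        by rewrite mdegD mulSn; apply: leq_add.
      exact/ltnW/msize_mdeg_lt.
    by move=> h m /h /leq_trans; apply; rewrite leq_mul2r -ltnS ltn_ord orbT.
- by rewrite card_prod card_box card_ord [X in (_ < X)%N]mulnC -expnS.
pose q j := \sum_(a : box M J) lam (a, j) *: 'X_[box_mnm a] : {mpoly k[n]}.
have qS j : supp_in J (q j).
  by apply: mon_in_sum => a _; apply: mon_inZ; apply: mon_inX; exact: box_mnm_off.
have qc j a : (q j)@_(box_mnm a) = lam (a, j).
  rewrite raddf_sum (bigD1 a) //= big1 ?addr0 => [|a' na].
    by rewrite mcoeffZ mcoeffX eqxx mulr1.
  by rewrite mcoeffZ mcoeffX (inj_eq (@box_mnm_inj _ _ _)) (negPf na) mulr0.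
have {}rel : vanish X (\sum_(j < M.+1) q j * f ^+ j).
  move: rel; congr (vanish X _).
  under [RHS]eq_bigr do rewrite mulr_suml.
  rewrite exchange_big pair_bigA /=.
  by apply: eq_bigr => -[a j] _; rewrite scalerAl.
(* The lowest power of [f] in the relation. It can be cancelled because [X] is irreducible and [f]
   does not vanish on it. *)
have exj : exists j, `[< exists h : (j < M.+1)%N, q (Ordinal h) != 0 >].
  exists j0; apply/asboolP; exists (ltn_ord j0).
  apply: contraNneq nz => q0; rewrite -(qc j0 a0) -[j0](_ : Ordinal (ltn_ord j0) = j0) ?q0 ?mcoeff0 //.
  exact/val_inj.
case: (ex_minnP exj) => j /asboolP[hj nqj] jmin.
set oj := Ordinal hj in nqj.
have lowj (i : 'I_M.+1) : (i < j)%N -> q i = 0.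
  move=> ij; apply/eqP/negPn/negP => ni.
  suff : (j <= i)%N by rewrite leqNgt ij.
  apply: jmin; apply/asboolP; exists (ltn_ord i).
  by rewrite [Ordinal _](_ : _ = i) //; exact/val_inj.
pose r := \sum_(i < M.+1 | (j <= i)%N) q i * f ^+ (i - j).
have : vanish X (f ^+ j * r).
  move: rel; congr (vanish X _); rewrite /r mulr_sumr.
  rewrite (bigID (fun i : 'I__ => (j <= i)%N)) /= [X in _ + X]big1 ?addr0 => [|i].
    by apply: eq_bigr => i ji; rewrite mulrCA -exprD subnKC.
  by rewrite -ltnNge => /lowj ->; rewrite mul0r.
case/(vanish_prime irrX).
  elim: (j) => [|i IH].
    move=> h; apply: nfX => x Xx; have := h x Xx; rewrite expr0 meval1.
    by move/eqP; rewrite oner_eq0.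
  by rewrite exprS => /(vanish_prime irrX)[/nfX|/IH].
move=> rX; apply: (indJ (q oj)) => // y Yy.
have := rX y (YX _ Yy).
rewrite /r (bigD1 oj) //= mevalD subnn expr0 mulr1.
rewrite [X in _ + X](_ : _ = 0) ?addr0 // (raddf_sum (meval y)) big1 //=.
move=> i /andP[ji nij]; rewrite mevalM rmorphXn /= fY // expr0n subn_eq0.
rewrite leqNgt ltn_neqAle ji andbT.
have -> : j != i by apply: contraNneq nij => e; apply/eqP/val_inj.
by rewrite mulr0.
Qed.

(** Each strict inclusion of the chain enlarges the independent set by one; the set itself may
    change entirely. The start is the empty set of coordinates, for which nonemptiness of [c 0]
    suffices. *)
Lemma zchain_indep X d : has_zchain X d ->
  exists J : {set 'I_n}, #|J| = d /\ indep_mod (vanish X) J.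
Proof.
move=> [c [hc lt]].
suff : forall i, (i <= d)%N ->
    exists J : {set 'I_n}, #|J| = i /\ indep_mod (vanish (c i)) J.
  move=> /(_ d (leqnn d)) [J [cJ indJ]]; exists J; split=> // p np sp vp.
  by apply: (indJ p) => // x cx; apply: vp; exact: (hc d (leqnn d)).2.
elim=> [_|i IH ltd]; last first.
  have [J [cJ indJ]] := IH (ltnW ltd).
  have [[zc _ _] _] := hc _ (ltnW ltd).
  by have := indep_grow (hc _ ltd).1 zc (lt _ ltd) indJ; rewrite cJ.
exists finset.set0; rewrite cards0; split=> // p np sp vp.
have [[_ [x cx] _] _] := hc 0%N (leq0n d).
have e : p = (p@_0%MM)%:MP.
  apply/mpolyP => m; rewrite mcoeffC.
  have [->|nm] := eqVneq m 0%MM; first by rewrite mulr1.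
  rewrite mulr0 memN_msupp_eq0 //; apply/negP => /sp h.
  by case/eqP: nm; apply/mnmP => i; rewrite h ?inE // mnm0E.
move: (vp x cx) np; rewrite e mevalC => ->.
by rewrite mpolyC0 eqxx.
Qed.

End Chain.

(** * Cutting a cone by homogeneous equations *)

Definition wt n (w : 'I_n -> nat) (m : 'X_{1..n}) := (\sum_i w i * m i)%N.

Lemma wt0 n (w : 'I_n -> nat) : wt w 0%MM = 0%N.
Proof. by rewrite /wt big1 // => i _; rewrite mnm0E muln0. Qed.

Lemma wtD n (w : 'I_n -> nat) : {morph wt w : m1 m2 / (m1 + m2)%MM >-> (m1 + m2)%N}.
Proof.
move=> m1 m2; rewrite /wt -big_split /=.
by apply: eq_bigr => i _; rewrite mnmDE mulnDr.
Qed.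

HB.instance Definition _ n (w : 'I_n -> nat) := isMeasure.Build n (wt w) (wt0 w) (@wtD n w).

Section Graded.
Variables (k : fieldType) (n : nat) (w : 'I_n -> nat).
Hypothesis w_gt0 : forall i, (0 < w i)%N.
Implicit Types (I : {mpoly k[n]} -> Prop) (u p q : {mpoly k[n]}).

Local Notation whom d p := (p \is d.-homog for (wt w)).
Local Notation hcomp d p := (pihomog (wt w) d p).

Definition graded I := forall d p, I p -> I (hcomp d p).

Lemma mdeg_wt m : (mdeg m <= wt w m)%N.
Proof. by rewrite mdegE; apply: leq_sum => i _; apply: leq_pmull. Qed.

Lemma comp_mull b d u q : whom b u -> hcomp (b + d) (u * q) = u * hcomp d q.
Proof.
move=> hu; have [e qe] : exists e, q = \sum_(i < e) hcomp i q.
  by exists (mmeasure (wt w) q); apply: pihomog_partitionE.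
rewrite {1}qe mulr_sumr raddf_sum /=.
have [lt|ge] := ltnP d e; last first.
  rewrite big1 => [|i _]; last first.
    rewrite (@pihomog_ne0 _ _ _ (b + i)%N) // ?dhomogM ?pihomogP //.
    by rewrite eqn_add2l neq_ltn (leq_trans (ltn_ord i) ge).
  have -> : hcomp d q = 0; last by rewrite mulr0.
  rewrite qe raddf_sum big1 //= => i _; apply: pihomog_ne0 (pihomogP _ _ _).
  by rewrite neq_ltn (leq_trans (ltn_ord i) ge).
rewrite (bigD1 (Ordinal lt)) //= big1 ?addr0 => [|i ni].
  by rewrite pihomog_dE // dhomogM ?pihomogP.
rewrite (@pihomog_ne0 _ _ _ (b + i)%N) // ?dhomogM ?pihomogP //.
by rewrite eqn_add2l; apply: contraNneq ni => e1; apply/eqP/val_inj.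
Qed.

Lemma comp_mull_small b d u q : whom b u -> (d < b)%N -> hcomp d (u * q) = 0.
Proof.
move=> hu lt; have [e ->] : exists e, q = \sum_(i < e) hcomp i q.
  by exists (mmeasure (wt w) q); apply: pihomog_partitionE.
rewrite mulr_sumr raddf_sum /= big1 // => i _.
rewrite (@pihomog_ne0 _ _ _ (b + i)%N) // ?dhomogM ?pihomogP //.
by rewrite neq_ltn (leq_trans lt (leq_addr _ _)) orbT.
Qed.

Definition adjoin I u p := exists c q, I c /\ p = c + u * q.

Lemma adjoin_ideal I u : is_ideal I -> is_ideal (adjoin I u).
Proof.
move=> hI; split.
- by exists 0, 0; rewrite mulr0 addr0; split=> //; exact: ideal0 hI.
- move=> _ _ [c [q [Ic ->]]] [c' [q' [Ic' ->]]]; exists (c + c'), (q + q').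
  by rewrite mulrDr addrACA; split=> //; apply: idealD.
- move=> a _ [c [q [Ic ->]]]; exists (a * c), (a * q).
  by rewrite mulrDr mulrCA; split=> //; apply: idealM.
Qed.

Lemma adjoin_graded I b u : is_ideal I -> graded I -> whom b u -> graded (adjoin I u).
Proof.
move=> hI gI hu d _ [c [q [Ic ->]]]; rewrite raddfD /=.
have [lt|ge] := ltnP d b.
  rewrite (comp_mull_small _ hu lt); exists (hcomp d c), 0.
  by rewrite mulr0; split=> //; apply: gI.
rewrite -(subnKC ge) (comp_mull _ _ hu); exists (hcomp (b + (d - b)) c), (hcomp (d - b) q).
by split=> //; apply: gI.
Qed.

Section Step.
Variables (I : {mpoly k[n]} -> Prop) (u : {mpoly k[n]}) (b e : nat).
Hypotheses (hI : is_ideal I) (gI : graded I) (hu : whom b u) (b_gt0 : (0 < b)%N).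

Section Span.
Variables (N0 D : nat).
Let T := std_code n e N0 D.
Hypothesis span : forall p, deg_le D p ->
  exists c : T -> k, adjoin I u (p - \sum_t c t *: 'X_[std_mnm t]).

Let S (c : nat -> T -> k) := \sum_(a < D.+1) \sum_t c a t *: (u ^+ a * 'X_[std_mnm t]).
(** The bound [m] on the powers of [u] ensures that multiplying by [u] does not leave the range
    [a < D.+1] of the sum [S]. *)
Let spanned m f := exists c : nat -> T -> k,
  (forall a t, (m < a)%N -> c a t = 0) /\ I (f - S c).

Let spannedW m m' f : (m <= m')%N -> spanned m f -> spanned m' f.
Proof.
move=> le [c [c0 h]]; exists c; split=> // a t lt.
by apply: c0; apply: leq_ltn_trans lt.
Qed.

Let spannedD m f g : spanned m f -> spanned m g -> spanned m (f + g).
Proof.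
move=> [c [c0 h]] [c' [c0' h']]; exists (fun a t => c a t + c' a t); split.
  by move=> a t lt; rewrite c0 // c0' // addr0.
have -> : S (fun a t => c a t + c' a t) = S c + S c'.
  rewrite /S -big_split; apply: eq_bigr => a _; rewrite -big_split /=.
  by apply: eq_bigr => t _; rewrite scalerDl.
by rewrite opprD addrACA; apply: idealD.
Qed.

Let spanned_ideal m f : I f -> spanned m f.
Proof.
move=> If; exists (fun _ _ => 0); split=> //.
rewrite /S big1 ?subr0 // => a _; rewrite big1 // => t _.
by rewrite scale0r.
Qed.

Let spanned_std (c : T -> k) : spanned 0 (\sum_t c t *: 'X_[std_mnm t]).
Proof.
exists (fun a t => if a == 0%N then c t else 0); split=> [[]//|].
have -> : S (fun a t => if a == 0%N then c t else 0) = \sum_t c t *: 'X_[std_mnm t].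
  rewrite /S big_ord_recl /= [X in _ + X]big1 ?addr0 => [|a _]; last first.
    by rewrite big1 // => t _; rewrite scale0r.
  by apply: eq_bigr => t _; rewrite expr0 mul1r.
by rewrite subrr; exact: ideal0 hI.
Qed.

Let spanned_mul m q : (m < D)%N -> spanned m q -> spanned m.+1 (u * q).
Proof.
move=> lt [c [c0 h]]; exists (fun a t => if a is a'.+1 then c a' t else 0); split.
  by case=> [//|a] t; rewrite ltnS => /c0.
have -> : S (fun a t => if a is a'.+1 then c a' t else 0) = u * S c.
  rewrite /S big_ord_recl /= big1 ?add0r => [|t _]; last by rewrite scale0r.
  rewrite mulr_sumr big_ord_recr /= [X in _ = _ + u * X]big1 ?mulr0 ?addr0 => [|t _]; last first.
    by rewrite c0 // scale0r.
  apply: eq_bigr => a _; rewrite mulr_sumr; apply: eq_bigr => t _.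
  by rewrite -scalerAr mulrA -exprS.
by rewrite -mulrBr; apply: idealM.
Qed.

(** Modulo [I] and [u], [f] is a combination of standard monomials; what remains is [u * q], and the
    relevant component of [q] has weight [m - b], smaller since [b > 0]. Positive weights bound
    degrees by weights, so [D] suffices at every stage. *)
Lemma homog_span m f : (m <= D)%N -> whom m f ->
  exists c : nat -> T -> k,
    I (f - \sum_(a < D.+1) \sum_t c a t *: (u ^+ a * 'X_[std_mnm t])).
Proof.
suff H : (m <= D)%N -> whom m f -> spanned m f.
  by move=> le /(H le) [c [_ h]]; exists c.
elim/ltn_ind: m f => m IH f le hf.
have [c0 [c1 [q [Ic1 e1]]]] : exists c : T -> k, adjoin I u (f - \sum_t c t *: 'X_[std_mnm t]).
  apply: span => v /(dhomog_mf hf) wv.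
  by apply: leq_trans (mdeg_wt v) _; rewrite wv.
pose c0' t := if wt w (std_mnm t) == m then c0 t else 0.
have -> : f = \sum_t c0' t *: 'X_[std_mnm t] + (hcomp m c1 + hcomp m (u * q)).
  have -> : \sum_t c0' t *: 'X_[std_mnm t] =
      hcomp m (\sum_t c0 t *: 'X_[std_mnm t]).
    rewrite [RHS]raddf_sum; apply: eq_bigr => t _ /=; rewrite linearZ /= pihomogX /c0'.
    by case: ifP => _; rewrite ?scaler0 ?scale0r.
  by rewrite -[hcomp m c1 + _]raddfD /= -e1 raddfB /= (pihomog_dE hf) addrC subrK.
apply: spannedD; first exact: spannedW (spanned_std _).
apply: spannedD; first by apply/spanned_ideal/gI.
have [lt|ge] := ltnP m b.
  by rewrite (comp_mull_small _ hu lt); apply/spanned_ideal/(ideal0 hI).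
rewrite -{2}(subnKC ge) (comp_mull _ _ hu).
have lt : (m - b < m)%N by rewrite ltn_subrL b_gt0 (leq_trans b_gt0 ge).
apply: (@spannedW (m - b).+1) => //; apply: spanned_mul.
  exact: leq_trans lt le.
apply: IH => //; last exact: pihomogP.
exact: leq_trans (ltnW lt) le.
Qed.

End Span.
End Step.

(** If [d = e + 1] and no [d] coordinates stayed independent modulo [u], the quotient by [I] would
    be spanned by powers of [u] times standard monomials. Their number grows with exponent [e + 1],
    against [e + 2] for the box monomials in [J]. *)
Lemma dim_step I u b d (J : {set 'I_n}) :
  is_ideal I -> graded I -> whom b u -> (0 < b)%N ->
  #|J| = d.+1 -> indep_mod I J ->
  exists J' : {set 'I_n}, #|J'| = d /\ indep_mod (adjoin I u) J'.
Proof.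
move=> hI gI hu b_gt0 cJ indJ; apply: contrapT => dep.
have {}dep (J' : {set 'I_n}) : #|J'| = d -> ~ indep_mod (adjoin I u) J'.
  by move=> c ind; apply: dep; exists J'.
case: d => [|e] in cJ dep.
  (* For [d = 0]: a constant of [adjoin I u] lies in [I], because multiples of [u] have no component
     of weight 0. *)
  apply: (dep finset.set0); first by rewrite cards0.
  move=> p np sp [c [q [Ic ep]]].
  have e : p = hcomp 0 p.
    rewrite pihomog_dE //; apply/dhomogP => m /sp hm.
    by rewrite /= /wt big1 // => i _; rewrite hm ?muln0 // inE.
  apply: (indJ p) => // [m /sp hm i _|]; first by rewrite hm // inE.
  rewrite e ep raddfD /= (comp_mull_small _ hu b_gt0) addr0.
  exact: gI.
have hA := adjoin_ideal u hI.
have [N0 span] := standard_span hA dep.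
pose W := (\sum_i w i)%N.
have [M hM] := box_count (N0.+1 ^ n)%N W e.+1.
have wtM (a : box M J) : (wt w (box_mnm a) <= M * W)%N.
  rewrite /wt /W big_distrr /=; apply: leq_sum => i _.
  by rewrite mulnC leq_mul2r box_mnm_le orbT.
have /choice[c hc] : forall a : box M J, exists c : nat -> std_code n e N0 (M * W) -> k,
    I ('X_[box_mnm a] - \sum_(i < (M * W).+1) \sum_t c i t *: (u ^+ i * 'X_[std_mnm t])).
  move=> a; apply: (homog_span hI gI hu b_gt0 (span _) (wtM a)).
  by rewrite dhomogX.
have [|lam [[a0 nz] h]] := @lin_dep k (box M J) ('I_(M * W).+1 * std_code n e N0 (M * W))%type
    (fun a it => c a it.1 it.2).
  rewrite card_prod card_ord card_std_code card_box cJ.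
  by rewrite mulnCA -expnS.
apply: (indJ (\sum_a lam a *: 'X_[box_mnm a])).
- apply: contraNneq nz => /(congr1 (mcoeff (box_mnm a0))).
  rewrite mcoeff0 raddf_sum (bigD1 a0) //= big1 => [|a na].
    by rewrite mcoeffZ mcoeffX eqxx mulr1 addr0 => ->.
  by rewrite mcoeffZ mcoeffX (inj_eq (@box_mnm_inj _ _ _)) (negPf na) mulr0.
- by apply: mon_in_sum => a _; apply: mon_inZ; apply: mon_inX; exact: box_mnm_off.
have -> : \sum_a lam a *: 'X_[box_mnm a] = \sum_a lam a *: ('X_[box_mnm a] -
    \sum_(i < (M * W).+1) \sum_t c a i t *: (u ^+ i * 'X_[std_mnm t])).
  rewrite -[LHS]subr0; under [RHS]eq_bigr do rewrite scalerBr pair_bigA.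
  rewrite sumrB; congr (_ - _).
  under eq_bigr do rewrite scaler_sumr.
  rewrite exchange_big big1 //= => it _.
  under eq_bigr do rewrite scalerA.
  by rewrite -scaler_suml h scale0r.
by apply: ideal_sum => // a _; apply: idealZ.
Qed.

(* Krull's principal ideal theorem, for a homogeneous system. *)
Lemma dim_homog_cut I b d (us : seq {mpoly k[n]}) (J : {set 'I_n}) :
  is_ideal I -> graded I -> (0 < b)%N -> (forall u, u \in us -> whom b u) ->
  #|J| = (d + size us)%N -> indep_mod I J ->
  exists (I' : {mpoly k[n]} -> Prop) (J' : {set 'I_n}),
    [/\ is_ideal I', forall p, I p -> I' p, forall u, u \in us -> I' u,
        #|J'| = d & indep_mod I' J'].
Proof.
elim: us I J => [|u us IH] I J hI gI b0 hus cJ indJ.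
  by exists I, J; split=> //; rewrite cJ addn0.
have hu : whom b u by apply: hus; rewrite mem_head.
have [J1 [cJ1 indJ1]] := @dim_step I u b (d + size us)%N J hI gI hu b0 ltac:(by rewrite cJ addnS) indJ.
have [I' [J' [hI' sub usI' cJ' indJ']]] := IH _ _ (adjoin_ideal u hI) (adjoin_graded hI gI hu)
  b0 (fun v vus => hus v ltac:(by rewrite inE vus orbT)) cJ1 indJ1.
exists I', J'; split=> // [p Ip|v].
  by apply: sub; exists p, 0; rewrite mulr0 addr0.
rewrite inE => /predU1P[->|/usI' //]; apply: sub.
by exists 0, 1; rewrite mulr1 add0r; split=> //; exact: ideal0 hI.
Qed.

End Graded.

(** * Derivations *)

Definition derivation (L : fieldType) (D : L -> L) :=
  (forall x y, D (x + y) = D x + D y) /\ (forall x y, D (x * y) = D x * y + x * D y).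

Definition char0 (L : fieldType) := forall n, n.+1%:R != 0 :> L.

(** A derivation from a subring of [L] to [L], kept as a graph so that extension is inclusion. The
    pair [(-1, 0)] and products give 1, negatives and 0. *)
Record der_graph (L : fieldType) (G : set (L * L)) : Prop := DerGraph {
  dgN1 : G (-1, 0);
  dgD : forall x u y v, G (x, u) -> G (y, v) -> G (x + y, u + v);
  dgM : forall x u y v, G (x, u) -> G (y, v) -> G (x * y, u * y + x * v);
  dg_fun : forall x u v, G (x, u) -> G (x, v) -> u = v }.

Section Adjunction.
Variables (L : fieldType) (L0 : char0 L) (G : set (L * L)) (dG : der_graph G).

Let dg1 : G (1, 0).
Proof. by have := dgM dG (dgN1 dG) (dgN1 dG); rewrite mulrNN mulr1 mul0r mulr0 addr0. Qed.

Let dgN x u : G (x, u) -> G (- x, - u).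
Proof. by move/(dgM dG (dgN1 dG)); rewrite mul0r !mulN1r add0r. Qed.

Let dg0 : G (0, 0).
Proof. by have := dgD dG dg1 (dgN1 dG); rewrite subrr addr0. Qed.

Let dgB x u y v : G (x, u) -> G (y, v) -> G (x - y, u - v).
Proof. by move=> h /dgN; apply: (dgD dG h). Qed.

Let dg_sum (I : Type) (s : seq I) (x u : I -> L) :
  (forall i, G (x i, u i)) -> G (\sum_(i <- s) x i, \sum_(i <- s) u i).
Proof.
by move=> h; elim: s => [|i s IH]; rewrite ?big_nil // !big_cons; apply: dgD.
Qed.

Let dgMn x u m : G (x, u) -> G (x *+ m, u *+ m).
Proof. by move=> h; elim: m => [|m IH]; rewrite ?mulr0n // !mulrS; apply: dgD. Qed.

(** [r] is [q] with the derivation applied to its coefficients. *)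
Let PG (q r : {poly L}) := forall i, G (q`_i, r`_i).

Let PGB q r q' r' : PG q r -> PG q' r' -> PG (q - q') (r - r').
Proof. by move=> h h' i; rewrite !coefB; apply: dgB. Qed.

Let PGD q r q' r' : PG q r -> PG q' r' -> PG (q + q') (r + r').
Proof. by move=> h h' i; rewrite !coefD; apply: (dgD dG). Qed.

Let PGM q r q' r' : PG q r -> PG q' r' -> PG (q * q') (r * q' + q * r').
Proof.
move=> h h' i; rewrite coefD !coefM -big_split /=; apply: dg_sum => j.
exact: (dgM dG).
Qed.

Let PGC c d : G (c, d) -> PG c%:P d%:P.
Proof. by move=> h i; rewrite !coefC; case: ifP. Qed.

Let PGXn m : PG 'X^m 0.
Proof. by move=> i; rewrite coef0 coefXn; case: eqP. Qed.

Let PG_deriv q r : PG q r -> PG q^`() r^`().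
Proof. by move=> h i; rewrite !coef_deriv; apply: dgMn. Qed.

Let PG0 r : PG 0 r -> r = 0.
Proof.
move=> h; apply/polyP => i; rewrite coef0; apply: (dg_fun dG) dg0.
by have := h i; rewrite coef0.
Qed.

(* The derivative of an algebraic theta is forced by its minimal relation;
   that of a transcendental one is arbitrary. *)
Lemma der_of_adjoined (theta : L) : exists theta', forall q r, PG q r ->
  q.[theta] = 0 -> r.[theta] + q^`().[theta] * theta' = 0.
Proof.
pose alg m := `[< exists q r, [/\ PG q r, q != 0, q.[theta] = 0 & size q = m] >].
have [exalg|nalg] := EM (exists m, alg m); last first.
  exists 0 => q r hqr q0; have [e|nq] := eqVneq q 0.
    by move: hqr; rewrite e => /PG0 ->; rewrite deriv0 !horner0 mul0r addr0.
  by case: nalg; exists (size q); apply/asboolP; exists q, r.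
case: (ex_minnP exalg) => m /asboolP[p [r0 [hp np p0 sp]]] minm.
(* Minimality makes [theta] a simple root of [p]: a nonzero derivative has smaller size, and in
   characteristic 0 a zero derivative would make [p] constant. *)
have np' : p^`().[theta] != 0.
  apply/eqP => p'0.
  have e : p^`() = 0.
    apply/eqP/negPn/negP => n0.
    have : (m <= size p^`())%N.
      by apply: minm; apply/asboolP; exists p^`(), r0^`(); split=> //; exact: PG_deriv.
    by rewrite -sp leqNgt lt_size_deriv.
  have sp1 : (size p <= 1)%N.
    apply/leq_sizeP => -[//|i] _.
    have /eqP := congr1 (fun q : {poly L} => q`_i) e.
    by rewrite coef_deriv coef0 -mulr_natr mulf_eq0 (negPf (L0 _)) orbF => /eqP.
  move: p0 np; rewrite (size1_polyC sp1) hornerC => ->.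
  by rewrite polyC0 eqxx.
have [theta' e2] : exists theta', r0.[theta] = - (p^`().[theta] * theta').
  by exists (- r0.[theta] / p^`().[theta]); rewrite mulrC divfK // opprK.
exists theta' => q.
have [s] := ubnP (size q); elim: s q => // s IH q ltq r hqr q0.
have [e|nq] := eqVneq q 0.
  by move: hqr; rewrite e => /PG0 ->; rewrite deriv0 !horner0 mul0r addr0.
have leq_pq : (size p <= size q)%N.
  by rewrite sp; apply: minm; apply/asboolP; exists q, r.
pose c := lead_coef p; pose c' := r0`_(size p).-1.
pose d := lead_coef q; pose d' := r`_(size q).-1.
pose M := (size q - size p)%N.
have hc : G (c, c') by exact: hp.
have hd : G (d, d') by exact: hqr.
(* One step of pseudo-division by [p]; the domain of the derivation is a ring in which [c] need not
   be invertible. *)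
pose q1 := c%:P * q - d%:P * ('X^M * p).
pose r1 := (c'%:P * q + c%:P * r) - (d'%:P * ('X^M * p) + d%:P * (0 * p + 'X^M * r0)).
have h1 : PG q1 r1.
  apply: PGB; first by apply: PGM => //; exact: PGC.
  by apply: PGM; [exact: PGC | exact: PGM].
have s1 : (size q1 < size q)%N.
  have sq : (0 < size q)%N by rewrite size_poly_gt0.
  have sp0 : (0 < size p)%N by rewrite size_poly_gt0.
  rewrite -(prednK sq) ltnS; apply/leq_sizeP => i le.
  rewrite coefB !coefCM coefXnM.
  have ltM : (i < M)%N = false by apply/negbTE; rewrite -leqNgt /M; move: le leq_pq sq sp0; clear; lia.
  rewrite ltM; have [e|ne] := eqVneq i (size q).-1.
    have -> : (i - M)%N = (size p).-1.
      by rewrite e /M; move: leq_pq sq sp0; clear; lia.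
    by rewrite e -/(lead_coef q) -/(lead_coef p) -/c -/d mulrC subrr.
  have lt : ((size q).-1 < i)%N by rewrite ltn_neqAle eq_sym ne.
  rewrite !nth_default ?mulr0 ?subrr // /M.
    have aux x y z : (y <= x -> x.-1 < z -> 0 < x -> y <= z - (x - y))%N by clear; lia.
    exact: aux.
  by rewrite -(prednK sq).
have q10 : q1.[theta] = 0 by rewrite /q1 !hornerE /= q0 p0 !mulr0 subrr.
have := IH q1 (leq_trans s1 ltq) r1 h1 q10.
rewrite /q1 /r1 derivB !derivM !derivC !hornerE /= q0 p0 => e1.
have nc : c != 0 by rewrite lead_coef_eq0.
by apply: (mulfI nc); rewrite mulr0 -[RHS]e1 e2; ring.
Qed.

(** The new domain consists of the values at [theta] of polynomials over the old one;
    [der_of_adjoined] makes the graph single-valued. *)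
Lemma der_graph_adjoin (theta : L) : exists G' : set (L * L),
  [/\ der_graph G', (G `<=` G')%classic & exists u, G' (theta, u)].
Proof.
have [theta' h] := der_of_adjoined theta.
exists [set xu | exists q r, PG q r /\
   xu = (q.[theta], r.[theta] + q^`().[theta] * theta')]%classic; split.
- split.
  + exists (-1)%:P, 0%:P; split; first by apply: PGC; exact: dgN1.
    by rewrite derivC !hornerE /= ?mul0r ?addr0.
  + move=> x u y v [q [r [hq [-> ->]]]] [q' [r' [hq' [-> ->]]]].
    exists (q + q'), (r + r'); split; first exact: PGD.
    by rewrite derivD !hornerE /=; congr (_, _); ring.
  + move=> x u y v [q [r [hq [-> ->]]]] [q' [r' [hq' [-> ->]]]].
    exists (q * q'), (r * q' + q * r'); split; first exact: PGM.
    by rewrite derivM !hornerE /=; congr (_, _); ring.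
  + move=> x u v [q [r [hq [-> ->]]]] [q' [r' [hq' [e ->]]]].
    have := h _ _ (PGB hq hq'); rewrite derivB !hornerE /= e subrr => /(_ erefl) e1.
    by apply/eqP; rewrite -subr_eq0 -[X in _ == X]e1; apply/eqP; ring.
- move=> [x u] Gxu; exists x%:P, u%:P; split; first exact: PGC.
  by rewrite derivC !hornerE /= ?mul0r ?addr0.
- exists theta', 'X, 0; split; last by rewrite derivX !hornerE /= ?mul1r ?add0r.
  by rewrite -['X]expr1; exact: PGXn.
Qed.

End Adjunction.

(** By Zorn's lemma there is a maximal graph, and any [theta] missing from its domain could be
    adjoined. *)
Lemma derivation_extend (L : fieldType) (G : set (L * L)) :
  char0 L -> der_graph G ->
  exists D : L -> L, derivation D /\ forall x u, G (x, u) -> D x = u.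
Proof.
move=> L0 dG.
pose good (A : set (L * L)) := A = set0 \/ (G `<=` A)%classic /\ der_graph A.
have [F Fgood tot|A [gA maxA]] := @Zorn_bigcup _ good.
  have [->|/eqP/set0P[z [A FA Az]]] := EM ((\bigcup_(X in F) X) = set0)%classic; first by left.
  have inF B y : F B -> B y -> (G `<=` B)%classic /\ der_graph B.
    by move=> FB By; case: (Fgood _ FB) => // B0; rewrite B0 in By.
  have pairF y y' : (\bigcup_(X in F) X)%classic y -> (\bigcup_(X in F) X)%classic y' ->
      exists B, [/\ F B, der_graph B, B y & B y'].
    move=> [B FB By] [C FC Cy].
    have [BC|CB] := tot B C FB FC.
      by exists C; split=> //; [exact: (inF _ _ FC Cy).2 | exact: BC].
    by exists B; split=> //; [exact: (inF _ _ FB By).2 | exact: CB].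
  right; split.
    by move=> y Gy; exists A => //; apply: (inF _ _ FA Az).1.
  have dA := (inF _ _ FA Az).2.
  split.
  - by exists A => //; exact: dgN1.
  - by move=> x u y v hx hy; have [B [FB dB Bx By]] := pairF _ _ hx hy; exists B => //; apply: dgD.
  - by move=> x u y v hx hy; have [B [FB dB Bx By]] := pairF _ _ hx hy; exists B => //; apply: dgM.
  - by move=> x u v hx hy; have [B [FB dB Bx By]] := pairF _ _ hx hy; apply: dg_fun dB _ _ _ Bx By.
have [GA dA] : (G `<=` A)%classic /\ der_graph A.
  case: gA => // A0; exfalso; apply: (maxA G); last by right; split.
  rewrite A0; split=> // h; have := dgN1 dG; exact: h.
have /choice[D hD] : forall x, exists u, A (x, u).
  move=> x; have [A' [dA' AA' [u Axu]]] := der_graph_adjoin L0 dA x.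
  exists u; apply: contrapT => nA; apply: (maxA A'); last by right; split=> // y /GA /AA'.
  by split=> // h; apply: nA; apply: h.
exists D; split; first split=> x y.
- exact: dg_fun dA _ _ _ (hD _) (dgD dA (hD x) (hD y)).
- exact: dg_fun dA _ _ _ (hD _) (dgM dA (hD x) (hD y)).
by move=> x u /GA; apply: dg_fun dA _ _ _ (hD x).
Qed.

Lemma mderivXU (R : comNzRingType) n (i j : 'I_n) :
  mderiv i ('X_j : {mpoly R[n]}) = ((i == j)%:R)%:MP.
Proof.
rewrite mderivX mnm1E eq_sym; have [->|_] := eqVneq i j.
  by rewrite scale1r -{1}[U_(j)%MM]add0m addmK mpolyX0 mpolyC1.
by rewrite scale0r mpolyC0.
Qed.

Lemma supp_inC (R : comNzRingType) n (J : {set 'I_n}) c : supp_in J (c%:MP : {mpoly R[n]}).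
Proof. by move=> m; rewrite msuppC; case: ifP => // _; rewrite inE => /eqP -> i _; rewrite mnm0E. Qed.

Section Derivations.
Variables (L : fieldType) (D : L -> L).
Hypothesis hD : derivation D.

Lemma derivation0 : D 0 = 0.
Proof. by have := hD.1 0 0; rewrite addr0 => /eqP; rewrite -subr_eq0 opprD addNKr oppr_eq0 => /eqP. Qed.

Lemma derivation_meval (k : fieldType) (iota : {rmorphism k -> L}) n
    (p : {mpoly k[n]}) (a : 'I_n -> L) :
  (forall c, D (iota c) = 0) ->
  D (map_mpoly iota p).@[a] = \sum_i (map_mpoly iota (mderiv i p)).@[a] * D (a i).
Proof.
move=> Dk; elim/mpoly_ring_ind: p => [c|j|p q IHp IHq|p q IHp IHq].
- rewrite map_mpolyC mevalC Dk big1 // => i _.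
  by rewrite mderivC (rmorph0 (map_mpoly iota)) meval0 mul0r.
- rewrite map_mpolyX mevalXU (bigD1 j) //= big1 ?addr0 => [|i nij].
    by rewrite mderivXU map_mpolyC mevalC /= rmorph_nat eqxx mul1r.
  by rewrite mderivXU map_mpolyC mevalC /= rmorph_nat (negPf nij) mul0r.
- rewrite (rmorphD (map_mpoly iota)) /= mevalD hD.1 IHp IHq -big_split /=.
  apply: eq_bigr => i _.
  by rewrite mderivD (rmorphD (map_mpoly iota)) /= mevalD mulrDl.
- rewrite (rmorphM (map_mpoly iota)) /= mevalM hD.2 IHp IHq mulr_suml mulr_sumr -big_split /=.
  apply: eq_bigr => i _.
  rewrite mderivM (rmorphD (map_mpoly iota)) /= !(rmorphM (map_mpoly iota)) /= mevalD !mevalM.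
  by rewrite mulrDl mulrAC mulrA.
Qed.

End Derivations.

Lemma derivation_lift (k L : fieldType) (iota : {rmorphism k -> L}) (D0 : k -> k) :
  char0 L -> derivation D0 ->
  exists D, derivation D /\ forall x, D (iota x) = iota (D0 x).
Proof.
move=> L0 hD0.
have [|D [hD e]] := @derivation_extend L [set xu | exists x, xu = (iota x, iota (D0 x))]%classic L0.
  have D1 : D0 1 = 0.
    have := hD0.2 1 1; rewrite !mulr1 mul1r => /eqP.
    by rewrite -subr_eq0 opprD addNKr oppr_eq0 => /eqP.
  split.
  - exists (-1); rewrite rmorphN1.
    have -> : D0 (-1) = 0 by rewrite -[LHS]addr0 -D1 -hD0.1 addNr (derivation0 hD0).
    by rewrite rmorph0.
  - by move=> _ _ _ _ [x [-> ->]] [y [-> ->]]; exists (x + y); rewrite hD0.1 !rmorphD.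
  - by move=> _ _ _ _ [x [-> ->]] [y [-> ->]]; exists (x * y); rewrite hD0.2 rmorphD !rmorphM.
  - by move=> _ _ _ [x [-> ->]] [y [/fmorph_inj -> ->]].
by exists D; split=> // x; apply: e; exists x.
Qed.

Definition alg_indep (k L : fieldType) (iota : {rmorphism k -> L}) n (a : 'I_n -> L)
    (J : {set 'I_n}) :=
  forall p, p != 0 -> supp_in J p -> (map_mpoly iota p).@[a] != 0.

(** On the polynomial ring generated by the [a i], [i] in [J], the partial derivative with respect
    to [j] is well defined by independence; it then extends to [L]. *)
Lemma dual_derivation (k L : fieldType) (iota : {rmorphism k -> L}) n (a : 'I_n -> L)
    (J : {set 'I_n}) (j : 'I_n) :
  char0 L -> alg_indep iota a J ->
  exists D, [/\ derivation D, forall c, D (iota c) = 0 &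
    forall i, i \in J -> D (a i) = (i == j)%:R].
Proof.
move=> L0 indJ.
have [|D [hD e]] := @derivation_extend L [set xu | exists p, supp_in J p /\
    xu = ((map_mpoly iota p).@[a], (map_mpoly iota (mderiv j p)).@[a])]%classic L0.
  split.
  - exists (-1)%:MP; split; first exact: supp_inC.
    by rewrite mderivC !map_mpolyC !mevalC /= rmorphN1 rmorph0.
  - move=> _ _ _ _ [p [hp [-> ->]]] [q [hq [-> ->]]]; exists (p + q); split; first exact: mon_inD.
    by rewrite mderivD !(rmorphD (map_mpoly iota)) /= !mevalD.
  - move=> _ _ _ _ [p [hp [-> ->]]] [q [hq [-> ->]]]; exists (p * q); split; first exact: supp_inM.
    rewrite mderivM (rmorphD (map_mpoly iota)) /= !(rmorphM (map_mpoly iota)) /=.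
    by rewrite mevalD !mevalM.
  - move=> _ _ _ [p [hp [-> ->]]] [q [hq [e ->]]].
    suff -> : p = q by [].
    apply/eqP; rewrite -subr_eq0; apply/negPn/negP => npq.
    have sB : supp_in J (p - q) by rewrite -scaleN1r; apply: mon_inD => //; apply: mon_inZ.
    have /eqP := indJ _ npq sB.
    by rewrite (rmorphB (map_mpoly iota)) mevalB e subrr.
exists D; split=> // [c|i iJ]; apply: e.
  exists c%:MP; split; first exact: supp_inC.
  by rewrite mderivC !map_mpolyC !mevalC /= rmorph0.
exists 'X_i; split.
  by apply: mon_inX => l lJ; rewrite mnm1E; case: eqP => // e1; rewrite -e1 iJ in lJ.
by rewrite map_mpolyX mevalXU mderivXU map_mpolyC mevalC /= rmorph_nat eq_sym.
Qed.

(** * Systems of rows and orthogonality *)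

Section Orthogonal.
Variables (L : fieldType) (X : finType).
Implicit Types A B Q : {set X}.

Definition rows_free (A : {set X}) (Q : {set X}) (E : X -> X -> L) :=
  forall nu : X -> L, (forall q, q \in Q -> \sum_(i in A) nu i * E i q = 0) ->
  forall i, i \in A -> nu i = 0.

Definition set_mx A Q (E : X -> X -> L) : 'M_(#|A|, #|Q|) :=
  \matrix_(i, j) E (enum_val i) (enum_val j).

Lemma set_mx_free A Q E : rows_free A Q E -> row_free (set_mx A Q E).
Proof.
move=> fE; rewrite -kermx_eq0; apply/eqP/row_matrixP => l; rewrite row0.
have : row l (kermx (set_mx A Q E)) *m set_mx A Q E = 0.
  by rewrite -row_mul mulmx_ker row0.
move: (row l _) => v vE; apply/rowP => i; rewrite mxE.
pose nu x := v 0 (enum_rank_in (enum_valP i) x).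
have nuE (j : 'I_#|A|) : nu (enum_val j) = v 0 j by rewrite /nu enum_valK_in.
rewrite -nuE; apply: fE; last exact: enum_valP.
move=> q qQ; rewrite big_enum_val /=.
move/rowP/(_ (enum_rank_in qQ q)): vE; rewrite !mxE => e; rewrite -[RHS]e.
by apply: eq_bigr => j _; rewrite nuE mxE enum_rankK_in.
Qed.

Lemma orthogonal_rank A B Q E G :
  rows_free A Q E -> rows_free B Q G ->
  (forall i j, i \in A -> j \in B -> \sum_(q in Q) E i q * G j q = 0) ->
  (#|A| + #|B| <= #|Q|)%N.
Proof.
move=> /set_mx_free/eqP rE /set_mx_free/eqP rG EG.
have : set_mx A Q E *m (set_mx B Q G)^T = 0.
  apply/matrixP => i j; rewrite !mxE.
  rewrite -[RHS](EG _ _ (enum_valP i) (enum_valP j)) [RHS]big_enum_val /=.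
  by apply: eq_bigr => q _; rewrite !mxE.
by move/mulmx0_rank_max; rewrite mxrank_tr rE rG.
Qed.

End Orthogonal.

(** [Phi] completes the rows of [E] to a spanning set of the orthogonal of the rows of [G]; a [v]
    orthogonal to all of these is in the row span of [G]. As [Phi] has entries in [k], it serves
    every extension [L]. *)
Lemma orthogonal_complement (k : fieldType) (X : finType) (A B Q : {set X}) (E G : X -> X -> k) :
  rows_free A Q E -> rows_free B Q G ->
  (forall i j, i \in A -> j \in B -> \sum_(q in Q) E i q * G j q = 0) ->
  exists c (Phi : 'I_c -> X -> k), (c + #|A| + #|B|)%N = #|Q| /\
    forall (L : fieldType) (iota : {rmorphism k -> L}) (v : X -> L),
      (forall i, i \in A -> \sum_(q in Q) iota (E i q) * v q = 0) ->
      (forall m, \sum_(q in Q) iota (Phi m q) * v q = 0) ->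
      exists x : X -> L, forall q, q \in Q -> v q = \sum_(j in B) x j * iota (G j q).
Proof.
move=> fE fG EG; have leAB := orthogonal_rank fE fG EG.
pose ME := set_mx A Q E; pose MG := set_mx B Q G.
have rE : \rank ME = #|A| by exact/eqP/set_mx_free.
have rG : \rank MG = #|B| by exact/eqP/set_mx_free.
pose K := kermx MG^T.
have EK : (ME <= K)%MS.
  apply/sub_kermxP/matrixP => i j; rewrite !mxE.
  rewrite -[RHS](EG _ _ (enum_valP i) (enum_valP j)) [RHS]big_enum_val /=.
  by apply: eq_bigr => q _; rewrite !mxE.
have rK : \rank K = (#|Q| - #|B|)%N by rewrite mxrank_ker mxrank_tr rG.
pose C := (K :\: ME)%MS.
have rC : (\rank C + #|A|)%N = \rank K.
  by rewrite -(mxrank_cap_compl K ME) (capmx_idPr EK) rE addnC.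
have KEC : (K <= ME + row_base C)%MS.
  rewrite -{1}(addsmx_diff_cap_eq K ME) addsmx_sub.
  rewrite (submx_trans _ (addsmxSr _ _)) ?eq_row_base //=.
  by apply: submx_trans (addsmxSl _ _); apply: capmxSr.
move: (row_base C) KEC => RB KEC.
exists (\rank C), (fun m q => if pselect (q \in Q) is left h
  then RB m (enum_rank_in h q) else 0); split.
  by rewrite rC rK subnK //; apply: leq_trans leAB; exact: leq_addl.
move=> L iota v vE vPhi.
pose vr : 'rV[L]_#|Q| := \row_j v (enum_val j).
have /sub_addsmxP[[X1 X2] /= eK] := KEC.
have vrE : vr *m (map_mx iota ME)^T = 0.
  apply/rowP => i; rewrite !mxE -[RHS](vE _ (enum_valP i)) [RHS]big_enum_val /=.
  by apply: eq_bigr => q _; rewrite !mxE mulrC.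
have vrC : vr *m (map_mx iota RB)^T = 0.
  apply/rowP => m; rewrite !mxE -[RHS](vPhi m) [RHS]big_enum_val /=.
  apply: eq_bigr => q _; rewrite !mxE mulrC.
  by case: pselect => [h|]; rewrite ?enum_valP // enum_valK_in.
have vrK : vr *m (map_mx iota K)^T = 0.
  by rewrite eK map_mxD !map_mxM linearD /= !trmx_mul mulmxDr !mulmxA vrE vrC !mul0mx addr0.
pose H := kermx (map_mx iota K)^T.
have GH : (map_mx iota MG <= H)%MS.
  apply/sub_kermxP; rewrite matrix.map_trmx -map_mxM.
  have -> : MG *m K^T = 0 by apply: trmx_inj; rewrite trmx_mul trmxK mulmx_ker trmx0.
  by rewrite map_mx0.
have rH : (\rank H <= \rank (map_mx iota MG))%N.
  rewrite mxrank_ker mxrank_tr !mxrank_map rK rG subKn //.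
  by apply: leq_trans leAB; exact: leq_addl.
have HG : (H <= map_mx iota MG)%MS.
  by rewrite -(geq_leqif (mxrank_leqif_sup GH)).
have /submxP[x ex] : (vr <= map_mx iota MG)%MS.
  by apply: submx_trans HG; apply/sub_kermxP.
exists (fun j => if pselect (j \in B) is left h then x 0 (enum_rank_in h j) else 0).
move=> q qQ; move/rowP/(_ (enum_rank_in qQ q)): ex.
rewrite !mxE enum_rankK_in // => ->; rewrite [RHS]big_enum_val /=.
apply: eq_bigr => j _; rewrite !mxE enum_rankK_in //.
by case: pselect => [h|]; rewrite ?enum_valP // enum_valK_in.
Qed.

(** * Non-degeneracy *)

(* Non-degeneracy for the faces cut out by integral weights, on the torus and
   in terms of the logarithmic derivatives of the face polynomials. *)
Definition log_nondegenerate (L : fieldType) N (S : seq 'X_{1..N}) (f : {mpoly L[N]}) :=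
  forall (c : 'I_N -> nat) (c0 : nat),
  (forall m, m \in S -> (c0 <= wt c m)%N) -> (exists2 m, m \in S & wt c m = c0) ->
  forall a : 'I_N -> L, (forall i, a i != 0) ->
  exists i, \sum_(m <- S | wt c m == c0) (m i)%:R * f@_m * ('X_[m]).@[a] != 0.

Section Nondegenerate.
Variables (L : fieldType) (N : nat) (S : seq 'X_{1..N}) (f : {mpoly L[N]}).
Hypotheses (uS : uniq S) (fS : msupp f =i S) (nd : log_nondegenerate S f).

Lemma meval_supp (G : {linear {mpoly L[N]} -> {mpoly L[N]}}) (a : 'I_N -> L) :
  (G f).@[a] = \sum_(m <- S) f@_m * (G 'X_[m]).@[a].
Proof.
rewrite {1}(mpolyE f) !raddf_sum /= (perm_big S) /=; last first.
  by apply: uniq_perm => //; exact: msupp_uniq.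
by apply: eq_bigr => m _; rewrite linearZ mevalZ.
Qed.

Lemma mevalX_off (a : 'I_N -> L) (m : 'X_{1..N}) i : a i = 0 -> (0 < m i)%N -> ('X_[m]).@[a] = 0.
Proof.
by move=> ai mi; rewrite mevalX (bigD1 i) //= ai expr0n gtn_eqF // mul0r.
Qed.

Lemma euler_monomial (a : 'I_N -> L) (m : 'X_{1..N}) i :
  a i * (mderiv i 'X_[m]).@[a] = (m i)%:R * ('X_[m]).@[a].
Proof.
rewrite mderivX mevalZ mulrCA; have [->|mi] := posnP (m i); first by rewrite !mul0r.
congr (_ * _); rewrite -[in RHS](@submK _ U_(i)%MM m); last first.
  by apply/mnm_lepP => j; rewrite mnm1E; case: eqP => // <-.
by rewrite mpolyXD mevalM mevalXU mulrC.
Qed.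

Lemma mevalX_eq (a c : 'I_N -> L) (m : 'X_{1..N}) :
  (forall i, (0 < m i)%N -> a i = c i) -> ('X_[m]).@[a] = ('X_[m]).@[c].
Proof.
move=> e; rewrite !mevalX; apply: eq_bigr => i _.
by have [->|/e ->] := posnP (m i); rewrite ?expr0.
Qed.

(** Give weight 0 to the coordinates where [a] is nonzero and 1 to the others. A monomial free of
    the latter would make the minimum 0; on that face the zeros of [a] can be replaced by 1, which
    yields a torus point with all logarithmic derivatives zero. *)
Lemma nondegenerate_support (a : 'I_N -> L) :
  (forall i, a i != 0 -> (mderiv i f).@[a] = 0) ->
  forall m, m \in S -> exists2 i, (0 < m i)%N & a i = 0.
Proof.
move=> crit m0 m0S; apply: contrapT => offm0.
pose c i : nat := (a i == 0).
have wt0P (m : 'X_{1..N}) : reflect (forall i, a i = 0 -> m i = 0%N) (wt c m == 0%N).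
  apply: (iffP eqP) => [/eqP|h].
    by rewrite sum_nat_eq0 => /forallP h i ai; have := h i; rewrite /c ai eqxx mul1n => /eqP.
  by rewrite /wt big1 // => i _; rewrite /c; case: eqP => [/h ->|]; rewrite ?muln0.
have [|||i] := nd (c := c) (c0 := 0%N) _ _ (a := fun i => if a i == 0 then 1 else a i).
- by [].
- exists m0 => //; apply/eqP/wt0P => i ai; apply/eqP; rewrite -leqn0 leqNgt.
  by apply/negP => mi; apply: offm0; exists i.
- by move=> i; case: ifP => [_|->]; rewrite ?oner_neq0.
case/negP; have [ai|nai] := eqVneq (a i) 0.
  rewrite big_seq_cond big1 // => m /andP[_ /wt0P h]; by rewrite h // !mul0r.
apply/eqP; transitivity (a i * (mderiv i f).@[a]); last by rewrite crit // mulr0.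
rewrite (meval_supp (mderiv i)) /=.
rewrite mulr_sumr big_mkcond; apply: eq_bigr => m _ /=.
rewrite mulrCA euler_monomial mulrCA mulrA.
case: ifPn => [/wt0P h|/wt0P h].
  by congr (_ * _); apply: mevalX_eq => j mj; case: eqP => // /h e; rewrite e in mj.
have [j hj] : exists j, ~ (a j = 0 -> m j = 0%N).
  by apply: contrapT => h'; apply: h => j; apply: contrapT => nj; apply: h'; exists j.
rewrite (@mevalX_off a m j) ?mulr0 //.
  by apply: contrapT => aj; apply: hj => /aj.
by rewrite lt0n; apply/eqP => mj; apply: hj.
Qed.

Definition touches (Q : {set 'I_N}) (i : 'I_N) (m : 'X_{1..N}) :=
  m i = 1%N /\ off (i |: Q) m.

(** A relation [nu] gives weights: 0 on [Q], 1 where [nu] is nonzero on [B], 2 elsewhere. The face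
    of weight 1 consists of the monomials touching some [i] in [C]. At the torus point equal to [a]
    on [Q] and to [nu] on [C], its logarithmic derivatives along [Q] vanish by the relation, those
    along [C] by the criticality of [a]. *)
Lemma nondegenerate_rows (a : 'I_N -> L) (Q B : {set 'I_N}) :
  (forall i, (a i != 0) = (i \in Q)) ->
  (forall m, m \in S -> ~ off Q m) ->
  (forall i, i \in B -> [/\ i \notin Q, (mderiv i f).@[a] = 0 &
     exists2 m, m \in S & touches Q i m]) ->
  rows_free B Q (fun i q => (mderiv q (mderiv i f)).@[a]).
Proof.
move=> aQ free hB nu hnu i0 i0B; apply: contrapT => /eqP nu0.
pose C := [set i in B | nu i != 0].
have CB i : i \in C -> i \in B by rewrite inE => /andP[].
have CQ i : i \in C -> i \notin Q by move=> /CB /hB[].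
pose c i := if i \in Q then 0%N else if i \in C then 1%N else 2%N.
pose a' i := if i \in Q then a i else if i \in C then nu i else 1.
have i0C : i0 \in C by rewrite inE i0B nu0.
have wt_touch i (m : 'X_{1..N}) : i \in C -> touches Q i m -> wt c m = 1%N.
  move=> iC [mi om]; rewrite /wt (bigD1 i) //= mi /c (negPf (CQ _ iC)) iC big1 // => j nj.
  have [jQ|njQ] := boolP (j \in Q); first by rewrite mul0n.
  by rewrite om ?muln0 // !inE negb_or nj.
have wt_gt0 (m : 'X_{1..N}) : m \in S -> (0 < wt c m)%N.
  move=> mS; rewrite lt0n; apply/negP; rewrite sum_nat_eq0 => /forallP h.
  apply: (free m mS) => i iQ; have := h i; rewrite /c (negPf iQ) muln_eq0.
  by case: ifP => _ /eqP.
have touchP (m : 'X_{1..N}) : wt c m = 1%N -> exists2 i, i \in C & touches Q i m.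
  move=> w1.
  have [i hi] : exists i, (0 < c i * m i)%N.
    apply: contrapT => h; have : wt c m = 0%N.
      rewrite /wt big1 // => i _; apply/eqP; rewrite -leqn0 leqNgt.
      by apply/negP => hi; apply: h; exists i.
    by rewrite w1.
  move: w1; rewrite /wt (bigD1 i) //= => w1.
  have aux x y : (0 < x -> x + y = 1 -> x = 1 /\ y = 0)%N by lia.
  have [/eqP ci1 rest] := aux _ _ hi w1.
  move: ci1; rewrite muln_eq1 => /andP[/eqP ci /eqP mi].
  exists i; first by move: ci; rewrite /c; case: ifP => // _; case: ifP.
  split=> // j; rewrite !inE negb_or => /andP[nj jQ].
  move/eqP: rest; rewrite sum_nat_eq0 => /forallP/(_ j); rewrite nj /= /c (negPf jQ).
  by rewrite muln_eq0; case: ifP => _ /eqP.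
have touch_uniq (m : 'X_{1..N}) i j : i \in C -> j \in C -> touches Q i m -> touches Q j m -> i = j.
  move=> iC jC [mi oi] [mj oj]; apply/eqP/negPn/negP => nij.
  by move: mi; rewrite oj // !inE negb_or nij CQ.
have keyE i (m : 'X_{1..N}) : i \in C ->
    nu i * (mderiv i 'X_[m]).@[a] = (`[< touches Q i m >])%:R * ('X_[m]).@[a'].
  move=> iC; rewrite mderivX mevalZ; have [mi0|mi] := posnP (m i).
    rewrite mi0 mul0r mulr0; case: asboolP => [[h]|]; last by rewrite mul0r.
    by rewrite h in mi0.
  have le1 : (U_(i) <= m)%MM.
    by apply/mnm_lepP => j; rewrite mnm1E; case: eqP => // <-.
  have aoff j : j \notin Q -> a j = 0.
    by move=> jQ; apply/eqP; rewrite -[_ == _]negbK aQ.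
  case: asboolP => [[mi1 om]|nt].
    rewrite mi1 !mul1r -{2}(submK le1) mpolyXD mevalM mevalXU mulrC /a' (negPf (CQ _ iC)) iC.
    congr (_ * _); apply: mevalX_eq => j; rewrite mnmBE mnm1E => hj.
    have jQ : j \in Q.
      apply: contraLR hj => jQ; rewrite -leqNgt leqn0.
      have [e|nij] := eqVneq i j; last by rewrite subn0 om // !inE negb_or eq_sym nij.
      by rewrite -e mi1.
    by rewrite jQ.
  rewrite mul0r; suff [j jQ hj] : exists2 j, j \notin Q & (0 < (m - U_(i))%MM j)%N.
    by rewrite (mevalX_off (aoff _ jQ) hj) !mulr0.
  have [mi1|mi2] := eqVneq (m i) 1%N; last first.
    exists i; first exact: CQ.
    by rewrite mnmBE mnm1E eqxx subn_gt0 ltn_neqAle eq_sym mi2.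
  have [j nj hj] : exists2 j, j \notin i |: Q & m j != 0%N.
    apply: contrapT => h; apply: nt; split=> // j jQ; apply: contrapT => /eqP hj.
    by apply: h; exists j.
  move: nj; rewrite !inE negb_or => /andP[nij jQ]; exists j => //.
  by rewrite mnmBE mnm1E eq_sym (negPf nij) subn0 lt0n.
have a'N i : a' i != 0.
  rewrite /a'; case: ifP => [|_]; first by rewrite -aQ.
  by case: ifP => [|_]; [rewrite inE => /andP[] | rewrite oner_neq0].
have [m1 m1S t1] : exists2 m, m \in S & touches Q i0 m by case: (hB _ i0B).
have [i] := nd wt_gt0 (ex_intro2 _ _ m1 m1S (wt_touch _ _ i0C t1)) a'N.
case/negP; apply/eqP.
have sumC (m : 'X_{1..N}) : m \in S -> (wt c m == 1%N)%:R = \sum_(j in C) (`[< touches Q j m >])%:R :> L.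
  move=> mS; case: eqP => [/touchP[j jC tj]|nw].
    rewrite (bigD1 j) //= big1 ?addr0 => [|l /andP[lC nl]].
      by case: asboolP.
    case: asboolP => // tl; case/eqP: nl.
    exact: touch_uniq lC jC tl tj.
  rewrite big1 // => j jC; case: asboolP => // tj.
  by case: nw; apply: wt_touch tj.
have -> : \sum_(m <- S | wt c m == 1%N) (m i)%:R * f@_m * ('X_[m]).@[a'] =
    \sum_(j in C) \sum_(m <- S) f@_m * ((m i)%:R * (nu j * (mderiv j 'X_[m]).@[a])).
  rewrite exchange_big big_mkcond big_seq [RHS]big_seq /=; apply: eq_bigr => m mS.
  rewrite -[LHS](_ : (wt c m == 1%N)%:R * ((m i)%:R * f@_m * ('X_[m]).@[a']) = _); last first.
    by case: ifP; rewrite ?mul1r ?mul0r.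
  rewrite sumC // mulr_suml; apply: eq_bigr => j jC.
  by rewrite keyE //; ring.
have [iQ|niQ] := boolP (i \in Q); last first.
  rewrite big1 // => j jC; have [<-|nij] := eqVneq j i.
    transitivity (nu j * (mderiv j f).@[a]); last first.
      by have [_ -> _] := hB _ (CB _ jC); rewrite mulr0.
    rewrite (meval_supp (mderiv j)) /= mulr_sumr.
    apply: eq_bigr => m _; rewrite [RHS]mulrCA !keyE //; congr (_ * _).
    by case: asboolP => [[->]|]; rewrite ?mul1r ?mul0r ?mulr0.
  rewrite big1 // => m _; rewrite keyE //; case: asboolP => [[_ om]|]; last by rewrite mul0r !mulr0.
  by rewrite om ?mul0r ?mulr0 // !inE negb_or eq_sym nij.
transitivity (a i * \sum_(j in B) nu j * (mderiv i (mderiv j f)).@[a]); last first.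
  by rewrite hnu // mulr0.
rewrite mulr_sumr [RHS](bigID (mem C)) /= [X in _ = _ + X]big1 ?addr0 => [|j /andP[jB]]; last first.
  by rewrite inE jB /= negbK => /eqP ->; rewrite mul0r mulr0.
rewrite [LHS](eq_bigl (fun j => (j \in B) && (j \in C))) => [|j]; last first.
  by apply/idP/andP => [jC|[]//]; split=> //; exact: CB.
apply: eq_bigr => j /andP[jB jC].
have nij : i != j by apply: contraNneq (CQ _ jC) => <-.
rewrite (meval_supp (mderiv i \o mderiv j)) /= mulrCA mulr_sumr mulr_sumr.
apply: eq_bigr => m _; rewrite mderivX mderivZ !mevalZ.
have := euler_monomial a (m - U_(j))%MM i.
rewrite mnmBE mnm1E (negPf (_ : j != i)) 1?eq_sym // subn0 => e.
rewrite [X in _ = X](_ : _ = f@_m * (nu j * ((m j)%:R * (a i * (mderiv i 'X_[m - U_(j)]).@[a])))); last by ring.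
by rewrite e; ring.
Qed.

End Nondegenerate.

(** A bad torus point over [L] solves a polynomial system over [k] in the coordinates and, as a
    second block of [N] variables, their inverses; the system then has a solution over [k]. *)
Lemma log_nondegenerate_ext (k L : fieldType) (iota : {rmorphism k -> L}) N
    (S : seq 'X_{1..N}) (f : {mpoly k[N]}) :
  alg_closed k -> uncountable k ->
  log_nondegenerate S f -> log_nondegenerate S (map_mpoly iota f).
Proof.
move=> clk unk nd c c0 hc exc a a0; apply: contrapT => h.
pose mon (m : 'X_{1..N}) : {mpoly k[N + N]} := \prod_i 'X_(lshift N i) ^+ m i.
pose P i := \sum_(m <- S | wt c m == c0) ((m i)%:R * f@_m) *: mon m.
pose E (p : {mpoly k[N + N]}) := (exists i, p = P i) \/
  exists i, p = 'X_(lshift N i) * 'X_(rshift N i) - 1.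
pose aa (j : 'I_(N + N)) := match split j with inl i => a i | inr i => (a i)^-1 end.
have aal i : aa (lshift N i) = a i.
  by rewrite /aa; case: splitP => j /= e; [congr a; apply/val_inj | move: (ltn_ord i); rewrite e ltnNge leq_addr].
have aar i : aa (rshift N i) = (a i)^-1.
  rewrite /aa; case: splitP => j /= e; last by congr (a _)^-1; apply/val_inj/eqP; rewrite -(eqn_add2l N) e.
  by move: (ltn_ord j); rewrite -e ltnNge leq_addr.
have [p|b hb] := @weak_nullstellensatz k L iota (N + N) E aa clk unk.
  case=> -[i ->]; last first.
    rewrite (rmorphB (map_mpoly iota)) (rmorphM (map_mpoly iota)) rmorph1 /=.
    by rewrite !map_mpolyX mevalB mevalM !mevalXU meval1 aal aar divff ?subrr.
  apply: contrapT => /eqP n0; apply: h; exists i; move: n0; congr (_ != 0).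
  rewrite /P (raddf_sum (map_mpoly iota)) (raddf_sum (meval aa)) /=; apply: eq_bigr => m _.
  rewrite map_mpolyZ mevalZ mcoeff_map_mpoly rmorphM rmorph_nat; congr (_ * _).
  rewrite /mon !rmorph_prod mevalX; apply: eq_bigr => j _.
  by rewrite !rmorphXn /= map_mpolyX mevalXU aal.
have b0 i : b (lshift N i) != 0.
  have := hb _ (or_intror (ex_intro _ i erefl)).
  rewrite mevalB mevalM !mevalXU meval1 => /eqP; rewrite subr_eq0 => /eqP e.
  by apply: contra_eq_neq e => ->; rewrite mul0r eq_sym oner_neq0.
have [i /negP] := nd c c0 hc exc (fun i => b (lshift N i)) b0; apply.
rewrite -[X in _ == X](hb (P i) (or_introl (ex_intro _ i erefl))).
rewrite /P raddf_sum /=; apply/eqP/eq_bigr => m _; rewrite mevalZ mevalX; congr (_ * _).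
by rewrite rmorph_prod; apply: eq_bigr => j _; rewrite rmorphXn /= mevalXU.
Qed.

(** * The weighted setting *)

Section Coordinates.
Variables s t r : nat.
Notation N := (s + (t + r))%N.

Definition ix (i : 'I_s) : 'I_N := lshift (t + r) i.
Definition iy (j : 'I_t) : 'I_N := rshift s (lshift r j).
Definition iz (l : 'I_r) : 'I_N := rshift s (rshift t l).

Definition pt (T : Type) (x : 'I_s -> T) (y : 'I_t -> T) (z : 'I_r -> T) (i : 'I_N) : T :=
  match split i with
  | inl i => x i
  | inr k => match split k with inl j => y j | inr l => z l end
  end.

Lemma splitK_lshift m n (i : 'I_m) : split (lshift n i) = inl i.
Proof. exact: (unsplitK (inl i)). Qed.

Lemma splitK_rshift m n (i : 'I_n) : split (rshift m i) = inr i.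
Proof. exact: (unsplitK (inr i)). Qed.

Lemma ptx T x y z i : @pt T x y z (ix i) = x i.
Proof. by rewrite /pt splitK_lshift. Qed.

Lemma pty T x y z j : @pt T x y z (iy j) = y j.
Proof. by rewrite /pt splitK_rshift splitK_lshift. Qed.

Lemma ptz T x y z l : @pt T x y z (iz l) = z l.
Proof. by rewrite /pt !splitK_rshift. Qed.

Lemma coord_ind (P : 'I_N -> Prop) :
  (forall i, P (ix i)) -> (forall j, P (iy j)) -> (forall l, P (iz l)) -> forall i, P i.
Proof.
move=> Px Py Pz i; rewrite -(splitK i); case: (split i) => [j|k] /=; first exact: Px.
by rewrite -(splitK k); case: (split k) => [j|l] /=; [exact: Py | exact: Pz].
Qed.

Lemma ix_inj : injective ix. Proof. exact: lshift_inj. Qed.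
Lemma iy_inj : injective iy. Proof. by move=> i j /rshift_inj /lshift_inj. Qed.
Lemma iz_inj : injective iz. Proof. by move=> i j /rshift_inj /rshift_inj. Qed.

Lemma ix_iy i j : (ix i == iy j) = false.
Proof. exact: eq_lrshift. Qed.
Lemma ix_iz i j : (ix i == iz j) = false.
Proof. exact: eq_lrshift. Qed.
Lemma iy_iz i j : (iy i == iz j) = false.
Proof. by rewrite /iy /iz (inj_eq (@rshift_inj _ _)) eq_lrshift. Qed.

Lemma big_coord (R : nmodType) (G : 'I_N -> R) :
  \sum_i G i = \sum_i G (ix i) + (\sum_j G (iy j) + \sum_l G (iz l)).
Proof. by rewrite big_split_ord big_split_ord. Qed.

Definition zset : {set 'I_N} := [set iz l | l in 'I_r].
Definition yzset (A : {set 'I_t}) : {set 'I_N} := [set iy j | j in A] :|: zset.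

Lemma mem_yz A :
  [/\ forall i, (ix i \in yzset A) = false, forall j, (iy j \in yzset A) = (j \in A)
    & forall l, iz l \in yzset A].
Proof.
split=> [i|j|l].
- by apply/negP; rewrite inE => /orP[] /imsetP[j _ /eqP]; rewrite ?ix_iy ?ix_iz.
- rewrite inE mem_imset; last exact: iy_inj.
  by rewrite orbC; case: imsetP => // -[l _ /eqP]; rewrite iy_iz.
- by rewrite inE orbC imset_f.
Qed.

Lemma yzset0 : yzset finset.set0 = zset.
Proof. by rewrite /yzset imset0 finset.set0U. Qed.

Lemma card_zset : #|zset| = r.
Proof. by rewrite card_imset ?card_ord //; exact: iz_inj. Qed.

Lemma card_yzset A : #|yzset A| = (#|A| + r)%N.
Proof.
rewrite cardsU card_zset card_imset; last exact: iy_inj.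
suff -> : [set iy j | j in A] :&: zset = finset.set0 by rewrite cards0 subn0.
apply/setP => i; rewrite !inE; apply/negP => /andP[/imsetP[j _ ->] /imsetP[l _ /eqP]].
by rewrite iy_iz.
Qed.

End Coordinates.
Arguments zset {s t r}. Arguments yzset {s t r} A. Arguments ix {s t r}. Arguments iy {s t r}. Arguments iz {s t r}.

Lemma meval_supp_eq (R : comNzRingType) n (J : {set 'I_n}) (p : {mpoly R[n]}) (a c : 'I_n -> R) :
  supp_in J p -> (forall i, i \in J -> a i = c i) -> p.@[a] = p.@[c].
Proof.
move=> sp e; rewrite !mevalE big_seq [RHS]big_seq; apply: eq_bigr => m /sp om.
congr (_ * _); apply: eq_bigr => i _.
by have [/e ->|/om ->] := boolP (i \in J); rewrite ?expr0.
Qed.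

Section Weights.
Variables (s t r b : nat) (w : 'I_t -> nat).
Notation N := (s + (t + r))%N.
Hypotheses (b_gt0 : (0 < b)%N) (w_bounds : forall j, (0 < w j < b)%N).
Variable S : seq 'X_{1..N}.
Hypotheses (uS : uniq S) (S_weight : in_hyperplane S (@weight s t r b w) b).
Let W := @weight s t r b w.

Lemma weight_x i : W (ix i) = b. Proof. by rewrite /W /weight splitK_lshift. Qed.
Lemma weight_y j : W (iy j) = w j. Proof. by rewrite /W /weight splitK_rshift splitK_lshift. Qed.
Lemma weight_z l : W (iz l) = 0%N. Proof. by rewrite /W /weight !splitK_rshift. Qed.

Lemma wt_S m : m \in S -> (\sum_i b * m (ix i) + \sum_j w j * m (iy j) = b)%N.
Proof.
move=> /S_weight e; rewrite -[RHS]e (big_coord (fun i => W i * m i)%N).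
have -> : (\sum_l W (iz l) * m (iz l) = 0)%N.
  by rewrite big1 // => l _; rewrite weight_z.
by congr (_ + _)%N; rewrite ?addr0; apply: eq_bigr => i _; rewrite ?weight_x ?weight_y.
Qed.

(** A single [x_i] exhausts the weight [b], and each [y_j] has positive weight. *)
Lemma S_touch_x m i : m \in S -> (0 < m (ix i))%N -> touches zset (ix i) m.
Proof.
move=> /wt_S e mi; rewrite -big_distrr (bigD1 i) //= mulnDr in e.
have [e1 e2 e3] : [/\ m (ix i) = 1%N, \sum_(j | j != i) m (ix j) = 0%N &
    \sum_j w j * m (iy j) = 0%N].
  by move: e b_gt0; move: (\sum_(j | j != i) _)%N (\sum_j _)%N (m (ix i)) mi => x y u; clear; split; nia.
split=> //; apply: coord_ind => [j|j|l]; last by rewrite !inE imset_f ?orbT.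
  rewrite !inE negb_or (inj_eq (@ix_inj _ _ _)) => /andP[nj _].
  by move/eqP: e2; rewrite sum_nat_eq0 => /forallP/(_ j); rewrite nj => /eqP.
move=> _; move/eqP: e3; rewrite sum_nat_eq0 => /forallP/(_ j) /=.
by rewrite muln_eq0; case/andP: (w_bounds j); case: (w j) => // ? _ _ /eqP.
Qed.

Lemma S_notz m : m \in S -> ~ off zset m.
Proof.
move=> /wt_S e om; move: e b_gt0; rewrite !big1 ?addn0 => [<- //|j _|i _];
  rewrite om ?muln0 //; apply/negP => /imsetP[l _ /eqP]; by rewrite ?ix_iz ?iy_iz.
Qed.

(** Such a monomial would have weight [w j], which is below [b]. *)
Lemma S_nottouch_y m j : m \in S -> ~ touches zset (iy j) m.
Proof.
move=> /wt_S e [mj om]; move: e; rewrite big1 ?add0n => [|i _]; last first.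
  rewrite om ?muln0 // !inE ix_iy /=.
  by apply/negP => /imsetP[l _ /eqP]; rewrite ix_iz.
rewrite (bigD1 j) //= mj muln1 big1 ?addn0 => [e|i nij]; last first.
  rewrite om ?muln0 // !inE (inj_eq (@iy_inj _ _ _)) negb_or nij /=.
  by apply/negP => /imsetP[l _ /eqP]; rewrite iy_iz.
by have := w_bounds j; rewrite e ltnn andbF.
Qed.

Section Poly.
Variables (L : fieldType) (f : {mpoly L[N]}).
Hypothesis fS : msupp f =i S.

Lemma deriv_x_supp i : supp_in zset (mderiv (ix i) f).
Proof.
move=> m; rewrite mcoeff_msupp mcoeff_mderiv => n0 l lz.
have mS : (m + U_(ix i))%MM \in S.
  by rewrite -fS mcoeff_msupp; apply: contraNneq n0 => ->; rewrite mul0rn.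
have [|e1 om] := S_touch_x (i := i) mS; first by rewrite mnmDE mnm1E eqxx addn1.
have [->|nl] := eqVneq l (ix i).
  by move: e1; rewrite mnmDE mnm1E eqxx addn1 => -[].
have := om l; rewrite !inE negb_or nl lz mnmDE => /(_ erefl).
by move/eqP; rewrite addn_eq0 => /andP[/eqP].
Qed.

Lemma coef_mulX_deriv i m : ('X_i * mderiv i f)@_m = f@_m *+ m i.
Proof.
have [mi|mi] := posnP (m i).
  rewrite mi mulr0n memN_msupp_eq0 //; apply/negP => /msuppM_le /allpairsP[[m1 m2] /= []].
  by rewrite msuppX inE => /eqP -> _ e; move: mi; rewrite e mnmDE mnm1E eqxx.
have le1 : (U_(i) <= m)%MM.
  by apply/mnm_lepP => j; rewrite mnm1E; case: eqP => // <-.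
rewrite mulrC -{1}(submK le1) addmC mcoeffMX mcoeff_mderiv submK //.
by rewrite mnmBE mnm1E eqxx subn1 prednK.
Qed.

Lemma linear_in_x : exists h : {mpoly L[N]},
  supp_in (yzset [set: 'I_t]) h /\ f = h + \sum_i 'X_(ix i) * mderiv (ix i) f.
Proof.
exists (f - \sum_i 'X_(ix i) * mderiv (ix i) f); rewrite subrK; split=> //.
move=> m; rewrite mcoeff_msupp mcoeffB raddf_sum /=.
under eq_bigr do rewrite coef_mulX_deriv.
rewrite sumrMnr => n0; have [_ myz mz] := mem_yz s r [set: 'I_t].
apply: coord_ind => [i _|j|l]; last by rewrite mz.
  have [//|mi] := posnP (m (ix i)).
  have mS : m \in S.
    by rewrite -fS mcoeff_msupp; apply: contraNneq n0 => ->; rewrite mul0rn subrr.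
  have [m1 om] := S_touch_x mS mi.
  case/eqP: n0; rewrite (bigD1 i) //= m1 big1 ?addn0 ?subrr // => l nl.
  rewrite om // !inE negb_or (inj_eq (@ix_inj _ _ _)) nl /=.
  by apply/negP => /imsetP[? _ /eqP]; rewrite ix_iz.
by rewrite myz inE.
Qed.

Lemma euler_f (a : 'I_N -> L) :
  \sum_i (W i)%:R * (a i * (mderiv i f).@[a]) = b%:R * f.@[a].
Proof.
under eq_bigr => i _ do rewrite (meval_supp uS fS (mderiv i)) mulr_sumr mulr_sumr.
have /= -> := meval_supp uS fS idfun a.
rewrite exchange_big /= mulr_sumr.
rewrite big_seq [RHS]big_seq; apply: eq_bigr => m mS /=.
have -> : b%:R = \sum_i (W i)%:R * (m i)%:R :> L.
  by rewrite -[b in LHS](S_weight mS) natr_sum; apply: eq_bigr => i _; rewrite natrM.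
rewrite mulr_suml; apply: eq_bigr => i _; have e := euler_monomial a m i.
transitivity ((W i)%:R * f@_m * (a i * (mderiv i 'X_[m]).@[a])); first by ring.
by rewrite e; ring.
Qed.

End Poly.
End Weights.

(** * The bound over an uncountable algebraically closed field of characteristic zero *)

Lemma char0_inj (L : fieldType) : char0 L -> injective (fun n => n%:R : L).
Proof.
move=> L0; suff H m n : (m < n)%N -> m%:R <> n%:R :> L.
  move=> m n e; have [/H|/H|//] := ltngtP m n; first by rewrite e.
  by case.
move=> lt e; have := L0 (n - m.+1)%N.
by rewrite -subSn // subSS natrB ?(ltnW lt) // e subrr eqxx.
Qed.

Lemma char0_poly (L : fieldType) (q : {poly L}) :
  char0 L -> (forall x, q.[x] = 0) -> q = 0.
Proof.
move=> L0 q0; apply/eqP/negPn/negP => nq.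
pose rs := [seq n%:R : L | n <- iota 0 (size q)].
have := max_poly_roots (rs := rs) nq.
rewrite size_map size_iota ltnn => H; suff : false by []; apply: H.
  by apply/allP => x _; rewrite /root q0 eqxx.
rewrite map_inj_uniq ?iota_uniq //; exact: char0_inj.
Qed.

Section WeightedCone.
Variables (L : fieldType) (n : nat) (w : 'I_n -> nat).

Lemma homog_prod_exp (I : finType) (R : comNzRingType) (lq : I -> {mpoly R[n]}) (d e : I -> nat) :
  (forall i, lq i \is (d i).-homog for (wt w)) ->
  \prod_i lq i ^+ e i \is (\sum_i d i * e i)%N.-homog for (wt w).
Proof.
move=> h; elim/big_rec2: _ => [|i x y _ hy]; first exact: dhomog1.
by apply: dhomogM => //; apply: dhomogMn.
Qed.

Lemma homog_scaling d (p : {mpoly L[n]}) (lam : L) (y : 'I_n -> L) :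
  p \is d.-homog for (wt w) -> p.@[fun j => lam ^+ w j * y j] = lam ^+ d * p.@[y].
Proof.
move=> /dhomogP hp; rewrite !mevalE mulr_sumr big_seq [RHS]big_seq.
apply: eq_bigr => m /hp wm; rewrite mulrCA; congr (_ * _).
under eq_bigr do rewrite exprMn -exprM.
by rewrite big_split /= prodrXr -wm.
Qed.

(** Along the curve [lam ^+ w j * y j] a polynomial of the ideal becomes a polynomial in [lam] whose
    coefficients are its components at [y]; it has infinitely many zeros. *)
Lemma cone_graded (C : set ('I_n -> L)) :
  char0 L -> (forall y lam, C y -> C (fun j => lam ^+ w j * y j)) ->
  graded w (vanish C).
Proof.
move=> L0 hC d p vp y Cy.
pose e := mmeasure (wt w) p.
have pe : p = \sum_(i < e) pihomog (wt w) i p by apply: pihomog_partitionE.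
have [lt|ge] := ltnP d e; last first.
  suff -> : pihomog (wt w) d p = 0 by rewrite meval0.
  rewrite pe raddf_sum big1 //= => i _; apply: pihomog_ne0 (pihomogP _ _ _).
  by rewrite neq_ltn (leq_trans (ltn_ord i) ge).
pose q : {poly L} := \poly_(i < e) (pihomog (wt w) i p).@[y].
have q0 : q = 0.
  apply: char0_poly => // lam; rewrite horner_poly -[RHS](vp _ (hC y lam Cy)).
  rewrite [in RHS]pe (raddf_sum (meval _)) /=; apply: eq_bigr => i _.
  by rewrite (homog_scaling _ _ (pihomogP _ _ _)) mulrC.
by have := congr1 (fun q : {poly L} => q`_d) q0; rewrite coef_poly lt coef0.
Qed.

End WeightedCone.

Section Substitution.
Variables s t r : nat.
Notation N := (s + (t + r))%N.

Definition subst_z (L : comNzRingType) (z : 'I_r -> L) (p : {mpoly L[N]}) : {mpoly L[t]} :=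
  p \mPo [tuple pt (fun _ : 'I_s => 0) (fun j => 'X_j) (fun l => (z l)%:MP) i | i < N].

Lemma subst_zE (k L : comNzRingType) (iota : {rmorphism k -> L}) z p (y : 'I_t -> L) :
  (map_mpoly iota (subst_z z p)).@[y] =
  (map_mpoly iota p).@[pt (fun _ => 0) y (iota \o z)].
Proof.
rewrite /subst_z; elim/mpoly_ring_ind: p => [c|i|p q IHp IHq|p q IHp IHq].
- by rewrite comp_mpolyC !map_mpolyC !mevalC.
- rewrite comp_mpolyXU -tnth_nth tnth_mktuple map_mpolyX mevalXU.
  move: i; apply: coord_ind => [i|j|l]; rewrite ?ptx ?pty ?ptz.
  + by rewrite (rmorph0 (map_mpoly iota)) meval0.
  + by rewrite map_mpolyX mevalXU.
  + by rewrite map_mpolyC mevalC.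
- by rewrite comp_mpolyD !(rmorphD (map_mpoly iota)) /= !mevalD IHp IHq.
- by rewrite (rmorphM (comp_mpoly _)) /= !(rmorphM (map_mpoly iota)) /= !mevalM IHp IHq.
Qed.

Lemma subst_z_meval (L : comNzRingType) z (p : {mpoly L[N]}) (y : 'I_t -> L) :
  (subst_z z p).@[y] = p.@[pt (fun _ => 0) y z].
Proof.
rewrite /subst_z comp_mpoly_meval; apply: meval_eq => i; rewrite tnth_mktuple.
by move: i; apply: coord_ind => [i|j|l]; rewrite ?ptx ?pty ?ptz ?meval0 ?mevalXU ?mevalC.
Qed.

Lemma subst_z_homog (L : comNzRingType) z (p : {mpoly L[N]}) b (w : 'I_t -> nat) d :
  mon_in (fun m => wt (@weight s t r b w) m = d) p ->
  subst_z z p \is d.-homog for (wt w).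
Proof.
move=> hp; rewrite /subst_z comp_mpolyE big_seq; apply: rpred_sum => m /hp <-.
apply: rpredZ; apply: homog_prod_exp => i; rewrite tnth_mktuple.
move: i; apply: coord_ind => [i|j|l]; rewrite ?ptx ?pty ?ptz.
- exact: dhomog0.
- rewrite weight_y dhomogX /= /wt (bigD1 j) //= mnm1E eqxx muln1 big1 ?addn0 //.
  by move=> i nij; rewrite mnm1E eq_sym (negPf nij) muln0.
- by rewrite weight_z -[_%:MP]mulr1 mul_mpolyC; apply: rpredZ; exact: dhomog1.
Qed.

End Substitution.

Lemma supp_in_mderiv (R : comNzRingType) n (J : {set 'I_n}) q (p : {mpoly R[n]}) :
  supp_in J p -> supp_in J (mderiv q p).
Proof.
move=> sp m; rewrite mcoeff_msupp mcoeff_mderiv => n0 i iJ.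
have /sp/(_ i iJ) : (m + U_(q))%MM \in msupp p.
  by rewrite mcoeff_msupp; apply: contraNneq n0 => ->; rewrite mul0rn.
by rewrite mnmDE => /eqP; rewrite addn_eq0 => /andP[/eqP].
Qed.

Lemma mderiv_off (R : comNzRingType) n (J : {set 'I_n}) q (p : {mpoly R[n]}) :
  supp_in J p -> q \notin J -> mderiv q p = 0.
Proof.
move=> sp qJ; apply/mpolyP => m; rewrite mcoeff_mderiv mcoeff0.
rewrite memN_msupp_eq0 ?mul0rn //; apply/negP => /sp/(_ q qJ).
by rewrite mnmDE mnm1E eqxx addn1.
Qed.

Lemma mderiv_map (R R' : comNzRingType) (g : {rmorphism R -> R'}) n i (p : {mpoly R[n]}) :
  mderiv i (map_mpoly g p) = map_mpoly g (mderiv i p).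
Proof.
by apply/mpolyP => m; rewrite mcoeff_mderiv !mcoeff_map_mpoly mcoeff_mderiv /= rmorphMn.
Qed.

Section CoordinateSets.
Variables s t r : nat.
Notation N := (s + (t + r))%N.

Lemma disjoint_images (T1 T2 T3 : finType) (f : T1 -> T3) (g : T2 -> T3) (A : {set T1}) (B : {set T2}) :
  (forall i j, f i == g j = false) -> [disjoint f @: A & g @: B].
Proof.
move=> fg; rewrite -setI_eq0; apply/eqP/setP => x; rewrite !inE.
by apply/negP => /andP[/imsetP[i _ ->] /imsetP[j _ /eqP]]; rewrite fg.
Qed.

Lemma card_imagesU (T1 T2 T3 : finType) (f : T1 -> T3) (g : T2 -> T3) (A : {set T1}) (B : {set T2}) :
  injective f -> injective g -> (forall i j, f i == g j = false) ->
  #|f @: A :|: g @: B| = (#|A| + #|B|)%N.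
Proof.
move=> fi gi fg; rewrite cardsU (disjoint_setI0 (disjoint_images A B fg)) cards0 subn0.
by rewrite !card_imset.
Qed.

Lemma sum_imagesU (R : nmodType) (T1 T2 T3 : finType) (f : T1 -> T3) (g : T2 -> T3)
    (A : {set T1}) (B : {set T2}) (F : T3 -> R) :
  injective f -> injective g -> (forall i j, f i == g j = false) ->
  \sum_(i in f @: A :|: g @: B) F i = \sum_(i in A) F (f i) + \sum_(j in B) F (g j).
Proof.
move=> fi gi fg; rewrite (eq_bigl [predU f @: A & g @: B]) => [|i]; last by rewrite !inE.
rewrite bigU /=; last exact: disjoint_images.
congr (_ + _); first by rewrite big_imset //= => ? ? _ _; exact: fi.
by rewrite big_imset //= => ? ? _ _; exact: gi.
Qed.

End CoordinateSets.

Section DerivX.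
Variables (s t r b : nat) (w : 'I_t -> nat) (S : seq 'X_{1..(s + (t + r))}).
Variables (L : fieldType) (f : {mpoly L[s + (t + r)]}).
Hypotheses (b_gt0 : (0 < b)%N) (w_bounds : forall j, (0 < w j < b)%N).
Hypotheses (S_weight : in_hyperplane S (@weight s t r b w) b) (fS : msupp f =i S).

Lemma deriv_x_eq i a c : (forall l, a (iz l) = c (iz l)) ->
  (mderiv (ix i) f).@[a] = (mderiv (ix i) f).@[c].
Proof.
move=> e; apply: (@meval_supp_eq _ _ zset); first exact: (deriv_x_supp b_gt0 w_bounds S_weight fS).
by move=> _ /imsetP[l _ ->].
Qed.

Lemma deriv2_x_eq q i a c : (forall l, a (iz l) = c (iz l)) ->
  (mderiv q (mderiv (ix i) f)).@[a] = (mderiv q (mderiv (ix i) f)).@[c].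
Proof.
move=> e; apply: (@meval_supp_eq _ _ zset).
  by apply: supp_in_mderiv; exact: (deriv_x_supp b_gt0 w_bounds S_weight fS).
by move=> _ /imsetP[l _ ->].
Qed.

Lemma deriv_yx i j : mderiv (iy j) (mderiv (ix i) f) = 0.
Proof.
apply: (@mderiv_off _ _ zset); first exact: (deriv_x_supp b_gt0 w_bounds S_weight fS).
by apply/negP => /imsetP[l _ /eqP]; rewrite iy_iz.
Qed.

End DerivX.

Lemma deriv_linear_x (s t r b : nat) (w : 'I_t -> nat) (S : seq 'X_{1..(s + (t + r))})
    (L : fieldType) (f : {mpoly L[s + (t + r)]}) (q : 'I_(s + (t + r))) x y z :
  (0 < b)%N -> (forall j, (0 < w j < b)%N) ->
  in_hyperplane S (@weight s t r b w) b -> msupp f =i S -> (forall i, ix i != q) ->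
  (mderiv q f).@[pt x y z] = (mderiv q f).@[pt (fun _ => 0) y z] +
    \sum_i x i * (mderiv q (mderiv (ix i) f)).@[pt (fun _ => 0) y z].
Proof.
move=> b0 wb Sw fS nq; have [h [sh e]] := linear_in_x b0 wb Sw fS.
have E x' : (mderiv q f).@[pt x' y z] = (mderiv q h).@[pt (fun _ => 0) y z] +
    \sum_i x' i * (mderiv q (mderiv (ix i) f)).@[pt (fun _ => 0) y z].
  rewrite {1}e mderivD mevalD; congr (_ + _).
    apply: (@meval_supp_eq _ _ (yzset [set: 'I_t])); first exact: supp_in_mderiv.
    have [m1 _ _] := mem_yz s r [set: 'I_t].
    by apply: coord_ind => [i|j|l]; rewrite ?m1 // ?pty ?ptz.
  rewrite (raddf_sum (mderiv q)) (raddf_sum (meval _)) /=.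
  apply: eq_bigr => i _; rewrite mderivM mderivXU eq_sym (negPf (nq i)) mpolyC0 mul0r add0r.
  rewrite mevalM mevalXU ptx; congr (_ * _).
  by apply: (deriv2_x_eq b0 wb Sw fS) => l; rewrite !ptz.
rewrite !E -addrA; congr (_ + _); rewrite [X in _ = X + _]big1 ?add0r // => i _.
by rewrite mul0r.
Qed.

Section CoreTheorem.
Variables (s t r b : nat) (w : 'I_t -> nat).
Notation N := (s + (t + r))%N.
Hypotheses (b_gt0 : (0 < b)%N) (w_bounds : forall j, (0 < w j < b)%N).
Variable S : seq 'X_{1..N}.
Hypotheses (uS : uniq S) (S_weight : in_hyperplane S (@weight s t r b w) b).
Variables (I : {set 'I_s}) (J : {set 'I_t}) (J' : {set 'I_r}).

Definition touched (A : {set 'I_t}) : {set 'I_t} :=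
  [set j | (j \notin A) && `[< exists2 m, m \in S & touches (yzset A) (iy j) m >]].

(* With weight 0 on A and the z_l, 1 on touched A and the x_i for i in I, 1/2 on the
   other y_j, the monomials of f_I have weight at least 1; this bounds sigma. *)
Definition weighted_cover := exists A : {set 'I_t},
  (forall m, m \in S -> ~ off (yzset A) m) /\
  (2 * (#|I| + #|J'|) + #|J| + #|touched A| <= #|A| + 2 * r)%N.

Lemma touched0 : touched finset.set0 = finset.set0.
Proof.
apply/setP => j; rewrite !inE /=; apply/negbTE/negP => /asboolP[m mS].
by rewrite yzset0; apply: (S_nottouch_y w_bounds S_weight mS).
Qed.

Variables (k0 k1 : fieldType) (iota : {rmorphism k0 -> k1}) (f0 : {mpoly k0[N]}).
Let f1 := map_mpoly iota f0.
Variable z : 'I_r -> k1.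
Let a1 (y : 'I_t -> k1) := pt (fun _ : 'I_s => 0) y z.
Let C : set ('I_t -> k1) := [set y | forall j, (mderiv (iy j) f1).@[a1 y] = 0]%classic.

Hypotheses (clk : alg_closed k1) (unk : uncountable k1) (k1_0 : char0 k1).
Hypotheses (f0S : msupp f0 =i S) (nd : log_nondegenerate S f1).
Hypotheses (hasI : forall i, i \in I -> exists2 m, m \in S & (0 < m (ix i))%N).
Hypotheses (z_neq0 : forall l, z l != 0) (z_indep : alg_indep iota z J').
Hypothesis (gI : forall i, i \in I -> (mderiv (ix i) f1).@[a1 (fun _ => 0)] = 0).
Hypothesis (C_indep : indep_mod (vanish C) J).

Let f1S : msupp f1 =i S.
Proof. by move=> m; rewrite -f0S (perm_mem (msupp_map_mpoly _ (@fmorph_inj _ _ iota))). Qed.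

Lemma deriv_wt i m : m \in msupp (mderiv i f1) ->
  (wt (@weight s t r b w) m + @weight s t r b w i = b)%N.
Proof.
rewrite mcoeff_msupp mcoeff_mderiv => n0.
have mS : (m + U_(i))%MM \in S.
  by rewrite -f1S mcoeff_msupp; apply: contraNneq n0 => ->; rewrite mul0rn.
rewrite -[RHS](S_weight mS) -/(wt _ _) wtD; congr (_ + _)%N.
rewrite /wt (bigD1 i) //= mnm1E eqxx muln1 big1 ?addn0 // => j nij.
by rewrite mnm1E eq_sym (negPf nij) muln0.
Qed.

Lemma cone_scaling y lam : C y -> C (fun j => lam ^+ w j * y j).
Proof.
move=> Cy j; rewrite /= -subst_z_meval (@homog_scaling _ _ _ (b - w j)).
  by rewrite subst_z_meval Cy mulr0.
apply: (@subst_z_homog s t r k1 z _ b w) => m /deriv_wt; rewrite weight_y.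
by move/(congr1 (subn^~ (w j))); rewrite addnK.
Qed.

(** Euler's identity: the [x_i] are 0, the [z_l] have weight 0, the [y]-derivatives vanish on [C],
    and [b] is invertible in characteristic 0. *)
Lemma f1_cone y : C y -> f1.@[a1 y] = 0.
Proof.
move=> Cy; have bn0 : b%:R != 0 :> k1 by rewrite -(prednK b_gt0); exact: k1_0.
apply: (mulfI bn0); rewrite mulr0 -(euler_f uS S_weight f1S) (big_coord (R := k1)).
rewrite big1 ?add0r => [|i _]; last by rewrite /a1 ptx mul0r mulr0.
rewrite big1 ?add0r => [|j _]; last by rewrite Cy !mulr0.
by rewrite big1 // => l _; rewrite weight_z mul0r.
Qed.

Lemma deriv_pt (D : k1 -> k1) p y : derivation D -> (forall c, D (iota c) = 0) ->
  D (map_mpoly iota p).@[a1 y] =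
    \sum_j (map_mpoly iota (mderiv (iy j) p)).@[a1 y] * D (y j) +
    \sum_l (map_mpoly iota (mderiv (iz l) p)).@[a1 y] * D (z l).
Proof.
move=> hD Dk; rewrite (derivation_meval hD) // (big_coord (R := k1)).
rewrite big1 ?add0r => [|i _]; last by rewrite /a1 ptx (derivation0 hD) mulr0.
by congr (_ + _); apply: eq_bigr => i _; rewrite /a1 ?pty ?ptz.
Qed.

(** The relation [f = 0] on [C] is differentiated; the unknown values [D (y j)] are multiplied by
    [y]-derivatives, which vanish there. *)
Lemma deriv_f_cone (D : k1 -> k1) y : derivation D -> (forall c, D (iota c) = 0) -> C y ->
  \sum_l (mderiv (iz l) f1).@[a1 y] * D (z l) = 0.
Proof.
move=> hD Dk Cy; have := deriv_pt f0 y hD Dk.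
rewrite -/f1 f1_cone // (derivation0 hD) big1 ?add0r => [e|j _]; last first.
  by rewrite -mderiv_map Cy mul0r.
by rewrite [RHS]e; apply: eq_bigr => l _; rewrite mderiv_map.
Qed.

Lemma deriv_g (D : k1 -> k1) i : derivation D -> (forall c, D (iota c) = 0) -> i \in I ->
  \sum_l (mderiv (iz l) (mderiv (ix i) f1)).@[a1 (fun _ => 0)] * D (z l) = 0.
Proof.
move=> hD Dk iI; have := deriv_pt (mderiv (ix i) f0) (fun _ => 0) hD Dk.
rewrite -mderiv_map gI // (derivation0 hD) big1 ?add0r => [e|j _]; last first.
  by rewrite ?(derivation0 hD) mulr0.
by rewrite [RHS]e; apply: eq_bigr => l _; rewrite !mderiv_map.
Qed.

Let xI : {set 'I_N} := [set ix i | i in I].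
Let zJ' : {set 'I_N} := [set iz l | l in J'].
Let G (i q : 'I_N) := (mderiv q (mderiv i f1)).@[a1 (fun _ => 0)].

Lemma sum_zset (L : nmodType) (F : 'I_N -> L) : \sum_(q in zset) F q = \sum_l F (iz l).
Proof. by rewrite big_imset //= => i j _ _; exact: iz_inj. Qed.

Lemma touch_xI i : i \in I -> exists2 m, m \in S & touches zset (ix i) m.
Proof.
by move=> /hasI[m mS mi]; exists m => //; exact: (S_touch_x b_gt0 w_bounds S_weight mS mi).
Qed.

Lemma G_free : rows_free xI zset G.
Proof.
apply: (nondegenerate_rows uS f1S nd) => [i|m mS|i /imsetP[j jI ->]].
- move: i; apply: coord_ind => [i|j|l]; rewrite /a1 ?ptx ?pty ?ptz ?eqxx.
  + by apply/esym/negbTE/negP => /imsetP[l _ /eqP]; rewrite ix_iz.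
  + by apply/esym/negbTE/negP => /imsetP[l _ /eqP]; rewrite iy_iz.
  + by rewrite z_neq0 imset_f.
- exact: (S_notz b_gt0 S_weight mS).
- split; [|exact: gI|exact: touch_xI].
  by apply/negP => /imsetP[l _ /eqP]; rewrite ix_iz.
Qed.

Lemma z_derivations : exists D : 'I_r -> k1 -> k1, forall l, l \in J' ->
  [/\ derivation (D l), forall c, D l (iota c) = 0 &
      forall l', l' \in J' -> D l (z l') = (l' == l)%:R].
Proof.
suff /choice[D hD] : forall l, exists D : k1 -> k1, l \in J' ->
    [/\ derivation D, forall c, D (iota c) = 0 &
      forall l', l' \in J' -> D (z l') = (l' == l)%:R] by exists D.
by move=> l; have [D hD] := dual_derivation l k1_0 z_indep; exists D.
Qed.

(** When the number of equations would reach [#|J|], there is nothing left to cut and the empty [A]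
    already satisfies the inequality. *)
Lemma core_small :
  (#|J| <= r - (#|I| + #|J'|))%N -> (#|I| + #|J'| <= r)%N -> weighted_cover.
Proof.
move=> h1 h2; exists finset.set0; rewrite touched0 !cards0 yzset0; split=> [m mS|].
  exact: (S_notz b_gt0 S_weight mS).
by move: h1 h2; clear; lia.
Qed.

Lemma card_zJ' : #|zJ'| = #|J'|.
Proof. by rewrite card_imset //; exact: iz_inj. Qed.

Lemma card_xI : #|xI| = #|I|.
Proof. by rewrite card_imset //; exact: ix_inj. Qed.

(* The tangent space at the generic point z, as the rows of E. *)
Lemma tangent_cut (D : 'I_r -> k1 -> k1) :
  (forall l, l \in J' -> [/\ derivation (D l), forall c, D l (iota c) = 0 &
      forall l', l' \in J' -> D l (z l') = (l' == l)%:R]) ->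
  exists c (Phi : 'I_c -> 'I_N -> k1), (c + #|J'| + #|I|)%N = r /\
    forall (L : fieldType) (iota2 : {rmorphism k1 -> L}) (v : 'I_N -> L),
      (forall l, l \in J' -> \sum_l' v (iz l') * iota2 (D l (z l')) = 0) ->
      (forall m, \sum_l iota2 (Phi m (iz l)) * v (iz l) = 0) ->
      exists x : 'I_s -> L, forall l, v (iz l) = \sum_(i in I) x i * iota2 (G (ix i) (iz l)).
Proof.
move=> hD.
pose E (i q : 'I_N) := pt (fun _ => id) (fun _ => id) D i (a1 (fun _ => 0) q).
have EE l l' : E (iz l) (iz l') = D l (z l') by rewrite /E ptz /a1 ptz.
have E_free : rows_free zJ' zset E.
  move=> nu h _ /imsetP[l lJ ->]; have := h (iz l) (imset_f _ (isT : l \in 'I_r)).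
  rewrite big_imset /= => [|? ? _ _]; last exact: iz_inj.
  rewrite (bigD1 l) //= EE; have [_ _ ->] := hD l lJ; rewrite // eqxx mulr1.
  rewrite big1 ?addr0 // => l' /andP[l'J nl]; rewrite EE; have [_ _ ->] := hD l' l'J.
    by rewrite eq_sym (negPf nl) mulr0.
  by [].
have orth i j : i \in zJ' -> j \in xI -> \sum_(q in zset) E i q * G j q = 0.
  move=> /imsetP[l lJ ->] /imsetP[i' iI ->]; rewrite sum_zset.
  have [hDl Dk _] := hD l lJ; rewrite -[RHS](deriv_g hDl Dk iI).
  by apply: eq_bigr => l' _; rewrite EE mulrC.
have [c [Phi [cE hPhi]]] := orthogonal_complement E_free G_free orth.
exists c, Phi; rewrite -card_zJ' -card_xI cE card_zset; split=> // L iota2 v hv hm.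
have [_ /imsetP[l lJ ->]||x hx] := hPhi L iota2 v.
- rewrite sum_zset -[RHS](hv l lJ); apply: eq_bigr => l' _.
  by rewrite EE mulrC.
- by move=> m; rewrite sum_zset.
exists (fun i => x (ix i)) => l; rewrite hx ?imset_f // big_imset //= => ? ? _ _.
exact: ix_inj.
Qed.

Let H q := subst_z z (mderiv q f1).

Lemma H_homog l : H (iz l) \is b.-homog for (wt w).
Proof.
apply: (@subst_z_homog s t r k1 z _ b w) => m /deriv_wt.
by rewrite weight_z addn0.
Qed.

Theorem core : weighted_cover.
Proof.
have [D hD] := z_derivations; have [c [Phi [cE hPhi]]] := tangent_cut hD.
have [leJ|ltJ] := leqP #|J| c.
  by apply: core_small; move: leJ cE; clear; lia.
have w_gt0 j : (0 < w j)%N by case/andP: (w_bounds j).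
pose us := [seq \sum_l Phi m (iz l) *: H (iz l) | m : 'I_c].
have us_homog u : u \in us -> u \is b.-homog for (wt w).
  move=> /mapP[m _ ->]; apply: rpred_sum => l _; apply: rpredZ; exact: H_homog.
have cJ : #|J| = (#|J| - c + size us)%N.
  by rewrite size_map size_enum_ord subnK // ltnW.
have [I' [J2 [hI' subI' usI' cJ2 indJ2]]] := dim_homog_cut w_gt0 (vanish_ideal C)
  (cone_graded k1_0 cone_scaling) b_gt0 us_homog cJ C_indep.
(* [L2] contains a point [y] of the cut at which the coordinates in [J2] are independent over
   [k1]. *)
have [||p Ip [np sp]|L2 [phi [phi0 phiS _ _]]] :=
    field_avoiding (S := fun p => p != 0 /\ supp_in J2 p) hI'.
- by split; [exact: oner_neq0 | exact: supp_in1].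
- by move=> p q [np sp] [nq sq]; split; [rewrite mulf_neq0 | exact: supp_inM].
- exact: (indJ2 p).
pose iota2 : {rmorphism k1 -> L2} := phi \o (@mpolyC t k1).
pose y j := phi 'X_j.
have phiE p : phi p = (map_mpoly iota2 p).@[y] by exact: mpoly_rmorphE.
have y_indep : alg_indep iota2 y J2.
  by move=> p np sp; rewrite -phiE phiS.
have L2_0 : char0 L2 by move=> n; rewrite -(rmorph_nat iota2) fmorph_eq0.
pose f2 := map_mpoly iota2 f1.
have nd2 : log_nondegenerate S f2 := log_nondegenerate_ext iota2 clk unk nd.
have f2S : msupp f2 =i S.
  by move=> m; rewrite -f1S (perm_mem (msupp_map_mpoly _ (@fmorph_inj _ _ iota2))).
pose z2 := iota2 \o z.
pose a2 := pt (fun _ : 'I_s => 0) y z2.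
have HE q : (mderiv q f2).@[a2] = phi (H q).
  by rewrite phiE subst_zE mderiv_map.
have vanE p : vanish C p -> phi p = 0 by move=> /subI' /phi0.
have crity j : (mderiv (iy j) f2).@[a2] = 0.
  rewrite HE; apply: vanE => y1 Cy1; rewrite subst_z_meval; exact: Cy1.
have zeq (l : 'I_r) : a2 (iz l) = (iota2 \o a1 (fun _ => 0)) (iz l).
  by rewrite /a2 /a1 /= !ptz.
have f2z i q : (mderiv q (mderiv (ix i) f2)).@[a2] = iota2 (G (ix i) q).
  rewrite (deriv2_x_eq b_gt0 w_bounds S_weight f2S q i zeq).
  by rewrite /f2 !mderiv_map map_mpoly_meval -!mderiv_map.
have [x hx] : exists x : 'I_s -> L2, forall l,
    (mderiv (iz l) f2).@[a2] = \sum_(i in I) x i * iota2 (G (ix i) (iz l)).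
  apply: (hPhi _ iota2 (fun q => (mderiv q f2).@[a2])) => [l lJ|m].
    have [hDl Dk _] := hD l lJ.
    under eq_bigr do rewrite HE mulrC -[iota2 _]/(phi (_)%:MP) -rmorphM mul_mpolyC.
    rewrite -rmorph_sum; apply: vanE => y1 Cy1.
    rewrite (raddf_sum (meval y1)) /= -[RHS](deriv_f_cone hDl Dk Cy1).
    by apply: eq_bigr => l' _; rewrite mevalZ subst_z_meval mulrC.
  under eq_bigr do rewrite HE -[iota2 _]/(phi (_)%:MP) -rmorphM mul_mpolyC.
  by rewrite -rmorph_sum; apply/phi0/usI'/mapP; exists m => //; rewrite mem_enum.
have critx c2 i : i \in I -> (mderiv (ix i) f2).@[pt c2 y z2] = 0.
  move=> iI; rewrite (deriv_x_eq b_gt0 w_bounds S_weight f2S i (c := iota2 \o a1 (fun _ => 0))).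
    by rewrite /f2 mderiv_map map_mpoly_meval gI ?rmorph0.
  by move=> l; rewrite -zeq /a2 !ptz.
have z2_neq0 l : z2 l != 0 by rewrite /= fmorph_eq0.
(* These [x]-coordinates cancel the [z]-derivatives. For [i] outside [I] the coordinate is 0, and
   there [nondegenerate_support] asks nothing of the derivative along [x_i]. *)
pose xx i := if i \in I then - x i else 0.
have crit i : pt xx y z2 i != 0 -> (mderiv i f2).@[pt xx y z2] = 0.
  move: i; apply: coord_ind => [i|j|l] _n.
  - by move: _n; rewrite ptx /xx; case: ifP => [iI _|]; [exact: critx | rewrite eqxx].
  - rewrite (deriv_linear_x _ _ _ b_gt0 w_bounds S_weight f2S) => [|i]; last by rewrite ix_iy.
    rewrite crity add0r big1 // => i _.
    by rewrite (deriv_yx b_gt0 w_bounds S_weight f2S) meval0 mulr0.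
  - rewrite (deriv_linear_x _ _ _ b_gt0 w_bounds S_weight f2S) => [|i]; last by rewrite ix_iz.
    rewrite -/a2 hx [X in X + _]big_mkcond -big_split big1 //= => i _.
    rewrite f2z /xx; case: ifP => _; first by rewrite -mulrDl subrr mul0r.
    by rewrite mul0r addr0.
pose A := [set j | y j != 0].
have [mx my mz] := mem_yz s r A.
have a2A i : (a2 i != 0) = (i \in yzset A).
  move: i; apply: coord_ind => [i|j|l]; rewrite /a2 ?ptx ?pty ?ptz ?mx ?my ?mz ?eqxx //.
    by rewrite inE.
  by rewrite z2_neq0.
have free m : m \in S -> ~ off (yzset A) m.
  move=> mS om; have [i mi ai] := nondegenerate_support uS f2S nd2 crit mS.
  have [iA|/om e] := boolP (i \in yzset A); last by rewrite e in mi.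
  move: i iA ai {mi}; apply: coord_ind => [i0|j0|l0]; rewrite ?mx // ?pty ?ptz ?my.
    by rewrite inE => /eqP.
  by move=> _ /eqP; rewrite (negPf (z2_neq0 l0)).
exists A; split=> //.
pose B2 : {set 'I_N} := [set ix i | i in I] :|: [set iy j | j in touched A].
have freeB : rows_free B2 (yzset A) (fun i q => (mderiv q (mderiv i f2)).@[a2]).
  apply: (nondegenerate_rows uS f2S nd2) => // i /setUP[] /imsetP[j hj ->].
  - split; [by rewrite mx | exact: critx|].
    have [m mS [m1 om]] := touch_xI hj; exists m => //; split=> // q.
    rewrite inE negb_or => /andP[q1 q2]; apply: om; rewrite inE negb_or q1 /=.
    by apply: contra q2 => q2; rewrite inE q2 orbT.
  - move: hj; rewrite inE => /andP[jA /asboolP touch].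
    by split; [rewrite my | exact: crity |].
have J2A j : j \in J2 -> j \in A.
  move=> jJ; rewrite inE; have := y_indep 'X_j; rewrite map_mpolyX mevalXU; apply.
    by apply/eqP => /(congr1 (mcoeff U_(j))); rewrite mcoeffXU eqxx mcoeff0 => /eqP; rewrite oner_eq0.
  by apply: mon_inX => l lJ; rewrite mnm1E; case: eqP => // e; rewrite -e jJ in lJ.
have /choice[Dy hDy] j := dual_derivation j L2_0 y_indep.
(* The derivations of [k1] dual to the [z_l] extend to [L2]; their values on the [y_j] are not
   controlled. *)
have /choice[Dz hDz] : forall l, exists Dl : L2 -> L2, l \in J' ->
    derivation Dl /\ forall u, Dl (iota2 u) = iota2 (D l u).
  move=> l; have [lJ|] := boolP (l \in J'); last by exists id.
  have [hDl _ _] := hD l lJ; have [Dl hDl2] := derivation_lift iota2 L2_0 hDl.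
  by exists Dl.
pose Dt : 'I_N -> L2 -> L2 := pt (fun _ => id) Dy Dz.
pose T : {set 'I_N} := [set iy j | j in J2] :|: [set iz l | l in J'].
have Dt_der i : i \in T -> derivation (Dt i) /\ forall u, Dt i (iota2 (iota u)) = 0.
  case/setUP => /imsetP[j hj ->]; rewrite /Dt ?pty ?ptz.
    by have [h1 h2 _] := hDy j; split=> // u; apply: h2.
  have [h1 h2] := hDz j hj; split=> // u; rewrite h2.
  by have [_ -> _] := hD j hj; rewrite rmorph0.
(* The system is block triangular: the [y]-derivations vanish on [k1], hence on the [z_l], so the
   columns [z_l] eliminate the [z]-rows first. *)
have freeT : rows_free T (yzset A) (fun i q => Dt i (a2 q)).
  move=> nu hnu.
  have sumT F : \sum_(i in T) F i = \sum_(j in J2) F (iy j) + \sum_(l in J') F (iz l) :> L2.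
    by apply: sum_imagesU; [exact: iy_inj | exact: iz_inj | exact: iy_iz].
  have nuz l : l \in J' -> nu (iz l) = 0.
    move=> lJ; have := hnu (iz l) (mz l); rewrite sumT big1 ?add0r => [|j jJ]; last first.
      by rewrite /Dt /a2 pty ptz; have [_ -> _] := hDy j; rewrite mulr0.
    rewrite (bigD1 l) //= big1 ?addr0 => [|l' /andP[l'J nl]].
      rewrite /Dt /a2 !ptz /= (hDz l lJ).2; have [_ _ ->] := hD l lJ; rewrite // eqxx.
      by rewrite rmorph1 mulr1.
    rewrite /Dt /a2 !ptz /= (hDz l' l'J).2; have [_ _ ->] := hD l' l'J; rewrite //.
    by rewrite eq_sym (negPf nl) rmorph0 mulr0.
  move=> _ /setUP[] /imsetP[j hj ->]; last exact: nuz.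
  have := hnu (iy j); rewrite my J2A // => /(_ isT); rewrite sumT.
  rewrite [X in _ + X]big1 ?addr0 => [|l lJ]; last by rewrite nuz // mul0r.
  rewrite (bigD1 j) //= big1 ?addr0 => [|l /andP[lJ nl]].
    by rewrite /Dt /a2 !pty; have [_ _ ->] := hDy j; rewrite // eqxx mulr1.
  by rewrite /Dt /a2 !pty; have [_ _ ->] := hDy l; rewrite // eq_sym (negPf nl) mulr0.
(* Apply the derivation to the equation that the derivative of [f2] along [j] is 0 at [a2];
   coordinates outside [yzset A] are 0 and contribute nothing. *)
have orth i j : i \in T -> j \in B2 ->
    \sum_(q in yzset A) Dt i (a2 q) * (mderiv q (mderiv j f2)).@[a2] = 0.
  move=> /Dt_der[hDi Dk] jB.
  have f2j : (mderiv j f2).@[a2] = 0.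
    by case/setUP: jB => /imsetP[l hl ->]; [exact: critx | exact: crity].
  have f2E p : map_mpoly iota2 (map_mpoly iota p) = map_mpoly (iota2 \o iota) p.
    by apply/mpolyP => m; rewrite !mcoeff_map_mpoly.
  have := derivation_meval hDi (iota := iota2 \o iota) (mderiv j f0) a2 Dk.
  rewrite -f2E -!mderiv_map -/f1 -/f2 f2j (derivation0 hDi) => e; rewrite [RHS]e.
  rewrite big_mkcond; apply: eq_bigr => q _ /=.
  rewrite -f2E -!mderiv_map -/f1 -/f2 mulrC.
  case: ifPn => //; rewrite -a2A negbK => /eqP ->.
  by rewrite (derivation0 hDi) mulr0.
(* This reads [#|J2| + #|J'| + #|I| + #|touched A| <= #|A| + r] with [#|J2| = #|J| - c];
   substituting [c = r - #|I| - #|J'|] gives the inequality of the cover. *)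
have := orthogonal_rank freeT freeB orth.
rewrite card_yzset !card_imagesU //; [|exact: ix_inj|exact: iy_inj|exact: ix_iy
  |exact: iy_inj|exact: iz_inj|exact: iy_iz].
rewrite cJ2; move: ltJ cE.
have aux (c' J0 k g B a r' : nat) : (c' < J0 -> c' + k + g = r' ->
    J0 - c' + k + (g + B) <= a + r' -> 2 * (g + k) + J0 + B <= a + 2 * r')%N by clear; lia.
exact: aux.
Qed.

End CoreTheorem.

(** * Ultraproducts *)

Definition fam (K : nat -> fieldType) : Type := forall i, K i.

Section FamilyRing.
Variable K : nat -> fieldType.

HB.instance Definition _ := gen_eqMixin (fam K).
HB.instance Definition _ := gen_choiceMixin (fam K).

Definition fam_add (x y : fam K) : fam K := fun i => x i + y i.
Definition fam_opp (x : fam K) : fam K := fun i => - x i.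
Definition fam_mul (x y : fam K) : fam K := fun i => x i * y i.

Lemma famP (x y : fam K) : (forall i, x i = y i) -> x = y.
Proof. exact: functional_extensionality_dep. Qed.

Lemma fam_addA : associative fam_add.
Proof. by move=> x y z; apply: famP => i; apply: addrA. Qed.
Lemma fam_addC : commutative fam_add.
Proof. by move=> x y; apply: famP => i; apply: addrC. Qed.
Lemma fam_add0 : left_id (fun _ => 0) fam_add.
Proof. by move=> x; apply: famP => i; apply: add0r. Qed.
Lemma fam_addN : left_inverse (fun _ => 0) fam_opp fam_add.
Proof. by move=> x; apply: famP => i; apply: addNr. Qed.

HB.instance Definition _ :=
  GRing.isZmodule.Build (fam K) fam_addA fam_addC fam_add0 fam_addN.

Lemma fam_mulA : associative fam_mul.
Proof. by move=> x y z; apply: famP => i; apply: mulrA. Qed.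
Lemma fam_mulC : commutative fam_mul.
Proof. by move=> x y; apply: famP => i; apply: mulrC. Qed.
Lemma fam_mul1 : left_id (fun _ => 1) fam_mul.
Proof. by move=> x; apply: famP => i; apply: mul1r. Qed.
Lemma fam_mulDl : left_distributive fam_mul +%R.
Proof. by move=> x y z; apply: famP => i; apply: mulrDl. Qed.
Lemma fam_1neq0 : (fun _ => 1) != 0 :> fam K.
Proof.
apply/eqP => /(congr1 (fun x : fam K => x 0%N)) /eqP.
by rewrite (_ : (0 : fam K) 0%N = 0) // oner_eq0.
Qed.

HB.instance Definition _ :=
  GRing.Zmodule_isComNzRing.Build (fam K) fam_mulA fam_mulC fam_mul1 fam_mulDl fam_1neq0.

Definition pr i (x : fam K) : K i := x i.
Lemma pr_zmod i : zmod_morphism (pr i). Proof. by []. Qed.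
Lemma pr_monoid i : monoid_morphism (pr i). Proof. by []. Qed.
HB.instance Definition _ i := GRing.isZmodMorphism.Build (fam K) (K i) (pr i) (pr_zmod i).
HB.instance Definition _ i := GRing.isMonoidMorphism.Build (fam K) (K i) (pr i) (pr_monoid i).

Lemma famBE (x y : fam K) i : (x - y) i = x i - y i. Proof. by []. Qed.

Lemma ultraproduct_field (U : set_system nat) : UltraFilter U ->
  exists (L : fieldType) (phi : {rmorphism fam K -> L}),
    (forall x, phi x = 0 <-> U [set i | x i = 0]%classic) /\ (forall u, exists x, u = phi x).
Proof.
move=> UU; have FU : ProperFilter U by exact: ultra_proper.
pose P (x : fam K) := U [set i | x i = 0]%classic.
have [|||L [phi [phi0 surj]]] := @prime_ideal_field _ P.
- split; rewrite /P.
  + by apply: filterS filterT => i _.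
  + by move=> x y hx hy; apply: filterS (filterI hx hy) => i [/= ex ey]; rewrite [LHS](_ : _ = x i + y i) // ex ey addr0.
  + by move=> a x hx; apply: filterS hx => i /= ex; rewrite [LHS](_ : _ = a i * x i) // ex mulr0.
- rewrite /P => h; apply: (filter_not_empty U); apply: filterS h => i /= /eqP.
  by rewrite [X in X == _](_ : _ = 1) // oner_eq0.
- move=> x y h; have [hx|hx] := in_ultra_setVsetC [set i | x i = 0]%classic UU; first by left.
  right; apply: filterS (filterI h hx) => i [/= /eqP].
  by rewrite [X in X == _](_ : _ = x i * y i) // mulf_eq0 => /orP[/eqP|/eqP].
exists L, phi; split=> // u; have [a [b [nb ->]]] := surj u.
exists (a * (fun i => (b i)^-1 : K i) : fam K); rewrite rmorphM; congr (_ * _).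
apply: (mulfI nb); rewrite divff // -rmorphM -(rmorph1 phi); apply/eqP.
rewrite -subr_eq0 -rmorphB; apply/eqP/phi0.
have [hb|hb] := in_ultra_setVsetC [set i | b i = 0]%classic UU.
  by case/eqP: nb; apply/phi0.
apply: filterS hb => i /= /eqP nbi.
by rewrite [LHS](_ : _ = 1 - b i * (b i)^-1) // divff // subrr.
Qed.

Lemma fam_choice (P : forall i, K i -> Prop) :
  (forall i, exists x, P i x) -> exists x : fam K, forall i, P i (x i).
Proof. by move=> h; exists (fun i => sval (cid (h i))) => i; case: cid. Qed.

End FamilyRing.

Section FamilyMap.
Variables (F K : nat -> fieldType) (iota : forall i, {rmorphism F i -> K i}).
Definition fam_map (x : fam F) : fam K := fun i => iota i (x i).
Lemma fam_map_zmod : zmod_morphism fam_map.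
Proof. by move=> x y; apply: famP => i; apply: rmorphB. Qed.
Lemma fam_map_monoid : monoid_morphism fam_map.
Proof. by split=> [|x y]; apply: famP => i; [apply: rmorph1 | apply: rmorphM]. Qed.
HB.instance Definition _ := GRing.isZmodMorphism.Build (fam F) (fam K) fam_map fam_map_zmod.
HB.instance Definition _ := GRing.isMonoidMorphism.Build (fam F) (fam K) fam_map fam_map_monoid.
End FamilyMap.

Section Factor.
Variables (R : comNzRingType) (F L : fieldType).
Variables (phi : {rmorphism R -> F}) (psi : {rmorphism R -> L}).
Hypotheses (surj : forall u, exists x, u = phi x) (ker : forall x, phi x = 0 -> psi x = 0).

Definition factor (u : F) : L := psi (sval (cid (surj u))).

Lemma factorE x : factor (phi x) = psi x.
Proof.
rewrite /factor; case: cid => y /= e; apply/eqP; rewrite -subr_eq0 -rmorphB.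
by apply/eqP/ker; rewrite rmorphB e subrr.
Qed.

Lemma factor_zmod : zmod_morphism factor.
Proof.
by move=> u v; have [x ->] := surj u; have [y ->] := surj v; rewrite -rmorphB !factorE rmorphB.
Qed.
Lemma factor_monoid : monoid_morphism factor.
Proof.
split=> [|u v]; first by rewrite -(rmorph1 phi) factorE rmorph1.
by have [x ->] := surj u; have [y ->] := surj v; rewrite -rmorphM !factorE rmorphM.
Qed.
HB.instance Definition _ := GRing.isZmodMorphism.Build F L factor factor_zmod.
HB.instance Definition _ := GRing.isMonoidMorphism.Build F L factor factor_monoid.

Lemma rmorph_factor : exists g : {rmorphism F -> L}, forall x, g (phi x) = psi x.
Proof. by exists factor; exact: factorE. Qed.
End Factor.

Section Ultraproduct.
Variables (K : nat -> closedFieldType) (U : set_system nat) (UU : UltraFilter U).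
Hypothesis Uoo : forall n, U [set i | (n <= i)%N]%classic.
Variables (L : fieldType) (phi : {rmorphism fam K -> L}).
Hypotheses (phi0 : forall x, phi x = 0 <-> U [set i | x i = 0]%classic)
  (surj : forall u, exists x, u = phi x).

Let FU : ProperFilter U. Proof. exact: ultra_proper. Qed.

Lemma ultra_eq x y : phi x = phi y <-> U [set i | x i = y i]%classic.
Proof.
have -> : (phi x = phi y) = (phi (x - y) = 0).
  by apply/propext; rewrite rmorphB; split=> [->|/eqP]; [rewrite subrr | rewrite subr_eq0 => /eqP].
rewrite phi0; split; apply: filterS => i /=; rewrite famBE.
  by move=> /eqP; rewrite subr_eq0 => /eqP.
by move=> ->; rewrite subrr.
Qed.

Lemma ultra_neq x y : phi x <> phi y -> U [set i | x i <> y i]%classic.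
Proof.
move=> h; have [|//] := in_ultra_setVsetC [set i | x i = y i]%classic UU.
by move/ultra_eq/h.
Qed.

Lemma ultra_char0 : (forall n i, (n < i)%N -> n.+1%:R != 0 :> K i) -> char0 L.
Proof.
move=> hK n; rewrite -(rmorph_nat phi); apply/eqP => /phi0 h.
apply: (filter_not_empty U); apply: filterS (filterI h (Uoo n.+1)) => i [/= e ni].
have /eqP := hK n i ni; apply.
by rewrite -[LHS](rmorph_nat (pr i : {rmorphism fam K -> K i})); exact: e.
Qed.

Lemma closed_field_avoid (M : closedFieldType) (s : seq M) : exists x, x \notin s.
Proof.
pose p : {poly M} := \prod_(a <- s) ('X - a%:P) + 1.
have [sz|sz] := eqVneq (size p) 1%N.
  have s0 : size s = 0%N.
    move: sz; rewrite /p; case: s {p} => // a s.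
    rewrite size_polyDl size_prod_XsubC ?size_poly1 //=.
  by exists 0; rewrite (size0nil s0).
have [x rx] := closed_rootP p sz; exists x; apply/negP => xs.
move: rx; rewrite /root /p hornerD hornerC horner_prod (big_rem x) //=.
by rewrite hornerXsubC subrr mul0r add0r oner_eq0.
Qed.

(** Diagonal argument: the component [x i] avoids the components of index [i] of representatives of
    the first [i + 1] lists. *)
Lemma ultra_uncountable : uncountable L.
Proof.
move=> l; have /choice[g hg] := surj.
have [x hx] : exists x : fam K, forall i,
    x i \notin [seq g u i | u <- flatten [seq l m | m <- iota 0 i.+1]].
  apply: (@fam_choice _ (fun i x => x \notin [seq g u i | u <- flatten [seq l m | m <- iota 0 i.+1]])).
  by move=> i; exact: closed_field_avoid.
exists (phi x) => m; apply/negP => xm.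
have h := hg (phi x); move/ultra_eq: h => h.
apply: (filter_not_empty U); apply: filterS (filterI h (Uoo m)) => i [/= e mi].
have /negP := hx i; apply; apply/mapP; exists (phi x) => //.
by apply/flattenP; exists (l m) => //; apply: map_f; rewrite mem_iota.
Qed.

(** A root is chosen in each factor; where the leading coefficient is nonzero, hence on a set of
    [U], the polynomial keeps its size. *)
Lemma ultra_alg_closed : alg_closed L.
Proof.
move=> p sp1; have [->|np] := eqVneq p 0; first by exists 0; rewrite root0.
have /choice[g hg] := surj.
pose q i : {poly K i} := \poly_(j < size p) (g p`_j i).
have [x hx] : exists x : fam K, forall i, size (q i) != 1%N -> (q i).[x i] = 0.
  apply: (@fam_choice _ (fun i x => size (q i) != 1%N -> (q i).[x] = 0)) => i.
  have [s1|s1] := eqVneq (size (q i)) 1%N; first by exists 0.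
  by have [x /rootP] := closed_rootP _ s1; exists x.
exists (phi x); apply/rootP; rewrite horner_coef.
have -> : \sum_(i < size p) p`_i * phi x ^+ i = phi (\sum_(i < size p) g p`_i * x ^+ i).
  by rewrite rmorph_sum; apply: eq_bigr => i _; rewrite rmorphM rmorphXn -hg.
apply/phi0.
have lead : U [set i | g (lead_coef p) i <> 0]%classic.
  apply: (@ultra_neq (g (lead_coef p)) 0); rewrite rmorph0 -hg.
  by apply/eqP; rewrite lead_coef_eq0.
apply: filterS lead => i /= /eqP nl.
have sq : size (q i) = size p by rewrite size_poly_eq.
rewrite -[RHS](hx i) ?sq // horner_poly -/(pr i _) rmorph_sum.
by apply: eq_bigr => j _; rewrite rmorphM rmorphXn.
Qed.

Lemma ultra_forall (T : finType) (P : T -> nat -> Prop) :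
  (forall j, U (P j)) -> U [set i | forall j, P j i]%classic.
Proof. by move=> h; apply: filter_forall => j; apply: h. Qed.

End Ultraproduct.

Lemma map_mpoly_comp2 (R1 R2 R3 : comNzRingType) (f : {rmorphism R1 -> R2})
    (g : {rmorphism R2 -> R3}) (h : {rmorphism R1 -> R3}) n (p : {mpoly R1[n]}) :
  (forall x, g (f x) = h x) -> map_mpoly g (map_mpoly f p) = map_mpoly h p.
Proof. by move=> e; apply/mpolyP => m; rewrite !mcoeff_map_mpoly /= e. Qed.

Lemma lift_mpoly (R S : comNzRingType) (f : {rmorphism R -> S}) n (p : {mpoly S[n]}) :
  (forall u, exists x, u = f x) ->
  exists q : {mpoly R[n]}, map_mpoly f q = p /\ {subset msupp q <= msupp p}.
Proof.
move=> /choice[g hg]; exists (\sum_(m <- msupp p) g p@_m *: 'X_[m]); split.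
  rewrite (raddf_sum (map_mpoly f)) [RHS]mpolyE; apply: eq_bigr => m _ /=.
  by rewrite map_mpolyZ map_mpolyX -hg.
rewrite big_seq; apply: mon_in_sum => m mp; apply: mon_inZ; exact: mon_inX.
Qed.

Section UltraCore.
Variables (s t r b : nat) (w : 'I_t -> nat).
Notation N := (s + (t + r))%N.
Hypotheses (b_gt0 : (0 < b)%N) (w_bounds : forall j, (0 < w j < b)%N).
Variable S : seq 'X_{1..N}.
Hypotheses (uS : uniq S) (S_weight : in_hyperplane S (@weight s t r b w) b).
Variables (I : {set 'I_s}) (J : {set 'I_t}) (J' : {set 'I_r}).
Hypothesis (hasI : forall i, i \in I -> exists2 m, m \in S & (0 < m (ix i))%N).

Record datum := Datum {
  dK : closedFieldType;
  dF : fieldType;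
  dio : {rmorphism dF -> dK};
  df : {mpoly dF[N]};
  dz : 'I_r -> dK }.

Definition crit_cone (K : fieldType) (f : {mpoly K[N]}) (z : 'I_r -> K) : set ('I_t -> K) :=
  [set y | forall j, (mderiv (iy j) f).@[pt (fun _ : 'I_s => 0) y z] = 0]%classic.

(** The hypotheses of [core] over a single pair of fields, with characteristic 0 and the
    independence of [z] required only up to the bound [e]. *)
Record good_datum (e : nat) (d : datum) : Prop := GoodDatum {
  d_char : forall n, (n < e)%N -> n.+1%:R != 0 :> dK d;
  d_supp : msupp (df d) =i S;
  d_nd : log_nondegenerate S (map_mpoly (dio d) (df d));
  d_z : forall l, dz d l != 0;
  d_g : forall i, i \in I ->
    (mderiv (ix i) (map_mpoly (dio d) (df d))).@[pt (fun _ : 'I_s => 0) (fun _ => 0) (dz d)] = 0;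
  d_C : indep_mod (vanish (crit_cone (map_mpoly (dio d) (df d)) (dz d))) J;
  d_indep : forall p : {mpoly (dF d)[r]}, p != 0 -> supp_in J' p -> (msize p <= e)%N ->
    (map_mpoly (dio d) p).@[dz d] != 0 }.

Theorem ultra_core : (forall e, exists d, good_datum e d) -> weighted_cover S I J J'.
Proof.
move=> /choice[d hd].
(* An ultrafilter containing all final segments, so that every fixed bound is eventually
   exceeded. *)
have [U [UU ooU]] := ultraFilterLemma eventually_filter.
have FU : ProperFilter U by exact: ultra_proper.
have Uoo n : U [set i | (n <= i)%N]%classic by apply: ooU; exists n.
pose K i : closedFieldType := dK (d i).
pose F i : fieldType := dF (d i).
have [k1 [phi [phi0 phis]]] := @ultraproduct_field K U UU.
have [k0 [chi [chi0 chis]]] := @ultraproduct_field F U UU.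
pose mu : {rmorphism fam F -> fam K} := @fam_map F K (fun i => dio (d i)).
have [iota iotaE] : exists iota : {rmorphism k0 -> k1}, forall x, iota (chi x) = phi (mu x).
  apply: (rmorph_factor (psi := phi \o mu)) => // x /chi0 h; apply/phi0.
  by apply: filterS h => i /= e; rewrite /mu /= /fam_map e rmorph0.
pose cf m : fam F := fun i => (df (d i))@_m.
(* The polynomials are assembled over the product ring, which maps both to each factor and to the
   ultraproduct; identities are compared through it. *)
pose fF : {mpoly (fam F)[N]} := \sum_(m <- S) cf m *: 'X_[m].
have fFc m : fF@_m = if m \in S then cf m else 0.
  rewrite /fF raddf_sum /=; under eq_bigr do rewrite mcoeffZ mcoeffX.
  case: ifPn => mS; last first.
    rewrite big_seq big1 // => u uS'; case: eqP => [e|]; last by rewrite mulr0.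
    by rewrite -e uS' in mS.
  rewrite (bigD1_seq m) //= eqxx mulr1 big1 ?addr0 // => u nu.
  by rewrite (negPf nu) mulr0.
have fFpr i : map_mpoly (@pr F i) fF = df (d i).
  apply/mpolyP => m; rewrite mcoeff_map_mpoly fFc; case: ifPn => // mS.
  by rewrite raddf0 memN_msupp_eq0 // (d_supp (hd i)).
pose f0 := map_mpoly chi fF.
pose fK := map_mpoly mu fF.
have f1E : map_mpoly iota f0 = map_mpoly phi fK.
  by rewrite /f0 /fK !(map_mpoly_comp2 (h := phi \o mu)).
have fKpr i : map_mpoly (@pr K i) fK = map_mpoly (dio (d i)) (df (d i)).
  by rewrite -fFpr /fK !(map_mpoly_comp2 (h := dio (d i) \o @pr F i)).
have f0S : msupp f0 =i S.
  move=> m; rewrite mcoeff_msupp mcoeff_map_mpoly fFc; case: ifPn => mS; last first.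
    by rewrite /= rmorph0 eqxx.
  apply/eqP => /chi0 h; apply: (filter_not_empty U); apply: filterS h => i /= e.
  by move: mS; rewrite -(d_supp (hd i)) mcoeff_msupp -[_@__]/(cf m i) e eqxx.
pose zK l : fam K := fun i => dz (d i) l.
pose z l := phi (zK l).
have evE n (q : {mpoly (fam K)[n]}) (a : 'I_n -> fam K) :
    (map_mpoly phi q).@[fun j => phi (a j)] = phi q.@[a].
  exact: map_mpoly_meval.
have prE n i (q : {mpoly (fam K)[n]}) (a : 'I_n -> fam K) :
    (map_mpoly (@pr K i) q).@[fun j => a j i] = q.@[a] i.
  exact: (map_mpoly_meval (@pr K i)).
have ptE (y : 'I_t -> fam K) : pt (fun _ : 'I_s => 0) (fun j => phi (y j)) z =1
    (fun i => phi (pt (fun _ : 'I_s => 0) y zK i)).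
  by apply: coord_ind => [i|j|l]; rewrite ?ptx ?pty ?ptz ?rmorph0.
have ptpr i (y : 'I_t -> fam K) : pt (fun _ : 'I_s => 0) (fun j => y j i) (dz (d i)) =1
    (fun q => pt (fun _ : 'I_s => 0) y zK q i).
  by apply: coord_ind => [i'|j|l]; rewrite ?ptx ?pty ?ptz.
have derE q (y : 'I_t -> fam K) :
    (mderiv q (map_mpoly iota f0)).@[pt (fun _ : 'I_s => 0) (fun j => phi (y j)) z] =
    phi (mderiv q fK).@[pt (fun _ : 'I_s => 0) y zK].
  by rewrite f1E mderiv_map (meval_eq _ (ptE y)) evE.
have derpr q i (y : 'I_t -> fam K) :
    (mderiv q (map_mpoly (dio (d i)) (df (d i)))).@[pt (fun _ : 'I_s => 0) (fun j => y j i) (dz (d i))] =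
    (mderiv q fK).@[pt (fun _ : 'I_s => 0) y zK] i.
  by rewrite -fKpr mderiv_map (meval_eq _ (ptpr i y)) prE.
have z_neq0 l : z l != 0.
  apply/eqP => /phi0 h; apply: (filter_not_empty U); apply: filterS h => i /= e.
  by have := d_z (hd i) l; rewrite -[dz _ _]/(zK l i) e eqxx.
have clk1 := ultra_alg_closed UU phi0 phis.
have unk1 := ultra_uncountable UU Uoo phi0 phis.
have k1_0 : char0 k1.
  apply: (ultra_char0 UU Uoo phi0) => n i; exact: d_char (hd i) n.
apply: (core (iota := iota) b_gt0 w_bounds uS S_weight clk1 unk1 k1_0 f0S _ hasI z_neq0).
- move=> c c0 hc exc a an0; apply: contrapT => hno.
  (* A representative of a nonzero element may vanish at some indices; replacing these zeros by 1
     gives a torus point in every factor. *)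
  have /choice[A hA] : forall j, exists x : fam K, a j = phi x /\ forall i, x i != 0.
    move=> j; have [x ex] := phis (a j).
    exists (fun i => if x i == 0 then 1 else x i); split=> [|i]; last first.
      by case: ifPn => // _; exact: oner_neq0.
    rewrite ex; apply/(ultra_eq UU phi0).
    have : U [set i | x i <> (0 : fam K) i]%classic.
      by apply: (ultra_neq UU phi0); rewrite rmorph0 -ex; apply/eqP.
    by apply: filterS => i /= /eqP; case: ifP => // /eqP -> /eqP.
  pose Sg i' : fam K := \sum_(m <- S | wt c m == c0) (m i')%:R * fK@_m * ('X_[m]).@[A].
  have Sg0 i' : U [set i | Sg i' i = 0]%classic.
    apply/phi0; apply: contrapT => /eqP n0; apply: hno; exists i'.
    move: n0; congr (_ != 0); rewrite rmorph_sum; apply: eq_bigr => m _.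
    rewrite !rmorphM rmorph_nat  f1E (mcoeff_map_mpoly phi m fK) -evE map_mpolyX.
    by congr (_ * _); apply: meval_eq => j; rewrite (hA j).1.
  apply: (filter_not_empty U); apply: filterS (ultra_forall UU Sg0) => i /= Sgi.
  have [|i' /eqP] := d_nd (hd i) hc exc (a := fun j => A j i).
    by move=> j; exact: (hA j).2.
  apply; rewrite -[RHS](Sgi i') -[RHS]/(pr i (Sg i')) rmorph_sum.
  apply: eq_bigr => m _; rewrite !rmorphM rmorph_nat -fKpr mcoeff_map_mpoly /=.
  by congr (_ * _); rewrite -[RHS]prE map_mpolyX.
- move=> p np sp; have [q [qp qsub]] := lift_mpoly p chis.
  apply/eqP; rewrite -qp (map_mpoly_comp2 (h := phi \o mu)) //.
  rewrite -(map_mpoly_comp2 (f := mu) (g := phi)) // evE => /phi0 h.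
  (* A monomial of [p] fixed beforehand: bounded independence kills the projections of [q] on a set
     of [U], hence the coefficient of [m]. *)
  have [m mp] : exists m, m \in msupp p.
    by exists (mlead p); exact: mlead_supp.
  have : p@_m != 0 by rewrite -mcoeff_msupp.
  case/eqP; rewrite -qp mcoeff_map_mpoly; apply/chi0.
  apply: filterS (filterI h (Uoo (msize p))) => i [/= e0 lei].
  have sub u : u \in msupp (map_mpoly (@pr F i) q) -> u \in msupp p.
    move=> uq; apply: qsub; move: uq; rewrite !mcoeff_msupp mcoeff_map_mpoly.
    by apply: contraNneq => ->; rewrite raddf0.
  have [e1|n1] := eqVneq (map_mpoly (@pr F i) q) 0.
    by rewrite -[LHS](mcoeff_map_mpoly (@pr F i)) e1 mcoeff0.
  have lt : (msize (map_mpoly (@pr F i) q) <= i)%N.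
    apply: leq_trans lei; rewrite [X in (X <= _)%N]msizeE; apply/bigmax_leqP_seq => u uq _.
    by apply: msize_mdeg_lt; exact: sub.
  have /eqP := d_indep (hd i) n1 (fun u uq => sp u (sub u uq)) lt; case.
  rewrite -[RHS]e0 -prE; rewrite !(map_mpoly_comp2 (h := dio (d i) \o @pr F i)) //.
- move=> i iI; have := derE (ix i) (fun _ => 0).
  rewrite (meval_eq (v2 := pt (fun _ : 'I_s => 0) (fun _ : 'I_t => 0) z)); last first.
    by apply: coord_ind => [i'|j|l]; rewrite ?ptx ?pty ?ptz ?rmorph0.
  move=> ->; apply/phi0; apply: filterS filterT => e _ /=.
  by rewrite -derpr -[RHS](d_g (hd e) iI); apply: meval_eq.
- move=> p np sp vp; have [q [qp qsub]] := lift_mpoly p phis.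
  (* In each factor, a point of the cone at which the projection of [q] is nonzero unless it is the
     zero polynomial. Together they form one point of the cone over the ultraproduct. *)
  have [y hy] : exists y : forall i, 'I_t -> K i, forall i,
      crit_cone (map_mpoly (dio (d i)) (df (d i))) (dz (d i)) (y i) /\
      (map_mpoly (@pr K i) q != 0 -> (map_mpoly (@pr K i) q).@[y i] != 0).
    suff ex i : exists y : 'I_t -> K i,
      crit_cone (map_mpoly (dio (d i)) (df (d i))) (dz (d i)) y /\
      (map_mpoly (@pr K i) q != 0 -> (map_mpoly (@pr K i) q).@[y] != 0).
      by exists (fun i => sval (cid (ex i))) => i; case: cid.
    (* When the projection is 0, the polynomial 1 still provides a point of the cone. *)
    pose q' := if map_mpoly (@pr K i) q == 0 then 1 else map_mpoly (@pr K i) q.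
    have nq' : q' != 0 by rewrite /q'; case: ifPn => // _; exact: oner_neq0.
    have sq' : supp_in J q'.
      rewrite /q'; case: ifP => _; first exact: supp_in1.
      move=> u uq; apply: sp; apply: qsub; move: uq.
      rewrite !mcoeff_msupp mcoeff_map_mpoly.
      by apply: contraNneq => ->; rewrite raddf0.
    apply: contrapT => h; apply: (d_C (hd i) nq' sq') => y Cy.
    apply: contrapT => /eqP ny; apply: h; exists y; split=> // n0.
    by move: ny; rewrite /q' (negPf n0).
  pose yK j : fam K := fun i => y i j.
  have Cy : crit_cone (map_mpoly iota f0) z (fun j => phi (yK j)).
    move=> j; rewrite derE; apply/phi0; apply: filterS filterT => i _ /=.
    by rewrite -derpr; exact: (hy i).1.
  have := vp _ Cy; rewrite -qp evE => /phi0 h.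
  have mp := mlead_supp np.
  have : p@_(mlead p) != 0 by rewrite -mcoeff_msupp.
  case/eqP; rewrite -[in LHS]qp mcoeff_map_mpoly; apply/phi0.
  apply: filterS h => i /= e0.
  have [e1|n1] := eqVneq (map_mpoly (@pr K i) q) 0.
    by rewrite -[LHS](mcoeff_map_mpoly (@pr K i)) e1 mcoeff0.
  by have /eqP := (hy i).2 n1; case; rewrite -[RHS]e0 -prE.
Qed.
End UltraCore.

(** * Newton polyhedra *)

Section NewtonBounds.
Variables (R : realType) (n : nat) (F : fieldType) (p : {mpoly F[n]}).

Lemma newton_ge (c : 'I_n -> nat) (c0 : nat) (v : 'rV[R]_n) :
  (forall m, m \in msupp p -> (c0 <= wt c m)%N) -> newton p v ->
  c0%:R <= \sum_i (c i)%:R * v 0 i.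
Proof.
move=> hc [_ [k [q [l [hq l0 l1 ->]]]] [v' v'0 <-]].
have -> : \sum_i (c i)%:R * (\sum_j l j *: q j + v') 0 i =
    \sum_j l j * (\sum_i (c i)%:R * q j 0 i) + \sum_i (c i)%:R * v' 0 i.
  under eq_bigr do rewrite mxE mulrDr summxE mulr_sumr.
  rewrite big_split /= exchange_big; congr (_ + _); apply: eq_bigr => j _.
  by rewrite mulr_sumr; apply: eq_bigr => i _; rewrite mxE mulrCA.
rewrite -[c0%:R]addr0; apply: lerD; last by apply: sumr_ge0 => i _; rewrite mulr_ge0 ?ler0n.
have -> : c0%:R = \sum_j l j * c0%:R :> R by rewrite -mulr_suml l1 mul1r.
apply: ler_sum => j _; apply: ler_wpM2l => //.
have [m mp <-] := hq j.
have -> : \sum_i (c i)%:R * (exponent R m) 0 i = (wt c m)%:R.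
  by rewrite natr_sum; apply: eq_bigr => i _; rewrite mxE natrM.
by rewrite ler_nat; apply: hc.
Qed.

Lemma exponent_newton m : m \in msupp p -> newton p (exponent R m).
Proof.
move=> mp; exists (exponent R m); last first.
  by exists 0; [move=> i; rewrite mxE | rewrite addr0].
exists 1%N, (fun _ => exponent R m), (fun _ => 1); split=> // [_||].
- by exists m.
- by rewrite big_ord1.
- by rewrite big_ord1 scale1r.
Qed.

(** If [(1/x, ..., 1/x)] is in the polyhedron, the valid inequality of [c] reads
    [c0 <= (\sum_i c i) / x]. *)
Lemma sigma_le (c : 'I_n -> nat) (c0 : nat) : (0 < c0)%N ->
  (forall m, m \in msupp p -> (c0 <= wt c m)%N) ->
  (sigma R p <= ((\sum_i c i)%N%:R / c0%:R)%:E)%E.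
Proof.
move=> c0_gt0 hc; apply: ub_ereal_sup => _ [x [x0 hx] <-].
rewrite lee_fin ler_pdivlMr ?ltr0n //.
have : c0%:R <= \sum_i (c i)%:R * x^-1.
  by apply: le_trans (newton_ge hc hx) _; apply: ler_sum => i _; rewrite mxE.
by rewrite -mulr_suml -natr_sum ler_pdivlMr // mulrC.
Qed.

End NewtonBounds.

(** A nonnegative integral weight and its minimum on the support cut out a face of the polyhedron;
    multiplying a partial derivative by the nonzero coordinate makes it logarithmic. *)
Lemma newton_log_nondegenerate (R : realType) n (F K : fieldType) (iota : {rmorphism F -> K})
    (S : seq 'X_{1..n}) (f : {mpoly F[n]}) :
  uniq S -> msupp f =i S -> newton_nondegenerate R iota f ->
  log_nondegenerate S (map_mpoly iota f).
Proof.
move=> uS fS nd c c0 hc [m0 m0S w0] a an0; apply: contrapT => hno.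
have sum0 i : \sum_(m <- S | wt c m == c0) (m i)%:R * (map_mpoly iota f)@_m * ('X_[m]).@[a] = 0.
  by apply: contrapT => /eqP h; apply: hno; exists i.
pose cR : 'rV[R]_n := \row_i (c i)%:R.
pose tau := [set v | newton f v /\ \sum_i cR 0 i * v 0 i = c0%:R]%classic.
have tauE m : m \in msupp f -> `[< tau (exponent R m) >] = (wt c m == c0).
  move=> mf; have e : \sum_i cR 0 i * (exponent R m) 0 i = (wt c m)%:R.
    by rewrite natr_sum; apply: eq_bigr => i _; rewrite !mxE natrM.
  apply/asboolP/eqP => [[_]|wm]; first by rewrite e => /eqP; rewrite eqr_nat => /eqP.
  by split; [exact: exponent_newton | rewrite e wm].
apply: (nd tau).
- exists cR, c0%:R; split=> // v hv.
  have -> : \sum_i cR 0 i * v 0 i = \sum_i (c i)%:R * v 0 i.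
    by apply: eq_bigr => i _; rewrite mxE.
  by apply: (newton_ge _ hv) => m; rewrite fS; exact: hc.
- exists (exponent R m0); apply/asboolP; rewrite tauE ?fS //; exact/eqP.
exists a; split=> // i; apply: (mulfI (an0 i)); rewrite mulr0 -[RHS](sum0 i).
rewrite /face_part (raddf_sum (mderiv i)) (raddf_sum (map_mpoly iota)) (raddf_sum (meval a)) mulr_sumr /=.
rewrite -[LHS]big_filter -[RHS]big_filter; apply: etrans (perm_big _ _) _; last first.
  apply: eq_bigr => m _; rewrite mderivZ map_mpolyZ mevalZ mulrCA -mderiv_map map_mpolyX.
  by rewrite euler_monomial mcoeff_map_mpoly mulrCA mulrA.
rewrite (@eq_in_filter _ _ (fun m => wt c m == c0)) //.
by apply/perm_filter/uniq_perm => //; exact: msupp_uniq.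
Qed.

(** * The polynomials [f_I] and their derivatives *)

Section Rename.
Variables (F : fieldType) (m n : nat) (e : 'I_m -> 'I_n).
Implicit Type p : {mpoly F[m]}.

Lemma renameD p q : rename e (p + q) = rename e p + rename e q.
Proof. exact: comp_mpolyD. Qed.

Lemma renameM p q : rename e (p * q) = rename e p * rename e q.
Proof. exact: rmorphM. Qed.

Lemma renameC c : rename e (c%:MP : {mpoly F[m]}) = c%:MP.
Proof. exact: comp_mpolyC. Qed.

Lemma renameX i : rename e ('X_i : {mpoly F[m]}) = 'X_(e i).
Proof. by rewrite /rename comp_mpolyXU -tnth_nth tnth_mktuple. Qed.

Lemma meval_rename (K : fieldType) (iota : {rmorphism F -> K}) p (a : 'I_n -> K) :
  (map_mpoly iota (rename e p)).@[a] = (map_mpoly iota p).@[a \o e].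
Proof.
elim/mpoly_ring_ind: p => [c|i|p q IHp IHq|p q IHp IHq].
- by rewrite renameC !map_mpolyC !mevalC.
- by rewrite renameX !map_mpolyX !mevalXU.
- by rewrite renameD !(rmorphD (map_mpoly iota)) /= !mevalD IHp IHq.
- by rewrite renameM !(rmorphM (map_mpoly iota)) /= !mevalM IHp IHq.
Qed.

Lemma supp_rename p : supp_in [set e i | i in 'I_m] (rename e p).
Proof.
elim/mpoly_ring_ind: p => [c|i|p q IHp IHq|p q IHp IHq].
- by rewrite renameC; exact: supp_inC.
- rewrite renameX; apply: mon_inX => j jE; rewrite mnm1E.
  by case: eqP => // ej; rewrite -ej imset_f in jE.
- by rewrite renameD; apply: mon_inD.
- by rewrite renameM; apply: supp_inM.
Qed.

Lemma mderiv_rename i p : injective e ->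
  mderiv (e i) (rename e p) = rename e (mderiv i p).
Proof.
move=> ei; elim/mpoly_ring_ind: p => [c|j|p q IHp IHq|p q IHp IHq].
- by rewrite renameC !mderivC /rename comp_mpoly0.
- by rewrite renameX !mderivXU renameC (inj_eq ei).
- by rewrite renameD !mderivD renameD IHp IHq.
- by rewrite renameM !mderivM renameD !renameM IHp IHq.
Qed.

Lemma rename_eq0 p : injective e -> rename e p = 0 -> p = 0.
Proof.
move=> ei h; pose back : n.-tuple {mpoly F[m]} :=
  [tuple (if [pick j | e j == i] is Some j then 'X_j else 0) | i < n].
suff : rename e p \mPo back = p by rewrite h comp_mpoly0.
elim/mpoly_ring_ind: {h} p => [c|i|p q IHp IHq|p q IHp IHq].
- by rewrite renameC comp_mpolyC.
- rewrite renameX comp_mpolyXU -tnth_nth tnth_mktuple.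
  by case: pickP => [j /eqP /ei ->|/(_ i)]; rewrite ?eqxx.
- by rewrite renameD comp_mpolyD IHp IHq.
- by rewrite renameM (rmorphM (comp_mpoly _)) /= IHp IHq.
Qed.

End Rename.

Section PartialSum.
Variables s t r : nat.
Notation N := (s + (t + r))%N.
Variables (F : fieldType) (h : {mpoly F[t + r]}) (g : 'I_s -> {mpoly F[r]}).
Let f : {mpoly F[N]} := partial_sum h g finset.setT.

Lemma x_notin i : @ix s t r i \notin [set rshift s k | k in 'I_(t + r)].
Proof. by apply/negP => /imsetP[k _ /eqP]; rewrite eq_lrshift. Qed.

Lemma notin_z k : (forall l, k != @iz s t r l) ->
  k \notin [set rshift s (rshift t l) | l in 'I_r].
Proof. by move=> nk; apply/negP => /imsetP[l _ e]; have := nk l; rewrite e eqxx. Qed.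

Lemma partial_fullE : f = rename (@rshift s (t + r)) h +
  \sum_i rename (fun l => rshift s (rshift t l)) (g i) * 'X_(ix i).
Proof. by congr (_ + _); apply: eq_bigl => i; rewrite inE. Qed.

Lemma partial_deriv_x i : mderiv (ix i) f = rename (fun l => rshift s (rshift t l)) (g i).
Proof.
rewrite partial_fullE mderivD (mderiv_off (@supp_rename _ _ _ _ h) (x_notin i)) add0r.
rewrite (raddf_sum (mderiv (ix i))) /= (bigD1 i) //= big1 ?addr0 => [|j nij].
  rewrite mderivM (mderiv_off (@supp_rename _ _ _ _ _) (notin_z _)) ?mul0r ?add0r.
    by rewrite mderivXU eqxx mulr1.
  by move=> l; rewrite ix_iz.
rewrite mderivM (mderiv_off (@supp_rename _ _ _ _ _) (notin_z _)) ?mul0r ?add0r.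
  by rewrite mderivXU (inj_eq (@ix_inj _ _ _)) eq_sym (negPf nij) mulr0.
by move=> l; rewrite ix_iz.
Qed.

Lemma partial_deriv_y j : mderiv (iy j) f = rename (@rshift s (t + r)) (mderiv (lshift r j) h).
Proof.
have E := mderiv_rename (lshift r j) h (@rshift_inj s (t + r)).
rewrite partial_fullE mderivD [X in X + _]E.
rewrite -[RHS]addr0; congr (_ + _); rewrite (raddf_sum (mderiv (iy j))) big1 //= => i _.
rewrite mderivM (mderiv_off (@supp_rename _ _ _ _ _) (notin_z _)) ?mul0r ?add0r.
  by rewrite mderivXU eq_sym ix_iy mulr0.
by move=> l; rewrite iy_iz.
Qed.

Variables (K : fieldType) (iota : {rmorphism F -> K}).

Lemma partial_deriv_x_eval i (y : 'I_t -> K) z :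
  (mderiv (ix i) (map_mpoly iota f)).@[pt (fun _ : 'I_s => 0) y z] = (map_mpoly iota (g i)).@[z].
Proof.
rewrite mderiv_map partial_deriv_x meval_rename; apply: meval_eq => l.
by rewrite /= -[rshift s _]/(iz l) ptz.
Qed.

Lemma fiber_deriv j (u : {mpoly F[t + r]}) (y : 'I_t -> K) z :
  (mderiv j (fiber iota u z)).@[y] = (map_mpoly iota (mderiv (lshift r j) u)).@[fun k =>
     match split k with inl j => y j | inr l => z l end].
Proof.
have fE v : (fiber iota v z).@[y] =
    (map_mpoly iota v).@[fun k => match split k with inl j => y j | inr l => z l end].
  rewrite /fiber comp_mpoly_meval; apply: meval_eq => k; rewrite tnth_mktuple.
  by case: (split k) => [i|l]; rewrite ?mevalXU ?mevalC.
elim/mpoly_ring_ind: u => [c|k|p q IHp IHq|p q IHp IHq].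
- rewrite /fiber map_mpolyC comp_mpolyC !mderivC (rmorph0 (map_mpoly iota)) !meval0 //.
- rewrite mderivXU map_mpolyC mevalC /= rmorph_nat.
  rewrite /fiber map_mpolyX comp_mpolyXU -tnth_nth tnth_mktuple.
  rewrite -(splitK k); case: (split k) => [i|l] /=.
    rewrite (splitK_lshift r i).
    by rewrite mderivXU mevalC (inj_eq (@lshift_inj _ _)).
  by rewrite (splitK_rshift t l) mderivC meval0 eq_lrshift.
- rewrite /fiber (rmorphD (map_mpoly iota)) comp_mpolyD /= mderivD mevalD.
  by rewrite mderivD (rmorphD (map_mpoly iota)) /= mevalD -IHp -IHq.
- rewrite /fiber (rmorphM (map_mpoly iota)) (rmorphM (comp_mpoly _)) /= mderivM mevalD !mevalM.
  rewrite mderivM (rmorphD (map_mpoly iota)) /= !(rmorphM (map_mpoly iota)) /= mevalD !mevalM.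
  by rewrite -IHp -IHq -!fE.
Qed.

Lemma crit_locusE z : crit_locus (fiber iota h z) = crit_cone (map_mpoly iota f) z.
Proof.
have e j (y : 'I_t -> K) : (mderiv j (fiber iota h z)).@[y] =
    (mderiv (iy j) (map_mpoly iota f)).@[pt (fun _ : 'I_s => 0) y z].
  rewrite fiber_deriv mderiv_map partial_deriv_y meval_rename; apply: meval_eq => k.
  by rewrite /= /pt splitK_rshift.
by apply/seteqP; split=> y hy j; have := hy j; rewrite e.
Qed.

Lemma partial_sum_supp (I : {set 'I_s}) m : m \in msupp (partial_sum h g I) ->
  m \in msupp f /\ forall i, i \notin I -> m (ix i) = 0%N.
Proof.
move=> mI.
have m0 i : i \notin I -> m (ix i) = 0%N.
  move=> iI; have sP : supp_in (~: [set ix i | i in ~: I]) (partial_sum h g I).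
    apply: mon_inD.
      move=> u /(@supp_rename _ _ _ _ h) ou k; rewrite !inE negbK => /imsetP[i' _ ->].
      exact/ou/x_notin.
    apply: mon_in_sum => i' i'I; apply: supp_inM.
      move=> u /(@supp_rename _ _ _ _ (g i')) ou k; rewrite !inE negbK => /imsetP[i2 _ ->].
      by apply/ou/notin_z => l; rewrite ix_iz.
    apply: mon_inX => k; rewrite !inE negbK => /imsetP[i2 i2I ->]; rewrite mnm1E.
    rewrite (inj_eq (@ix_inj _ _ _)); case: eqP => // e.
    by move: i2I; rewrite inE -e i'I.
  by apply: (sP m mI); rewrite !inE negbK imset_f // inE.
split=> //; rewrite mcoeff_msupp.
suff -> : f@_m = (partial_sum h g I)@_m by rewrite -mcoeff_msupp.
rewrite /f /partial_sum !mcoeffD; congr (_ + _).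
rewrite (bigID (fun i => i \in I)) /= mcoeffD [X in _ + X]raddf_sum /=.
rewrite [X in _ + X]big1 ?addr0 => [|i /andP[_ iI]].
  by congr (_@__); apply: eq_bigl => i; rewrite inE.
apply: memN_msupp_eq0; apply/negP => /msuppM_le /allpairsP[[m1 m2] /= [_]].
rewrite msuppX inE => /eqP -> e; have := m0 i iI.
by rewrite e mnmDE mnm1E eqxx addn1.
Qed.

End PartialSum.

(** * From a weighted cover to a bound on sigma *)

Section SigmaBound.
Variables (s t r : nat) (S : seq 'X_{1..(s + (t + r))}).
Variables (I : {set 'I_s}) (J : {set 'I_t}) (J' : {set 'I_r}).

Lemma sigma_cover (R : realType) (F : fieldType) (p : {mpoly F[s + (t + r)]}) :
  weighted_cover S I J J' ->
  (forall m, m \in msupp p -> m \in S /\ forall i, i \notin I -> m (ix i) = 0%N) ->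
  (sigma R p <= (r%:R + (t%:R - #|J|%:R) / 2 - #|J'|%:R)%:E)%E.
Proof.
move=> [A [free le]] pS; set B := touched S A in le.
(* Twice the weights of the cover, to stay integral: monomials must weigh at least 2, and the total
   is [2 * #|I| + t + #|B| - #|A|]. *)
pose kx (i : 'I_s) := if i \in I then 2%N else 0%N.
pose ky (j : 'I_t) := if j \in A then 0%N else if j \in B then 2%N else 1%N.
pose k := pt kx ky (fun _ : 'I_r => 0%N).
have hw m : m \in msupp p -> (2 <= wt k m)%N.
  move=> /pS[mS m0].
  have -> : wt k m = (\sum_i kx i * m (ix i) + \sum_j ky j * m (iy j))%N.
    rewrite /wt (big_coord (fun i => k i * m i)%N).
    have -> : (\sum_l k (iz l) * m (iz l) = 0)%N by rewrite big1 // => l _; rewrite /k ptz.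
    by congr (_ + _)%N; rewrite ?addr0; apply: eq_bigr => i _; rewrite /k ?ptx ?pty.
  have [[i mi]|nox] := pselect (exists i, (0 < m (ix i))%N).
    apply: leq_trans (leq_addr _ _); rewrite (bigD1 i) //=; apply: leq_trans (leq_addr _ _).
    have iI : i \in I by apply: contraTT mi => /m0 ->.
    by rewrite /kx iI; case: (m (ix i)) mi => // ? _; rewrite mulnS leq_addr.
  have x0 i : m (ix i) = 0%N.
    by apply/eqP; rewrite -leqn0 leqNgt; apply/negP => h; apply: nox; exists i.
  apply: leq_trans (leq_addl _ _).
  have /existsNP[q /not_implyP[qA /eqP mq]] : ~ off (yzset A) m by exact: free.
  have [mx my mz] := mem_yz s r A.
  have [j [jA mj]] : exists j, j \notin A /\ (0 < m (iy j))%N.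
    move: qA mq; move: q; apply: coord_ind => [i _|j|l]; first by rewrite x0.
      by rewrite my -lt0n; exists j.
    by rewrite mz.
  rewrite (bigD1 j) //= {1}/ky (negPf jA); case: ifPn => jB.
    by apply: leq_trans (leq_addr _ _); case: (m (iy j)) mj => // ? _; rewrite mulnS leq_addr.
  (* Here [y_j] has weight 1. If it occurs once, another [y] outside [A] must occur, since otherwise
     [m] would touch [j] and put it into [B]. *)
  rewrite mul1n; have [m2|m1] := ltnP 1 (m (iy j)); first exact: leq_trans (leq_addr _ _).
  have {m1}mj1 : m (iy j) = 1%N by apply/eqP; rewrite eqn_leq m1.
  rewrite mj1 add1n ltnS lt0n sum_nat_eq0; apply/negP => /forallP h0.
  move: jB; rewrite inE jA /= => /asboolP; apply; exists m => //; split=> //.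
  apply: coord_ind => [i _|j'|l]; first exact: x0.
    rewrite in_setU1 negb_or my (inj_eq (@iy_inj _ _ _)) => /andP[nj j'A].
    move: (h0 j'); rewrite nj /= muln_eq0 /ky (negPf j'A).
    by case: ifP => _ /=; move/eqP.
  by rewrite in_setU1 mz orbT.
have sumk : (\sum_i k i + #|A| = 2 * #|I| + t + #|B|)%N.
  rewrite (big_coord k).
  have -> : (\sum_l k (iz l) = 0)%N by rewrite big1 // => l _; rewrite /k ptz.
  rewrite addr0.
  have -> : (\sum_i k (ix i) = 2 * #|I|)%N.
    by rewrite mulnC -sum_nat_const [RHS]big_mkcond; apply: eq_bigr => i _; rewrite /k ptx.
  rewrite -[LHS]addnA -[RHS]addnA; apply: congr2 => //.
  have -> : (\sum_j k (iy j) = \sum_j ky j)%N by apply: eq_bigr => j _; rewrite /k pty.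
  transitivity (\sum_(j < t) 1 + #|B|)%N; last by rewrite sum1_card card_ord.
  rewrite -[#|A|]sum1_card -[#|B|]sum1_card.
  rewrite [X in (_ + X)%N]big_mkcond [X in (_ = _ + X)%N]big_mkcond -!big_split.
  apply: eq_bigr => j _ /=; rewrite /ky.
  have [jA|//] := boolP (j \in A); last by case: ifP.
  by rewrite inE jA.
apply: le_trans (sigma_le R (isT : (0 < 2)%N) hw) _; rewrite lee_fin.
have : (\sum_i k i + #|J| + #|J'| + #|J'| <= r + r + t)%N.
  by move: sumk le; clear; lia.
rewrite -(ler_nat R) !natrD; clear; lra.
Qed.

End SigmaBound.

(** * Independent coordinates on strata *)

Section Dimension.
Variables (K : fieldType) (n : nat).
Implicit Types X : set ('I_n -> K).

(** A finite supremum of integers is attained: chains shorter than [d] only would bound it by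
    [d - 1]. A longer chain is truncated. *)
Lemma zdim_zchain (R : realType) X d : zdim R X = d%:R%:E -> has_zchain X d.
Proof.
move=> e; have [[k [dk [c [hc lt]]]]|no] := pselect (exists k, (d <= k)%N /\ has_zchain X k).
  by exists c; split=> i ik; [apply/hc/(leq_trans ik) | apply/lt/(leq_trans ik)].
have : (zdim R X <= (d%:R - 1)%:E)%E.
  apply: ub_ereal_sup => _ [k hk <-]; rewrite lee_fin.
  have : (k < d)%N by rewrite ltnNge; apply/negP => dk; apply: no; exists k.
  by rewrite -(ler_nat R) -natr1 => ?; lra.
by rewrite e lee_fin; lra.
Qed.

Lemma vanish_zclosure X p : vanish X p -> vanish (zclosure X) p.
Proof.
move=> h x /(_ (zero_locus [set p]%classic)); apply; last by [].
by split; [exists [set p]%classic | move=> y Xy _ ->; exact: h].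
Qed.

Lemma indep_mod_zclosure X J : indep_mod (vanish (zclosure X)) J -> indep_mod (vanish X) J.
Proof. by move=> h p p0 sp /vanish_zclosure; exact: h. Qed.

Lemma supp_in_prod (R : comNzRingType) (J : {set 'I_n}) (T : Type) (s : seq T) (P : pred T)
    (G : T -> {mpoly R[n]}) :
  (forall i, P i -> supp_in J (G i)) -> supp_in J (\prod_(i <- s | P i) G i).
Proof. by move=> h; apply: big_ind => //; [exact: supp_in1 | exact: supp_inM]. Qed.

(** Nonzero polynomials vanishing on the separate pieces would have a nonzero product vanishing on
    [X]. *)
Lemma indep_mod_cover (T : finType) X (Z : T -> set ('I_n -> K)) J :
  (forall x, X x -> exists i, Z i x) -> indep_mod (vanish X) J ->
  exists i, indep_mod (vanish (Z i)) J.
Proof.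
move=> XZ ind; apply: contrapT => /forallNP no.
have /choice[p hp] : forall i, exists p, [/\ p != 0, supp_in J p & vanish (Z i) p].
  by move=> i; have /existsNP[p /not_implyP[p0 /not_implyP[sp /contrapT vp]]] := no i; exists p.
apply: (ind (\prod_i p i)).
- by apply/prodf_neq0 => i _; have [] := hp i.
- by apply: supp_in_prod => i _; have [] := hp i.
move=> x /XZ[i Zx]; have [_ _ v] := hp i.
by rewrite (bigD1 i) //= mevalM v ?mul0r.
Qed.

Lemma indep_mod_nonempty X J : indep_mod (vanish X) J -> exists x, X x.
Proof.
move=> ind; apply: contrapT => /forallNP no; apply: (ind 1); first exact: oner_neq0.
- exact: supp_in1.
by move=> x /no.
Qed.

Lemma supp_in_map (F : fieldType) (iota : {rmorphism F -> K}) J (p : {mpoly F[n]}) :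
  supp_in J p -> supp_in J (map_mpoly iota p).
Proof.
move=> sp m; rewrite mcoeff_msupp mcoeff_map_mpoly fmorph_eq0 -mcoeff_msupp; exact: sp.
Qed.

Lemma map_mpoly_neq0 (F : fieldType) (iota : {rmorphism F -> K}) (p : {mpoly F[n]}) :
  p != 0 -> map_mpoly iota p != 0.
Proof.
apply: contra_neq => e; apply/mpolyP => m; apply: (fmorph_inj iota).
by rewrite -mcoeff_map_mpoly e !mcoeff0 rmorph0.
Qed.

(* Over a finite field, only finitely many polynomials of bounded degree are to be avoided. *)
Lemma indep_mod_avoid (F : finFieldType) (iota : {rmorphism F -> K}) X J e :
  indep_mod (vanish X) J -> exists2 x, X x &
  forall p : {mpoly F[n]}, p != 0 -> supp_in J p -> (msize p <= e)%N ->
    (map_mpoly iota p).@[x] != 0.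
Proof.
move=> ind; pose P (a : {ffun 'X_{1..n < e} -> F}) := \sum_m a m *: 'X_[m] : {mpoly F[n]}.
pose ok a := (P a != 0) && `[< supp_in J (P a) >].
have /existsNP[x /not_implyP[Xx /eqP nx]] : ~ vanish X (\prod_(a | ok a) map_mpoly iota (P a)).
  apply: ind; first by apply/prodf_neq0 => a /andP[Pa _]; exact: map_mpoly_neq0.
  by apply: supp_in_prod => a /andP[_ /asboolP]; exact: supp_in_map.
exists x => // p p0 sp le; pose a := [ffun m : 'X_{1..n < e} => p@_m].
have pE : p = P a by rewrite [LHS](mpolywE le); apply: eq_bigr => m _; rewrite ffunE.
apply: contraNneq nx => px; rewrite (bigD1 a) /= ?mevalM -?pE ?px ?mul0r //.
by rewrite /ok -pE p0; apply/asboolP.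
Qed.

End Dimension.

(** * Compactness in the characteristic *)

Section Realizable.
Variables s t r : nat.
Notation N := (s + (t + r))%N.
Variable S : seq 'X_{1..N}.

(** Contains the part of a stratum where the coordinates in [J] are independent on the critical
    cone; it depends on [f] alone, which suits the ultraproduct. *)
Definition crit_stratum (K : fieldType) (f : {mpoly K[N]}) (I : {set 'I_s}) (J : {set 'I_t}) :
    set ('I_r -> K) :=
  [set z | [/\ forall l, z l != 0,
    forall i, i \in I -> (mderiv (ix i) f).@[pt (fun _ : 'I_s => 0) (fun _ => 0) z] = 0 &
    indep_mod (vanish (crit_cone f z)) J]]%classic.

(** What a stratum provides over a finite field in which [1, ..., e] are invertible; only [S] is
    remembered of the support. *)
Definition realizable (I : {set 'I_s}) (J : {set 'I_t}) (J' : {set 'I_r}) (e : nat) :=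
  exists (K : closedFieldType) (F : finFieldType) (iota : {rmorphism F -> K}) (f : {mpoly F[N]}),
  [/\ forall n, (n < e)%N -> n.+1%:R != 0 :> K, msupp f =i S,
      log_nondegenerate S (map_mpoly iota f) &
      indep_mod (vanish (crit_stratum (map_mpoly iota f) I J)) J'].

Lemma realizableW I J J' e e' : (e' <= e)%N -> realizable I J J' e -> realizable I J J' e'.
Proof.
move=> le [K [F [iota [f [ch fS nd ind]]]]]; exists K, F, iota, f; split=> // n ne'.
by apply: ch; exact: leq_trans le.
Qed.

Lemma realizable_datum I J J' e : realizable I J J' e -> exists d, @good_datum s t r S I J J' e d.
Proof.
move=> [K [F [iota [f [ch fS nd ind]]]]].
have [z [z0 gz Cz] av] := indep_mod_avoid iota e ind.
by exists (Datum iota f z).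
Qed.

Variables (b : nat) (w : 'I_t -> nat).
Hypotheses (b_gt0 : (0 < b)%N) (w_bounds : forall j, (0 < w j < b)%N).
Hypotheses (uS : uniq S) (S_weight : in_hyperplane S (@weight s t r b w) b).

(** A triple realizable for every [e] has a cover by [ultra_core], so each triple without a cover
    fails from some [e] on. There are finitely many triples, and the maximum serves them all. *)
Lemma realizable_bound : exists e, forall (I : {set 'I_s}) (J : {set 'I_t}) (J' : {set 'I_r}),
  (forall i, i \in I -> exists2 m, m \in S & (0 < m (ix i))%N) ->
  realizable I J J' e -> weighted_cover S I J J'.
Proof.
have /choice[e he] (T : {set 'I_s} * {set 'I_t} * {set 'I_r}) : exists e,
    (forall i, i \in T.1.1 -> exists2 m, m \in S & (0 < m (ix i))%N) ->
    realizable T.1.1 T.1.2 T.2 e -> weighted_cover S T.1.1 T.1.2 T.2.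
  apply: contrapT => /forallNP no.
  have hI : forall i, i \in T.1.1 -> exists2 m, m \in S & (0 < m (ix i))%N.
    by have /not_implyP[] := no 0%N.
  have /not_implyP[_ /not_implyP[_]] := no 0%N; apply.
  apply: (ultra_core b_gt0 w_bounds) => // e; apply: realizable_datum.
  by have /not_implyP[_ /not_implyP[]] := no e.
exists (\max_T e T) => I J J' hI hR; apply: (he (I, J, J')) => //.
by apply: realizableW hR; exact: leq_bigmax.
Qed.

End Realizable.

Lemma partial_deriv_witness (s t r : nat) (F : fieldType) (h : {mpoly F[t + r]})
    (g : 'I_s -> {mpoly F[r]}) i :
  g i != 0 -> exists2 m, m \in msupp (partial_sum h g finset.setT) & (0 < m (ix i))%N.
Proof.
move=> gi; have d0 : mderiv (ix i) (partial_sum h g finset.setT) != 0.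
  rewrite partial_deriv_x; apply: contra_neq gi; apply: rename_eq0; exact: iz_inj.
have [m] : exists m, m \in msupp (mderiv (ix i) (partial_sum h g finset.setT)).
  by case E : (msupp _) => [|m ?]; [rewrite -msupp_eq0 E in d0 | exists m; rewrite inE eqxx].
rewrite mcoeff_msupp mcoeff_mderiv => n0; exists (m + U_(ix i))%MM.
  by rewrite mcoeff_msupp; apply: contraNneq n0 => ->; rewrite mul0rn.
by rewrite mnmDE mnm1E eqxx addn1.
Qed.

(** The set [J] obtained from a chain in the critical locus depends on [z]; the finitely many
    choices cover the stratum, and [J'] stays independent on the piece of one of them. *)
Lemma stratum_crit (s t r : nat) (R : realType) (F K : fieldType) (iota : {rmorphism F -> K})
    (h : {mpoly F[t + r]}) (g : 'I_s -> {mpoly F[r]}) I d k :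
  has_zchain (zclosure (stratum iota R h g I d)) k ->
  exists (J : {set 'I_t}) (J' : {set 'I_r}), [/\ #|J| = d, #|J'| = k &
    indep_mod (vanish (crit_stratum (map_mpoly iota (partial_sum h g finset.setT)) I J)) J'].
Proof.
move=> /zchain_indep[J' [cJ' /indep_mod_zclosure ind]].
set f := map_mpoly _ _.
pose Z (J : {set 'I_t}) := [set z | #|J| = d /\ crit_stratum f I J z]%classic.
have [z [z0 dz gz]|J ZJ] := indep_mod_cover (Z := Z) _ ind.
  have [J [cJ iJ]] := zchain_indep (zdim_zchain dz).
  exists J; split=> //; split=> // [i /gz|]; first by rewrite partial_deriv_x_eval.
  by rewrite -crit_locusE.
(* The condition [#|J| = d] is part of the definition of the piece, so a point of it is needed to
   extract the size. *)
have [z [cJ _]] := indep_mod_nonempty ZJ.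
by exists J, J'; split=> // p p0 sp vp; apply: ZJ sp _ => // x [_]; exact: vp.
Qed.

Theorem theorem4p2 (R : realType) (s t r : nat)
    (S : seq 'X_{1..(s + (t + r))}) (b : nat) (w : 'I_t -> nat)
    (r_gt0 : (0 < r)%N) (b_gt0 : (0 < b)%N)
    (w_bounds : forall j, (0 < w j < b)%N)
    (S_weight : in_hyperplane S (@weight s t r b w) b)
    (r_max : forall (c : 'I_(s + (t + r)) -> nat) (b' : nat),
       (0 < b')%N -> in_hyperplane S c b' ->
       (#|[pred i | c i == 0%N]| <= r)%N) :
  exists P : seq nat,
    [/\ all prime P, {subset primes b <= P} &
      forall (F : finFieldType) (K : closedFieldType)
        (iota : {rmorphism F -> K}) (p : nat)
        (f : {mpoly F[s + (t + r)]}) (h : {mpoly F[t + r]})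
        (g : 'I_s -> {mpoly F[r]}),
      integralRange iota ->
      p \in [pchar F] -> p \notin P ->
      msupp f =i S ->
      newton_nondegenerate R iota f ->
      (forall i, g i != 0) ->
      f = partial_sum h g (finset.setT) ->
      h != 0 ->
      forall (I : {set 'I_s}) (d : nat), (d <= t)%N ->
      (zdim R (zclosure (stratum iota R h g I d)) + ((t + d)%:R / 2)%:E
         + (#|I|%:R)%:E - ((s + (t + r))%:R)%:E
       <= - sigma R (partial_sum h g I) - (s%:R)%:E + (#|I|%:R)%:E)%E].
Proof.
pose S' := undup S; have uS : uniq S' := undup_uniq S.
have S'_weight : in_hyperplane S' (@weight s t r b w) b.
  by move=> m; rewrite mem_undup; exact: S_weight.
have [e he] := realizable_bound b_gt0 w_bounds uS S'_weight.
(* All primes up to [e + b]: the part up to [b] contains the divisors of [b], and a characteristic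
   above [e] keeps [1, ..., e] invertible. *)
exists [seq p <- iota 0 (e + b).+1 | prime p]; split; first exact: filter_all.
  move=> p; rewrite mem_primes mem_filter mem_iota add0n ltnS => /and3P[-> _ /dvdn_leq] /(_ b_gt0) pb.
  exact: leq_trans (leq_addl _ _).
move=> F K io p f h g _ pF; rewrite mem_filter mem_iota (pcharf_prime pF) add0n ltnS /= -ltnNge.
move=> ep fS nd g0 fE _ I d _.
have chK n : (n < e)%N -> n.+1%:R != 0 :> K.
  move=> ne; rewrite -(rmorph_nat io) fmorph_eq0 -(dvdn_pcharf pF); apply/negP => /dvdn_leq.
  by move=> /(_ isT); rewrite leqNgt (leq_ltn_trans (leq_trans ne (leq_addr b e))) //.
have fS' : msupp f =i S' by move=> m; rewrite mem_undup fS.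
have sig k : has_zchain (zclosure (stratum io R h g I d)) k ->
    (sigma R (partial_sum h g I) <= (r%:R + (t%:R - d%:R) / 2 - k%:R)%:E)%E.
  move=> /stratum_crit[J [J' [<- <- ind]]]; apply: (@sigma_cover _ _ _ S' I).
    apply: he => [i _|]; last first.
      exists K, F, io, f; split=> //; last by rewrite fE.
      exact: newton_log_nondegenerate nd.
    by have [m] := partial_deriv_witness h (g0 i); rewrite -fE fS'; exists m.
  by move=> m /partial_sum_supp; rewrite -fE fS'.
(* Without any chain the dimension is [-oo], and so is the left-hand side. *)
have [[k hk]|no] := pselect (exists k, has_zchain (zclosure (stratum io R h g I d)) k); last first.
  have -> : zdim R (zclosure (stratum io R h g I d)) = -oo%E.
    by apply/eqP; rewrite -leeNy_eq; apply: ub_ereal_sup => y [k hk _]; case: no; exists k.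
  by rewrite !addNye leNye.
(* The value [+oo] contradicts the bound just obtained, while [-oo] makes the right-hand side
   [+oo]. *)
have := sig k hk; case E : (sigma R _) => [s0| |] // _; last first.
  by rewrite leey.
have /(leeD2r (((t + d)%:R / 2)%:E + #|I|%:R%:E - (s + (t + r))%:R%:E)%E) :
    (zdim R (zclosure (stratum io R h g I d)) <= (r%:R + (t%:R - d%:R) / 2 - s0)%:E)%E.
  apply: ub_ereal_sup => _ [k' hk' <-]; have := sig k' hk'; rewrite E !lee_fin; lra.
rewrite !addeA => /le_trans; apply; rewrite -!EFinD lee_fin !natrD; lra.
Qed.
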